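(* Let $(p^1,\dots,p^n,\phi)$ be a solution of the weak Poisson–Nernst–Planck problem $$a(p^i,v)+b(p^i,\phi,v)=0\ \ \forall v\in H^1_0(\Omega),\ i=1,\dots,n,\qquad \widetilde a(\phi,w)=\Big(\sum_{i=1}^n q^ip^i+f,\,w\Big)\ \ \forall w\in H^1_0(\Omega),$$ and let $(p_h^1,\dots,p_h^n,\phi_h)$, with all components in $S_0^h$, be a solution of the finite element problem $$a(p_h^i,v_h)+b(p_h^i,\phi_h,v_h)=0\ \ \forall v_h\in S^h_0,\ i=1,\dots,n,\qquad \widetilde a(\phi_h,w_h)=\Big(\sum_{i=1}^n q^ip_h^i+f,\,w_h\Big)\ \ \forall w_h\in S_0^h .$$ Then $$\|\nabla(\phi-\phi_h)\|_{0,\Omega}\le C\Big(\eta_\phi(p_h^i,\phi_h)+\sum_{i=1}^n\|p^i-p_h^i\|_{0,\Omega}\Big),$$ where $$\eta_\phi(p_h^i,\phi_h)=\sum_{\tau\in\mathcal T^h}\Big(h_\tau\|R_{1h}(p_h^i,\phi_h)\|_{0,\tau}+\|D_h(\phi_h)\|_{0,\tau}\Big),$$ $$R_{1h}(p_h^i,\phi_h)=\sum_{i=1}^nq^ip_h^i+\operatorname{div}(G_h\phi_h)+f,\qquad D_h(\phi_h)=G_h\phi_h-\epsilon(x)\nabla\phi_h .$$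
   Context: $\Omega\subset\mathbb R^2$ is a bounded polygonal domain with Lipschitz boundary. $\|\cdot\|_{k,D}$ is the norm of $H^k(D)=W^{k,2}(D)$, and $\|\cdot\|_{0,D}$ is the $L^2(D)$ norm; $(\cdot,\cdot)$ is the $L^2(\Omega)$ inner product. The coefficients $\alpha:\bar\Omega\times\mathbb R\to\mathbb R$, $\beta:\bar\Omega\times\mathbb R\to\mathbb R^2$, $\gamma:\bar\Omega\times\mathbb R\to\mathbb R$, $g:\bar\Omega\times\mathbb R\to\mathbb R$, $\epsilon:\bar\Omega\to\mathbb R$ are smooth, with $0<\epsilon_0\le\epsilon(x)\le\epsilon_1$ for constants $\epsilon_0,\epsilon_1$; $q^1,\dots,q^n$ are real constants and $f$ is a given function. The forms are $$a(w,v)=(\alpha(\cdot,w)\nabla w+\beta(\cdot,w),\nabla v)+(g(\cdot,w),v),\quad b(w,\psi,v)=(\gamma(\cdot,w)\nabla\psi,\nabla v),\quad \widetilde a(w,v)=(\epsilon\nabla w,\nabla v).$$ These are the weak forms of $-\nabla\cdot(\alpha(x,p^i)\nabla p^i+\beta(x,p^i)+\gamma(x,p^i)\nabla\phi)+g(x,p^i)=0$, $-\nabla\cdot(\epsilon\nabla\phi)-\sum_iq^ip^i=f$ in $\Omega$, $p^i=\phi=0$ on $\partial\Omega$. Standing assumptions on the solution: $\phi\in H_0^1(\Omega)\cap W^{1,\infty}(\Omega)$, $p^i\in H^1_0(\Omega)\cap W^{1,p}(\Omega)$ for some $p>2$; there is a constant $C>0$ with $\xi^T\alpha(x,p^i)\xi\ge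 C^{-1}|\xi|^2$ for all $\xi\in\mathbb R^2$, $x\in\bar\Omega$; and the linearized operator $\mathcal L'(p^i,\phi):H_0^1(\Omega)\to H^{-1}(\Omega)$ is an isomorphism, where $\mathcal L'(w,\phi)\psi=-\operatorname{div}(\alpha(\cdot,w)\nabla\psi+(\alpha_y(\cdot,w)\nabla w+\beta_y(\cdot,w))\psi)+g_y(\cdot,w)\psi-\operatorname{div}(\gamma_y(\cdot,w)\nabla\phi)\psi$ (subscript $y$: derivative in the second variable). $\mathcal T^h$ is a shape-regular triangulation of $\Omega$ into triangles $\tau$ with diameters $h_\tau$, $h=\max h_\tau$; $S^h$ is the space of functions in $H^1(\Omega)$ that are linear on every $\tau$, $S_0^h=S^h\cap H_0^1(\Omega)$; $\varphi_z$ are the nodal basis functions of $S^h$, with $z$ ranging over the set $\partial^2\mathcal T^h$ of all vertices. For a vertex $z$, let $\tau_z^1,\dots,\tau_z^{J_z}$ be the triangles whose closure contains $z$, and fix weights $\alpha_z^j\ge0$, $\sum_{j=1}^{J_z}\alpha_z^j=1$ (e.g. $\alpha_z^j=1/J_z$). The local averaging (flux recovery) operator applied to $\phi_h$ uses the coefficient $\epsilon$: $$G_h\phi_h=\sum_{z\in\partial^2\mathcal T^h}\Big(\sum_{j=1}^{J_z}\alpha_z^j\,\epsilon(z)\,(\nabla\phi_h)|_{\tau_z^j}\Big)\varphi_z\in S^h\times S^h.$$ Arguments written $p_h^i$ in $\eta_\phi$ and $R_{1h}$ stand for $(p_h^1,\dots,p_h^n)$. $C$ denotes a generic positive constant independent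 of the mesh parameters. *)

(* Defs.v *)
From HB Require Import structures.
From mathcomp Require Import all_boot all_order all_algebra.
From mathcomp Require Import all_classical all_reals all_analysis.
Set Implicit Arguments.
Unset Strict Implicit.
Unset Printing Implicit Defensive.
Import Order.TTheory GRing.Theory Num.Theory numFieldNormedType.Exports.
Local Open Scope classical_set_scope.
Local Open Scope ring_scope.

Notation plane R := (R * R)%type.

(* The library norm on R * R is the max norm (same topology); Euclidean lengths
   are always taken with vnorm. *)
Definition dot (R : realType) (u v : plane R) : R := u.1 * v.1 + u.2 * v.2.
Definition vnorm (R : realType) (u : plane R) : R := Num.sqrt (dot u u).

(* The plane as the library's product of two Borel lines: the Lebesgue measure
   lives on measurableTypeR R, whose carrier is R. *)
Notation mplane R := (measurableTypeR R * measurableTypeR R)%type.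

Definition mu2 (R : realType) : {measure set (mplane R) -> \bar R} :=
  (@lebesgue_measure R \x @lebesgue_measure R)%E.

Fixpoint Ck (R : realType) (V W : normedModType R) (k : nat) (f : V -> W) : Prop :=
  continuous f /\
  match k with
  | 0%N => True
  | k'.+1 => forall v : V,
      (forall x, derivable f x v) /\ Ck k' (fun x => 'D_v f x : W)
  end.

Definition smooth (R : realType) (V W : normedModType R) (f : V -> W) : Prop :=
  forall k, Ck k f.

(* On a set that need not be open, smooth means: restriction of a smooth
   function defined on the whole space. *)
Definition smooth_on (R : realType) (V W : normedModType R) (D : set V)
    (f : V -> W) : Prop :=
  exists F : V -> W, smooth F /\ forall x, D x -> f x = F x.

Definition segment (R : realType) (a b : plane R) : set (plane R) :=
  [set (1 - s) *: a + s *: b | s in `[0, 1]%classic].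

Definition bdry (R : realType) (A : set (plane R)) : set (plane R) :=
  closure A `\` A°.

(* Near each boundary point x0, in some orthonormal frame (e1, e2), the set is
   the strict epigraph of a Lipschitz function. *)
Definition lipschitz_boundary (R : realType) (A : set (plane R)) : Prop :=
  forall x0, bdry A x0 ->
    exists (e1 e2 : plane R) (h : R -> R) (L : R),
      [/\ dot e1 e1 = 1, dot e2 e2 = 1, dot e1 e2 = 0,
          (forall s s', `|h s - h s'| <= L * `|s - s'|) &
          \forall x \near x0, A x <-> h (dot x e1) < dot x e2].

Definition polygonal_boundary (R : realType) (A : set (plane R)) : Prop :=
  exists s : seq (plane R * plane R),
    bdry A = \bigcup_(ab in [set` s]) segment ab.1 ab.2.

Definition polygonal_lipschitz_domain (R : realType) (A : set (plane R)) : Prop :=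
  [/\ open A, A !=set0, connected A & bounded_set A] /\
  polygonal_boundary A /\ lipschitz_boundary A.

(* Functions are total on the plane; only their values on D matter, and
   elements of the spaces below are functions, not classes. *)
Definition Lp (R : realType) (D : set (plane R)) (p : \bar R) (u : plane R -> R)
  : Prop := u \_ D \in Lfun (mu2 R) p.

Definition L2norm (R : realType) (D : set (plane R)) (u : plane R -> R) : \bar R :=
  'N[mu2 R]_2%:E[EFin \o (u \_ D)].

Definition L2vnorm (R : realType) (D : set (plane R)) (F : plane R -> plane R)
  : \bar R := L2norm D (fun x => vnorm (F x)).

Definition locally_integrable2 (R : realType) (D : set (plane R))
    (u : plane R -> R) : Prop :=
  measurable_fun D (u : mplane R -> R) /\
  forall K, K `<=` D -> compact K ->
    ((\int[mu2 R]_(x in K) `|u x|%:E)%E < +oo)%E.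

Definition test_function (R : realType) (D : set (plane R)) (psi : plane R -> R)
  : Prop :=
  smooth (psi : _ -> R^o) /\
  exists K, [/\ compact K, K `<=` D & forall x, ~ K x -> psi x = 0].

Definition is_weak_grad (R : realType) (D : set (plane R)) (u : plane R -> R)
    (G : plane R -> plane R) : Prop :=
  [/\ locally_integrable2 D u, locally_integrable2 D (fun x => (G x).1),
      locally_integrable2 D (fun x => (G x).2) &
      forall psi, test_function D psi -> forall e : plane R,
        (\int[mu2 R]_(x in D) (u x * 'D_e (psi : _ -> R^o) x)) =
        - (\int[mu2 R]_(x in D) (dot (G x) e * psi x))].

(* A weak gradient of u on D, unique up to a null subset of D when one exists. *)
Definition wgrad (R : realType) (D : set (plane R)) (u : plane R -> R)
  : plane R -> plane R :=
  xget (fun=> (0, 0)) [set G | is_weak_grad D u G].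

Definition wdiv (R : realType) (D : set (plane R)) (F : plane R -> plane R)
  : plane R -> R :=
  fun x => (wgrad D (fun y => (F y).1) x).1 + (wgrad D (fun y => (F y).2) x).2.

Definition W1 (R : realType) (D : set (plane R)) (p : \bar R) (u : plane R -> R)
  : Prop :=
  Lp D p u /\
  exists G, [/\ is_weak_grad D u G, Lp D p (fun x => (G x).1) &
                Lp D p (fun x => (G x).2)].

Definition H1 (R : realType) (D : set (plane R)) (u : plane R -> R) : Prop :=
  W1 D 2%:E u.

(* Only meaningful on H1 D, where both terms are finite. *)
Definition H1norm (R : realType) (D : set (plane R)) (u : plane R -> R) : R :=
  Num.sqrt (fine (L2norm D u) ^+ 2 + fine (L2vnorm D (wgrad D u)) ^+ 2).

Definition H10 (R : realType) (D : set (plane R)) (u : plane R -> R) : Prop :=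
  H1 D u /\
  forall e : R, 0 < e ->
    exists2 psi, test_function D psi & H1norm D (fun x => u x - psi x) < e.

Definition Hm1 (R : realType) (D : set (plane R)) (l : (plane R -> R) -> R)
  : Prop :=
  (forall (c : R) u v, H10 D u -> H10 D v ->
     l (fun x => c * u x + v x) = c * l u + l v) /\
  exists K : R, forall v, H10 D v -> `|l v| <= K * H1norm D v.

Definition Hm1norm (R : realType) (D : set (plane R)) (l : (plane R -> R) -> R)
  : R := sup [set `|l v| | v in [set v | H10 D v /\ H1norm D v <= 1]].

(* The operator psi |-> B psi, where B psi v is the duality pairing of the image
   of psi with v, is a Banach space isomorphism of H10 onto Hm1. *)
Definition isomorphism_H10_Hm1 (R : realType) (D : set (plane R))
    (B : (plane R -> R) -> (plane R -> R) -> R) : Prop :=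
  [/\ (forall psi, H10 D psi -> Hm1 D (B psi)),
      (forall (c : R) psi chi v, H10 D psi -> H10 D chi -> H10 D v ->
         B (fun x => c * psi x + chi x) v = c * B psi v + B chi v),
      (forall l, Hm1 D l ->
         exists2 psi, H10 D psi & forall v, H10 D v -> B psi v = l v),
      (exists M : R, forall psi, H10 D psi ->
         Hm1norm D (B psi) <= M * H1norm D psi) &
      (exists M : R, forall psi, H10 D psi ->
         H1norm D psi <= M * Hm1norm D (B psi))].

Definition ip (R : realType) (D : set (plane R)) (u v : plane R -> R) : R :=
  \int[mu2 R]_(x in D) (u x * v x).

Definition ipv (R : realType) (D : set (plane R)) (F G : plane R -> plane R) : R :=
  \int[mu2 R]_(x in D) dot (F x) (G x).

Definition form_a (R : realType) (D : set (plane R)) (alpha : plane R -> R -> R)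
    (beta : plane R -> R -> plane R) (g : plane R -> R -> R)
    (w v : plane R -> R) : R :=
  ipv D (fun x => alpha x (w x) *: wgrad D w x + beta x (w x)) (wgrad D v)
  + ip D (fun x => g x (w x)) v.

Definition form_b (R : realType) (D : set (plane R)) (gamma : plane R -> R -> R)
    (w psi v : plane R -> R) : R :=
  ipv D (fun x => gamma x (w x) *: wgrad D psi x) (wgrad D v).

Definition form_ta (R : realType) (D : set (plane R)) (eps : plane R -> R)
    (w v : plane R -> R) : R :=
  ipv D (fun x => eps x *: wgrad D w x) (wgrad D v).

(* Duality pairing with v of
     - div (alpha(.,w) grad psi + (alpha_y(.,w) grad w + beta_y(.,w)) psi)
     + g_y(.,w) psi - div (gamma_y(.,w) grad phi) psi,
   the last term being the product of the distribution div F,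
   F = gamma_y(.,w) grad phi, with the function psi:
   <- (div F) psi, v> = <- div F, psi v> = (F, grad (psi v)). *)
Definition form_L' (R : realType) (D : set (plane R)) (alpha : plane R -> R -> R)
    (beta : plane R -> R -> plane R) (gamma g : plane R -> R -> R)
    (w phi psi v : plane R -> R) : R :=
  ipv D (fun x => alpha x (w x) *: wgrad D psi x
                  + psi x *: (derive1 (alpha x) (w x) *: wgrad D w x
                              + derive1 (beta x) (w x)))
        (wgrad D v)
  + ip D (fun x => derive1 (g x) (w x) * psi x) v
  + ipv D (fun x => derive1 (gamma x) (w x) *: wgrad D phi x)
          (wgrad D (fun x => psi x * v x)).

(* A triangle is given by its three vertices; face t I is the convex hull of
   those with index in I (empty for I = set0). *)
Definition face (R : realType) (t : 'I_3 -> plane R) (I : {set 'I_3})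
  : set (plane R) :=
  [set x | exists lam : 'I_3 -> R,
     [/\ forall i, 0 <= lam i, forall i, i \notin I -> lam i = 0,
         \sum_i lam i = 1 & x = \sum_i lam i *: t i]].

Definition triangle (R : realType) (t : 'I_3 -> plane R) : set (plane R) :=
  face t [set: 'I_3]%SET.

Definition nondegenerate (R : realType) (t : 'I_3 -> plane R) : Prop :=
  let u := t 1 - t 0 in let v := t 2%:R - t 0 in u.1 * v.2 - u.2 * v.1 != 0.

(* The closed triangles cover the closure of D, and two distinct ones meet in
   a proper (possibly empty) common face. *)
Definition triangulation (R : realType) (D : set (plane R)) (m : nat)
    (t : 'I_m -> 'I_3 -> plane R) : Prop :=
  [/\ forall k, nondegenerate (t k),
      \bigcup_k triangle (t k) = closure D &
      forall k l, k != l -> exists I J : {set 'I_3},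
        [/\ I != [set: 'I_3]%SET, J != [set: 'I_3]%SET,
            triangle (t k) `&` triangle (t l) = face (t k) I &
            triangle (t k) `&` triangle (t l) = face (t l) J]].

Definition diam (R : realType) (A : set (plane R)) : R :=
  sup [set vnorm (x.1 - x.2) | x in A `*` A].

Definition indiam (R : realType) (A : set (plane R)) : R :=
  sup [set r *+ 2 | r in [set r | 0 <= r /\
         exists c, forall x, vnorm (x - c) < r -> A x]].

Definition shape_regular (R : realType) (sigma : R) (m : nat)
    (t : 'I_m -> 'I_3 -> plane R) : Prop :=
  forall k, diam (triangle (t k)) <= sigma * indiam (triangle (t k)).

Definition vertices (R : realType) (m : nat) (t : 'I_m -> 'I_3 -> plane R)
  : seq (plane R) :=
  undup [seq t ki.1 ki.2 | ki : 'I_m * 'I_3].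

Definition slope_on (R : realType) (A : set (plane R)) (v : plane R -> R)
    (c : plane R) : Prop :=
  forall x y, A x -> A y -> v y - v x = dot c (y - x).

Definition linear_on (R : realType) (A : set (plane R)) (v : plane R -> R)
  : Prop := exists c, slope_on A v c.

(* The constant gradient on a nondegenerate triangle A of a v linear on A. *)
Definition grad_on (R : realType) (A : set (plane R)) (v : plane R -> R)
  : plane R := xget (0, 0) [set c | slope_on A v c].

(* Linearity is imposed on the closed triangles, which selects the continuous
   representative. *)
Definition Sh (R : realType) (D : set (plane R)) (m : nat)
    (t : 'I_m -> 'I_3 -> plane R) (v : plane R -> R) : Prop :=
  H1 D v /\ forall k, linear_on (triangle (t k)) v.

Definition Sh0 (R : realType) (D : set (plane R)) (m : nat)
    (t : 'I_m -> 'I_3 -> plane R) (v : plane R -> R) : Prop :=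
  Sh D t v /\ H10 D v.

(* Unique on the closure of D; unspecified (and irrelevant) elsewhere. *)
Definition nodal (R : realType) (D : set (plane R)) (m : nat)
    (t : 'I_m -> 'I_3 -> plane R) (z : plane R) : plane R -> R :=
  xget (fun=> 0) [set v | Sh D t v /\
    forall z', z' \in vertices t -> v z' = (z' == z)%:R].

(* wt z k is the weight attached to the vertex z and to the k-th triangle; it
   is relevant only if that triangle contains z. *)
Definition averaging_weights (R : realType) (m : nat)
    (t : 'I_m -> 'I_3 -> plane R) (wt : plane R -> 'I_m -> R) : Prop :=
  forall z, z \in vertices t ->
    (forall k, z \in triangle (t k) -> 0 <= wt z k) /\
    \sum_(k < m | z \in triangle (t k)) wt z k = 1.

Definition Gh (R : realType) (D : set (plane R)) (m : nat)
    (t : 'I_m -> 'I_3 -> plane R) (wt : plane R -> 'I_m -> R)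
    (eps : plane R -> R) (v : plane R -> R) : plane R -> plane R :=
  fun x => \sum_(z <- vertices t)
    nodal D t z x *:
      \sum_(k < m | z \in triangle (t k))
         (wt z k * eps z) *: grad_on (triangle (t k)) v.

Definition R1h (R : realType) (D : set (plane R)) (m : nat)
    (t : 'I_m -> 'I_3 -> plane R) (wt : plane R -> 'I_m -> R)
    (eps : plane R -> R) (n : nat) (q : 'I_n -> R) (f : plane R -> R)
    (ph : 'I_n -> plane R -> R) (phih : plane R -> R) : plane R -> R :=
  fun x => \sum_(i < n) q i * ph i x + wdiv D (Gh D t wt eps phih) x + f x.

Definition Dh (R : realType) (D : set (plane R)) (m : nat)
    (t : 'I_m -> 'I_3 -> plane R) (wt : plane R -> 'I_m -> R)
    (eps : plane R -> R) (phih : plane R -> R) : plane R -> plane R :=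
  fun x => Gh D t wt eps phih x - eps x *: wgrad D phih x.

(* Norms are taken on the open triangles, which are subsets of D. *)
Definition eta_phi (R : realType) (D : set (plane R)) (m : nat)
    (t : 'I_m -> 'I_3 -> plane R) (wt : plane R -> 'I_m -> R)
    (eps : plane R -> R) (n : nat) (q : 'I_n -> R) (f : plane R -> R)
    (ph : 'I_n -> plane R -> R) (phih : plane R -> R) : \bar R :=
  (\sum_(k < m)
     ((diam (triangle (t k)))%:E
        * L2norm (triangle (t k))° (R1h D t wt eps q f ph phih)
      + L2vnorm (triangle (t k))° (Dh D t wt eps phih)))%E.

Definition weak_PNP (R : realType) (D : set (plane R)) (alpha : plane R -> R -> R)
    (beta : plane R -> R -> plane R) (gamma g : plane R -> R -> R)
    (eps : plane R -> R) (n : nat) (q : 'I_n -> R) (f : plane R -> R)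
    (V : (plane R -> R) -> Prop)
    (p : 'I_n -> plane R -> R) (phi : plane R -> R) : Prop :=
  [/\ forall i, V (p i), V phi,
      forall i v, V v -> form_a D alpha beta g (p i) v
                         + form_b D gamma (p i) phi v = 0 &
      forall w, V w -> form_ta D eps phi w
                       = ip D (fun x => \sum_(i < n) q i * p i x + f x) w].

(* Pointwise values of p i on
   the closure of D are those of its continuous representative pc i, which
   exists because p i is in W^{1,s} for some s > 2. *)
Definition solution_regularity (R : realType) (D : set (plane R))
    (alpha : plane R -> R -> R) (beta : plane R -> R -> plane R)
    (gamma g : plane R -> R -> R)
    (n : nat) (p : 'I_n -> plane R -> R) (phi : plane R -> R) : Prop :=
  [/\ H10 D phi /\ W1 D +oo%E phi,
      exists2 s : R, 2 < s & forall i, H10 D (p i) /\ W1 D s%:E (p i),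
      exists pc : 'I_n -> plane R -> R,
        (forall i, {within closure D, continuous (pc i)} /\
                   {ae mu2 R, forall x, D x -> p i x = pc i x}) /\
        exists2 C : R, 0 < C & forall i x (xi : plane R), closure D x ->
          C^-1 * vnorm xi ^+ 2 <= dot xi (alpha x (pc i x) *: xi) &
      forall i, isomorphism_H10_Hm1 D (form_L' D alpha beta gamma g (p i) phi)].

(* Main.v *)
(* The functional F(v) = (R1h, v) + (Dh, grad v) is, after integrating div (Gh phih) by parts, the
   residual of the potential equation minus (sum_i q i (p i - ph i), v); by Galerkin orthogonality it
   vanishes on Sh0.  For a test function psi one subtracts an interpolant v in Sh0 with
   |psi - v| <= C h |grad psi| and |grad (psi - v)| <= C |grad psi| in L2 of every triangle, with the
   global energy of psi on the right, since eta_phi is a sum of unsquared norms.  Coercivity of the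
   form with coefficient eps and density of the test functions in H10 conclude.

   The nodal value of v at a vertex z is the value of psi at a point provided by the Poincare
   inequality on a square around z; it is 0 if v would otherwise fail to vanish on the boundary, and
   then a square outside the domain, given by the Lipschitz boundary, yields Friedrichs' inequality
   instead.  Triangles sharing a vertex in the domain have comparable diameters because their number
   is bounded by an area argument and neighbours share an edge.  The interpolant is Lipschitz and
   vanishes off the domain, so soft thresholding followed by mollification puts it in H10. *)
Require Import Defs.
From HB Require Import structures.
From mathcomp Require Import all_boot all_order all_algebra.
From mathcomp Require Import all_classical all_reals all_analysis.
From mathcomp Require Import measurable_realfun ring lra.
Set Implicit Arguments.
Unset Strict Implicit.
Unset Printing Implicit Defensive.
Import Order.TTheory GRing.Theory Num.Theory numFieldNormedType.Exports.
Local Open Scope classical_set_scope.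
Local Open Scope ring_scope.

(** * Lebesgue measure of the plane *)

Section plane_measure.
Variable R : realType.
Implicit Types (A D : set (plane R)).

(** The local estimates are proved for a test function psi, because they evaluate psi at points and
    integrate its classical derivatives along segments; coercivity and density transfer them to the
    error only at the end. The energy of psi is always bounded strictly by a parameter K: a line
    carrying at most the average energy is found by contradiction, and the strict bound covers the
    case of zero energy. The value attached to a vertex must be common to all triangles around it,
    so its square has to contain them all, which is affordable only if their diameters are
    comparable. Comparability comes from turning around the vertex inside the domain, through common
    edges, which is possible at a vertex of the domain. At a vertex outside it the value is 0, and
    each triangle can use a square of its own size. Weak gradients are chosen by [xget], so
    identities between them hold almost everywhere, by uniqueness. *)

Definition box (a b : plane R) : set (plane R) := `]a.1, b.1[ `*` `]a.2, b.2[.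

Definition cbox (a b : plane R) : set (plane R) :=
  `[a.1, b.1] `*` `[a.2, b.2].

Lemma box_cbox (a b : plane R) : box a b `<=` cbox a b.
Proof.
move=> x [] /=; rewrite /cbox /= !in_itv/= => /andP[? ?] /andP[? ?].
by rewrite !ltW.
Qed.

Lemma box_measurable (a b : plane R) : measurable (box a b : set (mplane R)).
Proof. by apply: measurableX; exact: measurable_itv. Qed.

Lemma box_open (a b : plane R) : open (box a b).
Proof.
have -> : box a b = (fst @^-1` `]a.1, b.1[) `&` (snd @^-1` `]a.2, b.2[) by [].
apply: openI.
  by apply: open_comp => [x _|]; [exact: cvg_fst|exact: interval_open].
by apply: open_comp => [x _|]; [exact: cvg_snd|exact: interval_open].
Qed.

Lemma mu2_box (a b : plane R) : a.1 <= b.1 -> a.2 <= b.2 ->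
  mu2 R (box a b) = ((b.1 - a.1) * (b.2 - a.2))%:E.
Proof.
move=> h1 h2;
have H (r s : R) : r <= s -> @lebesgue_measure R `]r, s[ = (s - r)%:E.
  rewrite lebesgue_measure_itv/= lte_fin EFinB; case: ltgtP => // ->.
  by rewrite subee.
rewrite /mu2 /box EFinM -!H//.
by apply: product_measure1E; exact: measurable_itv.
Qed.

Definition rat_box (q : (rat * rat) * (rat * rat)) : set (plane R) :=
  box (ratr q.1.1, ratr q.1.2) (ratr q.2.1, ratr q.2.2).

(** The closed box is controlled, and not only the open one, because the fundamental lemma below
    uses rational boxes whose compact closure lies in the domain. *)
Lemma rat_box_nbhs (x : plane R) (e : R) : 0 < e ->
  exists q, rat_box q x /\
    cbox (ratr q.1.1, ratr q.1.2) (ratr q.2.1, ratr q.2.2) `<=` [set y | `|y.1 - x.1| < e /\ `|y.2 - x.2| < e].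
Proof.
move=> e0.
have H (r : R) : exists a b : rat, [/\ r - e < ratr a, ratr a < r, r < ratr b & ratr b < r + e].
  have [a /andP[a1 a2]] : exists a : rat, ratr a \in `]r - e, r[.
    by apply: rat_in_itvoo; lra.
  have [b /andP[b1 b2]] : exists b : rat, ratr b \in `]r, r + e[.
    by apply: rat_in_itvoo; lra.
  by exists a, b; rewrite !bnd_simp in a1 a2 b1 b2.
have [a [b [h1 h2 h3 h4]]] := H x.1.
have [c [d [k1 k2 k3 k4]]] := H x.2.
exists ((a, c), (b, d)); rewrite /rat_box /box /cbox /=; split.
  by rewrite !in_itv /= h2 h3 k2 k3.
move=> y /= []; rewrite !in_itv /= => /andP[? ?] /andP[? ?].
by rewrite !ltr_norml; split; apply/andP; split; lra.
Qed.

Lemma nbhs_plane (x : plane R) A : nbhs x A <->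
  exists2 e : R, 0 < e & [set y | `|y.1 - x.1| < e /\ `|y.2 - x.2| < e] `<=` A.
Proof.
split.
  move=> /nbhs_ballP[e /= e0 eA]; exists e => // y [y1 y2]; apply: eA.
  by split; rewrite /ball /= distrC.
move=> [e e0 eA]; apply/nbhs_ballP; exists e => // y [y1 y2]; apply: eA.
by rewrite /ball /= in y1 y2; split; rewrite distrC.
Qed.

Lemma open_rat_boxes A : open A ->
  A = \bigcup_(q in [set q | rat_box q `<=` A]) rat_box q.
Proof.
move=> oA; apply/seteqP; split => x; last by move=> [q qA qx]; exact: qA.
move=> Ax; have /nbhs_plane[e e0 eA] : nbhs x A by exact: open_nbhs_nbhs.
have [q [qx qe]] := rat_box_nbhs x e0.
by exists q => //; apply: subset_trans eA; apply: subset_trans qe; exact: box_cbox.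
Qed.

Lemma open_mplane A : open A -> measurable (A : set (mplane R)).
Proof.
move=> /open_rat_boxes ->; rewrite bigcup_mkcond.
apply: countable_bigcupT_measurable; first exact: countableP.
by move=> q; case: ifPn => // _; exact: box_measurable.
Qed.

Lemma closed_mplane A : closed A -> measurable (A : set (mplane R)).
Proof. by move/closed_openC/open_mplane/measurableC; rewrite setCK. Qed.

(** Measurability is tested on open intervals, whose preimages are open and hence countable unions
    of rational boxes. *)
Lemma continuous_mplane D (f : plane R -> R) :
  continuous (f : _ -> R^o) -> measurable_fun D (f : mplane R -> R).
Proof.
move=> cf; apply: (@measurable_funS _ _ _ _ setT) => //.
apply: (measurability _ (measurable_realfun.RGenOpens.measurableE R)).
move=> _ [_ [a [b ->] <-]]; rewrite setTI; apply: open_mplane.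
by move/continuousP : cf; apply; exact: interval_open.
Qed.

End plane_measure.

(** * Square-integrable functions *)

Section square_integrable.
Context d (T : measurableType d) (R : realType) (mu : {measure set T -> \bar R}).
Implicit Types (D : set T) (f g : T -> R).

Lemma integrableRD D f g : measurable D -> mu.-integrable D (EFin \o f) ->
  mu.-integrable D (EFin \o g) ->
  mu.-integrable D (EFin \o (fun x => f x + g x)).
Proof.
move=> mD If Ig.
rewrite (_ : EFin \o _ = (EFin \o f) \+ (EFin \o g))%E//; exact: integrableD.
Qed.

Lemma integrableRZ D (c : R) f : measurable D -> mu.-integrable D (EFin \o f) ->
  mu.-integrable D (EFin \o (fun x => c * f x)).
Proof.
move=> mD If.
rewrite (_ : EFin \o _ = (fun x => c%:E * (EFin \o f) x))%E//.
exact: integrableZl.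
Qed.

(** Finiteness is asserted in the extended reals, separately from the real-valued [nsq]: an infinite
    integral would be sent to 0 by [fine], so [nsq] alone carries no information. *)
Definition sqint D f := measurable_fun D f /\
  (\int[mu]_(x in D) (f x ^+ 2)%:E < +oo)%E.

Definition nsq D f : R := \int[mu]_(x in D) (f x ^+ 2).

Lemma nsq_ge0 D f : 0 <= nsq D f.
Proof. by apply: Rintegral_ge0 => x _; exact: sqr_ge0. Qed.

Lemma sqint_sqr D f : measurable D -> sqint D f ->
  mu.-integrable D (EFin \o (fun x => f x ^+ 2)).
Proof.
move=> mD [mf ff]; apply/integrableP; split.
  by apply/measurable_EFinP; exact: measurable_funX.
apply: le_lt_trans ff; rewrite le_eqVlt; apply/orP; left; apply/eqP.
by apply: eq_integral => x _ /=; rewrite ger0_norm// sqr_ge0.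
Qed.

Lemma sqint_mul D f g : measurable D -> sqint D f -> sqint D g ->
  mu.-integrable D (EFin \o (fun x => f x * g x)).
Proof.
move=> mD sf sg.
apply: (@le_integrable _ _ _ mu D mD _
  (EFin \o (fun x => f x ^+ 2 + g x ^+ 2))).
- apply/measurable_EFinP; apply: measurable_funM; [exact: sf.1|exact: sg.1].
- move=> x _ /=; rewrite lee_fin normrM [leRHS]ger0_norm; last first.
    by rewrite addr_ge0// sqr_ge0.
  rewrite -(real_normK (num_real (f x))) -(real_normK (num_real (g x))).
  have := sqr_ge0 (`|f x| - `|g x|); have := normr_ge0 (f x).
  have := normr_ge0 (g x); nra.
- by apply: integrableRD => //; exact: sqint_sqr.
Qed.

Lemma sqintP D f : measurable D -> measurable_fun D f ->
  mu.-integrable D (EFin \o (fun x => f x ^+ 2)) -> sqint D f.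
Proof.
move=> mD mf /integrableP[_ fy]; split => //; apply: le_lt_trans fy.
rewrite le_eqVlt; apply/orP; left; apply/eqP.
by apply: eq_integral => x _ /=; rewrite ger0_norm// sqr_ge0.
Qed.

Lemma sqintZ D (c : R) f : measurable D -> sqint D f ->
  sqint D (fun x => c * f x).
Proof.
move=> mD sf; apply: sqintP => //; first by apply: measurable_funM => //; exact: sf.1.
under eq_fun do rewrite exprMn.
by apply: integrableRZ => //; exact: sqint_sqr.
Qed.

Lemma sqintD D f g : measurable D -> sqint D f -> sqint D g ->
  sqint D (fun x => f x + g x).
Proof.
move=> mD sf sg; have mfg : measurable_fun D (fun x => f x + g x).
  by apply: measurable_funD; [exact: sf.1|exact: sg.1].
split => //.
have /integrableP[_] : mu.-integrable D
    (EFin \o (fun x => 2 * f x ^+ 2 + 2 * g x ^+ 2)).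
  by apply: integrableRD => //; apply: integrableRZ => //; exact: sqint_sqr.
apply: le_lt_trans; apply: ge0_le_integral => //.
- by move=> x _; rewrite lee_fin sqr_ge0.
- by apply/measurable_EFinP; exact: measurable_funX.
- apply: measurableT_comp => //; apply/measurable_EFinP.
  by apply: measurable_funD; apply: measurable_funM => //;
    apply: measurable_funX; [exact: sf.1|exact: sg.1].
- move=> x _ /=; rewrite lee_fin ger0_norm; last first.
    by rewrite addr_ge0// mulr_ge0// sqr_ge0.
  by have := sqr_ge0 (f x - g x); nra.
Qed.

Lemma sqintN D f : measurable D -> sqint D f -> sqint D (fun x => - f x).
Proof.
move=> mD /(sqintZ (-1) mD); by under eq_fun do rewrite mulN1r.
Qed.

Lemma sqintB D f g : measurable D -> sqint D f -> sqint D g ->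
  sqint D (fun x => f x - g x).
Proof. by move=> mD sf sg; apply: sqintD => //; exact: sqintN. Qed.

Lemma sqint0 D : measurable D -> sqint D (fun=> 0).
Proof.
move=> mD; split => //; under eq_integral do rewrite expr0n/=.
by rewrite integral0.
Qed.

Lemma sqint_sum (I : Type) (s : seq I) D (F : I -> T -> R) : measurable D ->
  (forall i, sqint D (F i)) -> sqint D (fun x => \sum_(i <- s) F i x).
Proof.
move=> mD sF; elim: s => [|i s IH].
  by under eq_fun do rewrite big_nil; exact: sqint0.
by under eq_fun do rewrite big_cons; exact: sqintD.
Qed.

Lemma sqint_le D f g : measurable D -> measurable_fun D f -> sqint D g ->
  (forall x, D x -> `|f x| <= `|g x|) -> sqint D f.
Proof.
move=> mD mf sg fg; split => //; apply: le_lt_trans sg.2.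
apply: ge0_le_integral => //.
- by move=> x _; rewrite lee_fin sqr_ge0.
- by apply/measurable_EFinP; exact: measurable_funX.
- by apply/measurable_EFinP; apply: measurable_funX; exact: sg.1.
- move=> x Dx; rewrite lee_fin -(real_normK (num_real (f x))).
  by rewrite -(real_normK (num_real (g x))) lerXn2r// ?nnegrE// fg.
Qed.

Lemma sqint_abs D f : measurable D -> sqint D f -> sqint D (fun x => `|f x|).
Proof.
move=> mD sf; apply: sqint_le (sf) _ => //; last by move=> x _; rewrite normr_id.
by apply: measurableT_comp => //; exact: sf.1.
Qed.

Lemma sqintS D E f : measurable D -> measurable E -> E `<=` D -> sqint D f ->
  sqint E f.
Proof.
move=> mD mE ED sf; split; first by apply: measurable_funS sf.1.
apply: le_lt_trans sf.2; apply: ge0_subset_integral => //.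
  by apply/measurable_EFinP; apply: measurable_funX; exact: sf.1.
by move=> x _; rewrite lee_fin sqr_ge0.
Qed.

Lemma nsqS D E f : measurable D -> measurable E -> E `<=` D -> sqint D f ->
  nsq E f <= nsq D f.
Proof.
move=> mD mE ED sf; rewrite /nsq /Rintegral fine_le//.
- by apply: integrable_fin_num => //; apply: sqint_sqr => //; exact: sqintS sf.
- by apply: integrable_fin_num => //; exact: sqint_sqr.
apply: ge0_subset_integral => //.
  by apply/measurable_EFinP; apply: measurable_funX; exact: sf.1.
by move=> x _; rewrite lee_fin sqr_ge0.
Qed.

Lemma nsqE D f : measurable D -> sqint D f ->
  (\int[mu]_(x in D) (f x ^+ 2)%:E)%E = (nsq D f)%:E.
Proof.
by move=> mD sf; rewrite /nsq /Rintegral fineK//; apply: integrable_fin_num => //; exact: sqint_sqr.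
Qed.

Lemma nsqZ D (c : R) f : measurable D -> sqint D f ->
  nsq D (fun x => c * f x) = c ^+ 2 * nsq D f.
Proof.
move=> mD sf; rewrite /nsq; under eq_Rintegral do rewrite exprMn.
by rewrite RintegralZl//; exact: sqint_sqr.
Qed.

Lemma nsq_expand D f g (t : R) : measurable D -> sqint D f -> sqint D g ->
  nsq D (fun x => f x + t * g x) =
  nsq D f + (2 * t) * \int[mu]_(x in D) (f x * g x) + t ^+ 2 * nsq D g.
Proof.
move=> mD sf sg; rewrite /nsq.
rewrite -RintegralZl//; last exact: sqint_mul.
rewrite -RintegralZl//; last exact: sqint_sqr.
rewrite -RintegralD//.
- rewrite -RintegralD//.
  + by apply: eq_Rintegral => x _; ring.
  + apply: integrableRD => //; first exact: sqint_sqr.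
    by apply: integrableRZ => //; exact: sqint_mul.
  + by apply: integrableRZ => //; exact: sqint_sqr.
- exact: sqint_sqr.
- by apply: integrableRZ => //; exact: sqint_mul.
Qed.

(** The quadratic polynomial of [nsq_expand] is nonnegative in t; it is evaluated at its minimiser
    [- B / nsq D g]. *)
Lemma cauchy_schwarz_sqr D f g : measurable D -> sqint D f -> sqint D g ->
  (\int[mu]_(x in D) (f x * g x)) ^+ 2 <= nsq D f * nsq D g.
Proof.
move=> mD sf sg; set B := Rintegral _ _ _.
have H t : 0 <= nsq D f + (2 * t) * B + t ^+ 2 * nsq D g.
  by rewrite -nsq_expand//; exact: nsq_ge0.
have [g0|g0] := eqVneq (nsq D g) 0.
  have [->|B0] := eqVneq B 0; first by rewrite expr0n mulr_ge0// nsq_ge0.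
  (* The polynomial has degenerated to an affine function of t with slope [2 * B]; at this point its
     value is -1. *)
  have := H (- (nsq D f + 1) / (2 * B)); rewrite g0 mulr0 addr0.
  have -> : 2 * (- (nsq D f + 1) / (2 * B)) * B = - (nsq D f + 1) by field.
  by move=> ?; exfalso; lra.
have gp : 0 < nsq D g by rewrite lt0r g0 nsq_ge0.
have := H (- B / nsq D g).
have -> : nsq D f + 2 * (- B / nsq D g) * B + (- B / nsq D g) ^+ 2 * nsq D g =
   nsq D f - B ^+ 2 / nsq D g by field.
by rewrite subr_ge0 ler_pdivrMr.
Qed.

Definition nrm D f : R := Num.sqrt (nsq D f).

Lemma nrm_ge0 D f : 0 <= nrm D f. Proof. exact: sqrtr_ge0. Qed.

Lemma cauchy_schwarz D f g : measurable D -> sqint D f -> sqint D g ->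
  `|\int[mu]_(x in D) (f x * g x)| <= nrm D f * nrm D g.
Proof.
move=> mD sf sg; rewrite -sqrtr_sqr -sqrtrM ?nsq_ge0//.
by rewrite ler_wsqrtr// cauchy_schwarz_sqr.
Qed.

Lemma nrmD D f g : measurable D -> sqint D f -> sqint D g ->
  nrm D (fun x => f x + g x) <= nrm D f + nrm D g.
Proof.
move=> mD sf sg; rewrite -(@ler_pXn2r _ 2)// ?nnegrE ?addr_ge0 ?nrm_ge0//.
rewrite sqrrD /nrm !sqr_sqrtr ?nsq_ge0//.
have := nsq_expand 1 mD sf sg; under [X in X = _]eq_Rintegral do rewrite mul1r.
rewrite -/(nsq D (fun x => f x + g x)) => ->.
rewrite mulr1 expr1n mul1r lerD2r lerD2l -/(nrm D f) -/(nrm D g) -[leRHS]mulr_natl.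
by rewrite ler_pM2l//; exact: le_trans (ler_norm _) (cauchy_schwarz mD sf sg).
Qed.

Lemma nrmZ D (c : R) f : measurable D -> sqint D f ->
  nrm D (fun x => c * f x) = `|c| * nrm D f.
Proof.
by move=> mD sf; rewrite /nrm nsqZ// sqrtrM ?sqr_ge0// sqrtr_sqr.
Qed.

Lemma nrmN D f : measurable D -> sqint D f -> nrm D (fun x => - f x) = nrm D f.
Proof.
by move=> mD sf; congr Num.sqrt; apply: eq_Rintegral => x _; rewrite sqrrN.
Qed.

Lemma nrmB D f g : measurable D -> sqint D f -> sqint D g ->
  nrm D (fun x => f x - g x) <= nrm D f + nrm D g.
Proof. by move=> mD sf sg; rewrite -(nrmN mD sg); apply: nrmD => //; exact: sqintN. Qed.

Lemma nrm_le D f g : measurable D -> measurable_fun D f -> sqint D g ->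
  (forall x, D x -> `|f x| <= `|g x|) -> nrm D f <= nrm D g.
Proof.
move=> mD mf sg fg; have sf := sqint_le mD mf sg fg.
rewrite ler_wsqrtr//; apply: le_Rintegral => //; [exact: sqint_sqr..|].
move=> x Dx; rewrite -(real_normK (num_real (f x))).
by rewrite -(real_normK (num_real (g x))) lerXn2r// ?nnegrE// fg.
Qed.

Lemma nrm_sum (I : Type) (s : seq I) D (F : I -> T -> R) : measurable D ->
  (forall i, sqint D (F i)) ->
  nrm D (fun x => \sum_(i <- s) F i x) <= \sum_(i <- s) nrm D (F i).
Proof.
move=> mD sF; elim: s => [|i s IH].
  under [X in nrm _ X]eq_fun do rewrite big_nil.
  rewrite big_nil /nrm /nsq; under eq_Rintegral do rewrite expr0n/=.
  by rewrite /Rintegral integral0 sqrtr0.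
under [X in nrm _ X]eq_fun do rewrite big_cons.
rewrite big_cons; apply: le_trans (nrmD mD (sF i) (sqint_sum s mD sF)) _.
by rewrite lerD2l.
Qed.

Lemma sqint_bounded D f (M : R) : measurable D -> (mu D < +oo)%E ->
  measurable_fun D f -> (forall x, D x -> `|f x| <= M) -> sqint D f.
Proof.
move=> mD fD mf fM; apply: (@sqint_le _ _ (fun=> M)) => //; last first.
  by move=> x Dx; rewrite (le_trans (fM x Dx))// ler_norm.
split => //; rewrite integral_cst//.
by apply: lte_mul_pinfty => //; rewrite lee_fin sqr_ge0.
Qed.

Lemma ae_eq_nsq D f g : measurable D -> sqint D f -> sqint D g ->
  {ae mu, forall x, D x -> f x = g x} -> nsq D f = nsq D g.
Proof.
move=> mD sf sg fg; congr fine; apply: ae_eq_integral => //.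
- by apply/measurable_EFinP; apply: measurable_funX; exact: sf.1.
- by apply/measurable_EFinP; apply: measurable_funX; exact: sg.1.
by apply: filterS fg => x H Dx; rewrite H.
Qed.

End square_integrable.

(** * Square integrability on planar sets and translation invariance *)

Section plane_L2.
Variable R : realType.
Local Notation mu := (mu2 R).
Implicit Types (D : set (plane R)) (u : plane R -> R).

Lemma integral_sqr_restrict D u : measurable (D : set (mplane R)) ->
  (\int[mu]_x `|(EFin \o u \_ D) x| `^ 2 = \int[mu]_(x in D) (u x ^+ 2)%:E)%E.
Proof.
move=> mD; rewrite [RHS]integral_mkcond; apply: eq_integral => x _ /=.
rewrite /patch; case: ifPn => _ /=.
  by rewrite powR_mulrn// real_normK// num_real.
by rewrite normr0 powR0// pnatr_eq0.
Qed.

Lemma L2normE D u : measurable (D : set (mplane R)) -> sqint mu D u ->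
  L2norm D u = (nrm mu D u)%:E.
Proof.
move=> mD su; rewrite /L2norm unlock /Lnorm/=.
by rewrite integral_sqr_restrict// nsqE// poweR_EFin powR12_sqrt// nsq_ge0.
Qed.

Lemma LpE D u : measurable (D : set (mplane R)) ->
  Lp D 2%:E u <-> sqint mu D u.
Proof.
move=> mD; rewrite /Lp inE; split.
  move=> /andP[]; rewrite !inE/= => mu2 fu; split.
    by apply/(measurable_restrictT _ mD).
  move: fu; rewrite /finite_norm unlock /Lnorm/= integral_sqr_restrict//.
  by apply: lty_poweRy; rewrite invr_eq0 pnatr_eq0.
move=> su; apply/andP; split; rewrite inE/=.
  by apply/(measurable_restrictT _ mD); exact: su.1.
by rewrite /finite_norm -/(L2norm D u) L2normE// ltry.
Qed.

(** Uniqueness of the product measure reduces the claim to the line; there uniqueness of Lebesgue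
    measure reduces it to half-open intervals. *)
Lemma mu2_translate (v : plane R) (A : set (mplane R)) : measurable A ->
  pushforward mu ((fun x : plane R => x + v) : mplane R -> mplane R) A = mu A.
Proof.
move=> mA.
have mt (r : R) : measurable_fun [set: measurableTypeR R] (+%R^~ r : measurableTypeR R -> measurableTypeR R).
  by apply: measurable_funD => //; exact: measurable_cst.
have L1 (r : R) (B : set (measurableTypeR R)) : measurable B ->
   (@lebesgue_measure R) ((fun x : R => x + r) @^-1` B) = (@lebesgue_measure R) B.
  move=> mB; apply/esym.
  pose ph : {measure set (measurableTypeR R) -> \bar R} :=
    pushforward lebesgue_measure (+%R^~ r : measurableTypeR R -> measurableTypeR R).
  suff: lebesgue_measure B = ph (mt r) B by [].
  apply: lebesgue_measure_unique => // X [[a b] _ <-] /=.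
  rewrite /ph /= /pushforward.
  have -> : +%R^~ r @^-1` `]a, b] = `]a - r, b - r]%classic.
    by apply/seteqP; split => x /=; rewrite !in_itv/= ltrBlDr lerBrDr.
  rewrite !lebesgue_measure_itv/= !lte_fin ltrD2r.
  by case: ifPn => // _; rewrite -!EFinB; congr EFin; ring.
have mtv : measurable_fun [set: mplane R] ((fun x : plane R => x + v) : mplane R -> mplane R).
  apply/measurable_fun_pairP; split.
    exact: (measurableT_comp (mt v.1) measurable_fst).
  exact: (measurableT_comp (mt v.2) measurable_snd).
pose ph : {measure set (mplane R) -> \bar R} :=
    pushforward mu ((fun x : plane R => x + v) : mplane R -> mplane R).
apply/esym; apply: (@product_measure_unique _ _ _ _ _ _ _ (ph mtv)) => // {mA}A B mA mB.
rewrite /ph /= /pushforward -[X in (_ = X * _)%E](L1 v.1)// -[X in (_ = _ * X)%E](L1 v.2)//.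
apply: product_measure1E.
  by rewrite -[X in measurable X]setTI; exact: mt.
by rewrite -[X in measurable X]setTI; exact: mt.
Qed.

End plane_L2.

(** * Dominated convergence, almost-everywhere statements and integrals in the plane *)

Lemma Rdominated_cvg d (T : measurableType d) (R : realType)
    (mu : {measure set T -> \bar R}) (D : set T) (f_ : nat -> T -> R) (f g : T -> R) :
  measurable D -> (forall n, measurable_fun D (f_ n)) -> measurable_fun D f ->
  {ae mu, forall x, D x -> f_ ^~ x @ \oo --> f x} ->
  mu.-integrable D (EFin \o g) ->
  (forall n x, D x -> `|f_ n x| <= g x) ->
  mu.-integrable D (EFin \o f) /\
  (fun n => \int[mu]_(x in D) f_ n x) @ \oo --> \int[mu]_(x in D) f x.
Proof.
move=> mD mf_ mf ff ig fg.
have [||||] := @dominated_convergence _ _ _ mu D mD (fun n => EFin \o f_ n) (EFin \o f)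
  (EFin \o g) _ _ _ ig.
- by move=> n; exact/measurable_EFinP.
- exact/measurable_EFinP.
- by apply: filterS ff => x h Dx; apply: cvg_EFin; [exact: nearW|exact: h].
- by apply: aeW => x n Dx /=; rewrite lee_fin fg.
move=> fi _ c; split => //.
apply: fine_cvg; rewrite /Rintegral fineK//; exact: integrable_fin_num.
Qed.

Section plane_integral.
Variable R : realType.
Local Notation mu := (mu2 R).
Implicit Types (D : set (plane R)).

Lemma ae_imp (P Q : plane R -> Prop) : (forall x, P x -> Q x) ->
  {ae mu, forall x, P x} -> {ae mu, forall x, Q x}.
Proof.
move=> PQ; apply: negligibleS => x /= nQ Px; exact/nQ/PQ.
Qed.

Lemma ae_and (P Q : plane R -> Prop) : {ae mu, forall x, P x} ->
  {ae mu, forall x, Q x} -> {ae mu, forall x, P x /\ Q x}.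
Proof.
move=> aP aQ; apply: negligibleS (negligibleU aP aQ) => x /= nPQ.
have [Px|nP] := pselect (P x); last by left.
by right => Qx; exact: nPQ.
Qed.

Lemma ae_all (P : plane R -> Prop) : (forall x, P x) -> {ae mu, forall x, P x}.
Proof.
by move=> aP; apply: negligibleS (negligible_set0 mu) => x /=; exact.
Qed.

Lemma ae_forall_nat (P : nat -> plane R -> Prop) :
  (forall n, {ae mu, forall x, P n x}) -> {ae mu, forall x, forall n, P n x}.
Proof.
move=> aP; apply: negligibleS (negligible_bigcup aP) => x /= /existsNP[n nP].
by exists n.
Qed.

Lemma measurable_translate (v : plane R) :
  measurable_fun setT ((fun x : plane R => x + v) : mplane R -> mplane R).
Proof.
have mt (r : R) : measurable_fun [set: measurableTypeR R] (+%R^~ r : measurableTypeR R -> measurableTypeR R).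
  by apply: measurable_funD => //; exact: measurable_cst.
apply/measurable_fun_pairP; split.
  exact: (measurableT_comp (mt v.1) measurable_fst).
exact: (measurableT_comp (mt v.2) measurable_snd).
Qed.

Lemma measurable_fun_translate (f : plane R -> R) (v : plane R) :
  measurable_fun setT (f : mplane R -> R) ->
  measurable_fun setT ((fun x => f (x + v)) : mplane R -> R).
Proof. by move=> mf; exact: (measurableT_comp mf (measurable_translate v)). Qed.

Lemma ge0_integral_translate (f : plane R -> \bar R) (v : plane R) :
  measurable_fun setT (f : mplane R -> \bar R) -> (forall x, 0 <= f x)%E ->
  (\int[mu]_x f (x + v)%R = \int[mu]_x f x)%E.
Proof.
move=> mf f0.
transitivity (\int[pushforward mu ((fun x : plane R => (x + v)%R) : mplane R -> mplane R)]_x f x)%E.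
  apply/esym; apply: (ge0_integral_pushforward (measurable_translate v) mu measurableT mf).
  by move=> x _; exact: f0.
by apply: eq_measure_integral => [|? A mA _]; [exact: measurable_translate|exact: mu2_translate].
Qed.

Lemma Rintegral_translate (f : plane R -> R) (v : plane R) :
  measurable_fun setT (f : mplane R -> R) ->
  \int[mu]_x f (x + v) = \int[mu]_x f x.
Proof.
move=> /measurable_EFinP mf; rewrite /Rintegral; congr fine.
rewrite [LHS]integralE [RHS]integralE; congr (_ - _)%E.
  etransitivity; last exact: (ge0_integral_translate v (measurable_funepos mf) (funepos_ge0 _)).
  by apply: eq_integral => x _; rewrite unlock.
etransitivity; last exact: (ge0_integral_translate v (measurable_funeneg mf) (funeneg_ge0 _)).
by apply: eq_integral => x _; rewrite unlock.
Qed.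

Lemma integrable_translate (f : plane R -> R) (v : plane R) :
  mu.-integrable setT (EFin \o f) -> mu.-integrable setT (EFin \o (fun x => f (x + v))).
Proof.
move=> /integrableP[/measurable_EFinP mf fy]; apply/integrableP; split.
  by apply/measurable_EFinP; exact: measurable_fun_translate.
rewrite (ge0_integral_translate (f := fun x => `|(f x)%:E|%E))//.
by apply: measurableT_comp => //; exact/measurable_EFinP.
Qed.

Lemma dot_continuous (a : plane R) : continuous (dot a : plane R -> R^o).
Proof.
by move=> x; apply: cvgD; apply: cvgMr; [exact: cvg_fst|exact: cvg_snd].
Qed.

Lemma line_null (a : plane R) (c : R) : a != 0 ->
  measurable ([set x | dot a x = c] : set (mplane R)) /\ mu [set x | dot a x = c] = 0%E.
Proof.
move=> a0.
have mL : measurable ([set x | dot a x = c] : set (mplane R)).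
  rewrite -[X in measurable X]setTI.
  exact: (continuous_mplane (D := setT) (@dot_continuous a)) (measurable_set1 c).
split => //.
(* A vertical line has one full section and is measured as the product of a point and a line; every
   other line has single points as vertical sections. *)
have [a2|a2] := eqVneq a.2 0.
  have a1 : a.1 != 0.
    by apply: contra a0 => /eqP a1; rewrite [a]surjective_pairing a1 a2.
  have -> : [set x | dot a x = c] = [set c / a.1] `*` setT.
    apply/seteqP; split => -[x1 x2]; rewrite /dot /= a2 mul0r addr0.
      by move=> <-; split => //; field.
    by move=> [-> _]; field.
  transitivity (@lebesgue_measure R [set (c / a.1)%R] * @lebesgue_measure R setT)%E.
    by apply: product_measure1E.
  by rewrite lebesgue_measure_set1 mul0e.
rewrite /mu2 /= /product_measure1 integral0_eq// => x _ /=.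
rewrite (_ : xsection _ _ = [set (c - a.1 * x) / a.2]) ?lebesgue_measure_set1//.
apply/seteqP; split => y; rewrite /xsection /= inE /dot /=.
  by move=> <-; field.
by move=> ->; field.
Qed.

Lemma ae_notin_line (a : plane R) (c : R) : a != 0 ->
  {ae mu, forall x, dot a x != c}.
Proof.
move=> a0; have [mL L0] := line_null c a0.
exists [set x | dot a x = c]; split => // x /= /negP; rewrite negbK => /eqP.
exact.
Qed.

Lemma bounded_support_integrable (f : plane R -> R) (M N : R) :
  measurable_fun setT (f : mplane R -> R) ->
  (forall x, `|f x| <= M) -> (forall x, f x != 0 -> `|x| < N) ->
  mu.-integrable setT (EFin \o f).
Proof.
move=> mf fM fN.
pose B := box (- `|N|, - `|N|) (`|N|, `|N|).
have mB : measurable (B : set (mplane R)) by exact: box_measurable.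
have fB : (EFin \o f) = (EFin \o f) \_ B.
  apply/funext => x; rewrite /patch; case: ifPn => // /negP; rewrite in_setE => xB.
  rewrite /=; congr EFin; apply/eqP/negPn/negP => /fN xN; apply: xB.
  have xN' : `|x| < `|N| by rewrite (lt_le_trans xN)// ler_norm.
  move: xN'; rewrite prod_normE gt_max => /andP[].
  by rewrite /B /box /= !ltr_norml !in_itv /= => /andP[-> ->] /andP[-> ->].
rewrite fB; apply/integrable_restrict => //; rewrite setTI.
apply: (@le_integrable _ _ _ mu B mB _ (EFin \o cst M)).
- by apply/measurable_EFinP; apply: measurable_funS mf.
- by move=> x _ /=; rewrite lee_fin (le_trans (fM x))// ler_norm.
- apply/integrableP; split; first by apply/measurable_EFinP; exact: measurable_cst.
  rewrite /= integral_cst// mu2_box//=; last 2 first.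
    by rewrite (le_trans (y := 0))// oppr_le0.
    by rewrite (le_trans (y := 0))// oppr_le0.
  by rewrite -EFinM ltry.
Qed.

End plane_integral.

(** * Smooth bump functions *)

Section Ck_theory.
Variable R : realType.

Lemma Ck_continuous (V W : normedModType R) k (f : V -> W) :
  Ck k f -> continuous f.
Proof. by case: k => [|k] []. Qed.

Lemma CkW (V W : normedModType R) k (f : V -> W) : Ck k.+1 f -> Ck k f.
Proof.
elim: k f => [|k IH] f [cf df]; first by split.
by split => // v; have [d1 d2] := df v; split => //; exact: IH.
Qed.

Variable V : normedModType R.
Implicit Types f g : V -> R^o.

Lemma Ck_cst k (c : R) : Ck k (fun _ : V => c : R^o).
Proof.
elim: k c => [|k IH] c; split => //; try exact: cst_continuous.
move=> v; split => [x|]; first exact: derivable_cst.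
have -> : (fun x => 'D_v (fun _ : V => c : R^o) x) = (fun _ : V => 0 : R^o).
  by apply/funext => x; exact: derive_cst.
exact: IH.
Qed.

Lemma CkD k f g : Ck k f -> Ck k g -> Ck k (fun x => f x + g x : R^o).
Proof.
elim: k f g => [|k IH] f g [cf df] [cg dg]; split => //.
- by move=> x; apply: cvgD; [exact: cf|exact: cg].
- by move=> x; apply: cvgD; [exact: cf|exact: cg].
move=> v; have [f1 f2] := df v; have [g1 g2] := dg v; split.
  by move=> x; exact: derivableD.
have -> : (fun x => 'D_v (fun x => f x + g x : R^o) x) = (fun x => 'D_v f x + 'D_v g x).
  by apply/funext => x; exact: deriveD.
exact: IH.
Qed.

Lemma CkM k f g : Ck k f -> Ck k g -> Ck k (fun x => f x * g x : R^o).
Proof.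
elim: k f g => [|k IH] f g Cf Cg.
  split => //; have [cf _] := Cf; have [cg _] := Cg.
  by move=> x; apply: cvgM; [exact: cf|exact: cg].
have [cf df] := Cf; have [cg dg] := Cg; split.
  by move=> x; apply: cvgM; [exact: cf|exact: cg].
move=> v; have [f1 f2] := df v; have [g1 g2] := dg v; split.
  by move=> x; exact: derivableM.
have -> : (fun x => 'D_v (fun x => f x * g x : R^o) x) =
    (fun x => f x * 'D_v g x + g x * 'D_v f x).
  by apply/funext => x; exact: deriveM.
by apply: (@CkD k (fun x => f x * 'D_v g x : R^o)); apply: IH => //; exact: CkW.
Qed.

Lemma CkZ k (c : R) f : Ck k f -> Ck k (fun x => c * f x : R^o).
Proof. by move=> Cf; apply: CkM => //; exact: Ck_cst. Qed.

(** [L] is the linear part of the affine map [phi]: the difference quotient of the composite along v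
    is literally that of f along [L v]. *)
Lemma Ck_affine (U : normedModType R) k (phi : U -> V) (L : U -> V) f :
  continuous phi -> (forall x v (h : R), phi (h *: v + x) = h *: L v + phi x) ->
  Ck k f -> Ck k (fun x => f (phi x) : R^o).
Proof.
move=> cphi aphi; elim: k f => [|k IH] f [cf df].
  by split => //; move=> x; apply: continuous_comp; [exact: cphi|exact: cf].
split; first by move=> x; apply: continuous_comp; [exact: cphi|exact: cf].
move=> v; have [f1 f2] := df (L v).
have E x : (fun h => h^-1 *: (((fun x => f (phi x)) \o shift x) (h *: v) - f (phi x)))
    = (fun h : R => h^-1 *: ((f \o shift (phi x)) (h *: L v) - f (phi x)) : R^o).
  by apply/funext => h; rewrite /= aphi.
split; first by move=> x; rewrite /derivable E; exact: f1.
have -> : (fun x => 'D_v (fun x => f (phi x) : R^o) x) = (fun x => 'D_(L v) f (phi x)).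
  by apply/funext => x; rewrite /derive E.
exact: (IH (fun x => 'D_(L v) f x : R^o)).
Qed.

End Ck_theory.

Section theta.
Variable R : realType.

Lemma scale_reg (a : R) (b : R^o) : a *: b = a * b.
Proof. by []. Qed.

(** Powers of 1/x times exp(-1/x). The derivative of theta_n is - n theta_(n+1) + theta_(n+2), so
    the family is closed under derivation and smoothness follows by induction on the order. *)
Definition theta (n : nat) (x : R) : R :=
  if 0 < x then x^-1 ^+ n * expR (- x^-1) else 0.

Lemma theta_ge0 n x : 0 <= theta n x.
Proof.
rewrite /theta; case: ifPn => // x0.
by rewrite mulr_ge0 ?expR_ge0// exprn_ge0// invr_ge0 ltW.
Qed.

(** This is y^(n+2) <= (n+2)! exp(y) at y = 1/x. Quadratic decay makes theta_n differentiable at 0,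
    with derivative 0. *)
Lemma theta_bound n (x : R) : theta n x <= (n.+2)`!%:R * x ^+ 2.
Proof.
rewrite /theta; case: ifPn => x0; last by rewrite mulr_ge0// sqr_ge0.
have y0 : 0 < x^-1 by rewrite invr_gt0.
rewrite expRN ler_pdivrMr ?expR_gt0//.
have := expR_ge1Dxn n.+1 (ltW y0).
have F0 : 0 < (n.+2)`!%:R :> R by rewrite ltr0n fact_gt0.
move=> H; have {H} : x^-1 ^+ n.+2 <= (n.+2)`!%:R * expR x^-1.
  rewrite -ler_pdivrMl// mulrC; apply: le_trans H; rewrite lerDr//.
rewrite -(ler_pM2l (exprn_gt0 2 x0)) => H.
rewrite mulrAC [leRHS]mulrC; apply: le_trans H.
rewrite -[n.+2]/(2 + n)%N exprD mulrA -exprMn.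
by rewrite divff ?gt_eqF// expr1n mul1r.
Qed.

Lemma is_derive_theta n (x : R) :
  is_derive x 1 (theta n : R -> R^o) (- n%:R * theta n.+1 x + theta n.+2 x).
Proof.
have [x0|x0|<-] := ltgtP 0 x.
- have x0' : x != 0 by rewrite gt_eqF.
  have D1 : is_derive x 1 (fun y : R => y^-1 : R^o) (- x ^- 2).
    apply: (is_derive_eq (@is_deriveV R id x 1 1 x0' (is_derive_id _ _))).
    by rewrite scale_reg mulr1.
  have Dn : is_derive x 1 (fun y : R => y^-1 ^+ n : R^o) (n%:R * x^-1 ^+ n.-1 * (- x ^- 2)).
    have -> : (fun y : R => y^-1 ^+ n : R^o) = (fun y : R => y^-1 : R^o) ^+ n.
      by rewrite exprfctE.
    apply: (is_derive_eq (@is_deriveX _ _ (fun y : R => y^-1 : R^o) n x 1 _ D1)).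
    by rewrite scale_reg.
  have De : is_derive x 1 (fun y : R => expR (- y^-1) : R^o) (expR (- x^-1) * x ^- 2).
    have DN := is_deriveN D1; rewrite opprK in DN.
    exact: (is_derive1_comp (is_derive_expR _) DN).
  have := is_deriveM Dn De.
  move=> H; apply: (@near_eq_is_derive _ _ _ _ _ _ _ _ _ (is_derive_eq H _)).
    near=> y; rewrite /theta.
    have -> : 0 < y by near: y; exact: lt_nbhsr.
    by [].
  rewrite /theta x0 !scale_reg/= ; set e := expR _.
  case: n {Dn H} => [|n]; first by rewrite expr0 !mul0r oppr0 !mul0r mulr0 addr0 mul1r add0r expr2 exprVn mulrC.
  rewrite /= exprVn -!exprVn !exprS; ring.
- apply: (@near_eq_is_derive _ _ _ (fun=> 0 : R^o)).
    near=> y; rewrite /theta.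
    have y0 : y < 0 by near: y; exact: lt_nbhsl.
    by rewrite ltNge (ltW y0).
  by apply: is_derive_eq; rewrite /theta ltNge (ltW x0)/= mulr0 addr0.
- have E : theta n 0 = 0 by rewrite /theta ltxx.
  have cn : (n.+2)`!%:R * `|h| @[h --> (0 : R)^'] --> (0 : R).
    have H : (n.+2)`!%:R * `|h| @[h --> (0 : R)^'] --> (n.+2)`!%:R * `|0 : R|.
      by apply: cvgMr; apply: cvg_within_filter; exact: norm_continuous.
    by rewrite normr0 mulr0 in H.
  have cN : - ((n.+2)`!%:R * `|h|) @[h --> (0 : R)^'] --> (0 : R).
    have H : - ((n.+2)`!%:R * `|h|) @[h --> (0 : R)^'] --> - (0 : R) by exact: cvgN cn.
    by rewrite oppr0 in H.
  have C : h^-1 *: ((theta n \o shift 0) (h *: 1) - theta n 0) @[h --> 0^'] --> (0 : R^o).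
    apply: (@squeeze_cvgr _ _ _ _ (fun h : R => - ((n.+2)`!%:R * `|h|)) (fun h : R => (n.+2)`!%:R * `|h|)).
    - near=> h.
      have h0 : h != 0 by near: h; exact: nbhs_dnbhs_neq.
      rewrite -ler_norml/= E subr0 addr0 scaler1 scale_reg normrM normfV.
      rewrite ler_pdivrMl ?normr_gt0// ger0_norm ?theta_ge0//.
      rewrite mulrCA -expr2 real_normK ?num_real//; exact: theta_bound.
    - exact: cN.
    - exact: cn.
  have -> : - n%:R * theta n.+1 0 + theta n.+2 0 = 0 by rewrite /theta ltxx mulr0 addr0.
  apply: DeriveDef; [exact: cvgP C|by apply/cvg_lim => //; exact: norm_hausdorff].
Unshelve. all: by end_near.
Qed.

Lemma derive_theta n (x v : R) : derivable (theta n : R -> R^o) x v /\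
  'D_v (theta n : R -> R^o) x = v * (- n%:R * theta n.+1 x + theta n.+2 x).
Proof.
have D := is_derive_theta n x.
have df : differentiable (theta n : R -> R^o) x by apply/derivable1_diffP.
split; first exact: diff_derivable.
rewrite deriveE// -[v in LHS]mulr1 -[v * 1]/(v *: (1 : R^o)) linearZ/= -deriveE//.
by rewrite derive_val.
Qed.

Lemma theta_smooth n : smooth (theta n : R -> R^o).
Proof.
move=> k; elim: k n => [|k IH] n.
  split => // x; apply: differentiable_continuous; apply/derivable1_diffP.
  by have D := is_derive_theta n x.
split.
  move=> x; apply: differentiable_continuous; apply/derivable1_diffP.
  by have D := is_derive_theta n x.
move=> v; split; first by move=> x; exact: (derive_theta n x v).1.
have -> : (fun x => 'D_v (theta n : R -> R^o) x) =
    (fun x => v * (- n%:R * theta n.+1 x + theta n.+2 x) : R^o).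
  by apply/funext => x; exact: (derive_theta n x v).2.
by apply: CkZ; apply: CkD => //; apply: CkZ.
Qed.

End theta.

(** * The fundamental lemma of the calculus of variations *)

Section fundamental_lemma.
Variable R : realType.
Local Notation mu := (mu2 R).
Implicit Types (D : set (plane R)) (a b : plane R).

Lemma cbox_compact a b : compact (cbox a b).
Proof. by apply: compact_setX; exact: segment_compact. Qed.

Lemma cbox_measurable a b : measurable (cbox a b : set (mplane R)).
Proof. by apply: measurableX; exact: measurable_itv. Qed.

Definition boxes : set (set (plane R)) := [set A | exists a b, A = box a b].

Definition bmax a b : plane R := (Num.max a.1 b.1, Num.max a.2 b.2).
Definition bmin a b : plane R := (Num.min a.1 b.1, Num.min a.2 b.2).

Lemma boxI a b c d : box a b `&` box c d = box (bmax a c) (bmin b d).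
Proof.
apply/seteqP; split => x; rewrite /box /bmin /bmax /= !in_itv/= !gt_max !lt_min.
  by move=> [[/andP[-> ->] /andP[-> ->]] [/andP[-> ->] /andP[-> ->]]].
by move=> [/andP[/andP[-> ->] /andP[-> ->]] /andP[/andP[-> ->] /andP[-> ->]]].
Qed.

Lemma cboxI_sub a b c d : cbox (bmax a c) (bmin b d) `<=` cbox a b.
Proof.
move=> x; rewrite /cbox /bmin /bmax /= !in_itv/= !ge_max !le_min.
by move=> [/andP[/andP[-> _] /andP[-> _]] /andP[/andP[-> _] /andP[-> _]]].
Qed.

Lemma boxes_setI : setI_closed boxes.
Proof.
move=> _ _ [a [b ->]] [c [d ->]]; rewrite boxI.
by exists (bmax a c), (bmin b d).
Qed.

Lemma mplane_sub_boxes (A : set (mplane R)) : measurable A -> <<s boxes >> A.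
Proof.
move=> mA.
have bd (r : R) : exists n : nat, - n%:R < r < n%:R.
  by exists (Num.bound r); rewrite -ltr_norml; exact: unstable.ltr_norm_bound.
pose S : pointedType := plane R.
have m1 : measurable_fun setT (fst : g_sigma_algebraType (boxes : set (set S)) -> R).
  apply: (measurability _ (RGenOpens.measurableE R)).
  move=> _ [_ [x [y ->]] <-]; rewrite setTI.
  have -> : (fst : plane R -> R) @^-1` `]x, y[%classic =
      \bigcup_(n : nat) box (x, - n%:R) (y, n%:R).
    apply/seteqP; split => z /=.
      move=> zxy; have [n /andP[n1 n2]] := bd z.2; exists n => //.
      by rewrite /box /=; split => //; rewrite in_itv/= n1 n2.
    by move=> [n _ []].
  by apply: bigcupT_measurable => n; apply: sub_sigma_algebra; exists (x, - n%:R), (y, n%:R).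
have m2 : measurable_fun setT (snd : g_sigma_algebraType (boxes : set (set S)) -> R).
  apply: (measurability _ (RGenOpens.measurableE R)).
  move=> _ [_ [x [y ->]] <-]; rewrite setTI.
  have -> : (snd : plane R -> R) @^-1` `]x, y[%classic =
      \bigcup_(n : nat) box (- n%:R, x) (n%:R, y).
    apply/seteqP; split => z /=.
      move=> zxy; have [n /andP[n1 n2]] := bd z.1; exists n => //.
      by rewrite /box /=; split => //; rewrite in_itv/= n1 n2.
    by move=> [n _ []].
  by apply: bigcupT_measurable => n; apply: sub_sigma_algebra; exists (- n%:R, x), (n%:R, y).
have mid : measurable_fun setT (id : g_sigma_algebraType (boxes : set (set S)) -> mplane R).
  by apply/measurable_fun_pairP; split.
by have := mid measurableT A mA; rewrite setTI.
Qed.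

(** The sets over which k integrates to 0 form a Dynkin system containing the boxes, which are
    stable under intersection and generate the measurable sets. The integral over the whole plane is
    a separate hypothesis: a Dynkin system contains the full set, and boxes are bounded. *)
Lemma boxes_ae0 (k : plane R -> R) :
  mu.-integrable setT (EFin \o k) ->
  \int[mu]_x k x = 0 ->
  (forall a b, \int[mu]_(x in box a b) k x = 0) ->
  {ae mu, forall x, k x = 0}.
Proof.
move=> ik k0 kb.
pose H : set (set (plane R)) := [set A | measurable (A : set (mplane R)) /\
  (\int[mu]_(x in A) (k x)%:E = 0)%E].
have ikA (A : set (mplane R)) : measurable A -> mu.-integrable A (EFin \o k).
  by move=> mA; exact: integrableS ik.
have R0 (A : set (mplane R)) : measurable A -> \int[mu]_(x in A) k x = 0 ->
    (\int[mu]_(x in A) (k x)%:E = 0)%E.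
  move=> mA; rewrite /Rintegral => e; rewrite -[LHS]fineK ?e//.
  exact: integrable_fin_num (ikA _ mA).
have dH : dynkin H.
  split.
  - by split; [exact: measurableT|exact: R0].
  - move=> A [mA A0]; split; first exact: measurableC.
    have := R0 _ measurableT k0; rewrite -(setUv A) integral_setU_EFin//.
    + by rewrite A0 add0e.
    + exact: measurableC.
    + by rewrite setUv; have /integrableP[/measurable_EFinP] := ik.
    + by apply/disj_setPS; rewrite setICr.
  - move=> F tF HF; split; first by apply: bigcup_measurable => n _; exact: (HF n).1.
    have mF n : measurable (F n : set (mplane R)) := (HF n).1.
    have mUF : measurable (\bigcup_k F k : set (mplane R)) by exact: bigcup_measurable.
    etransitivity; first exact: (@integral_bigcup _ (mplane R) R mu F (EFin \o k) tF mF (ikA _ mUF)).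
    by apply: eseries0 => n _ _; exact: (HF n).2.
have BH : boxes `<=` H.
  by move=> _ [a [b ->]]; split; [exact: box_measurable|apply: R0 => //; exact: box_measurable].
have mH (A : set (mplane R)) : measurable A -> H A.
  move/mplane_sub_boxes; rewrite -(setI_closed_g_dynkin_g_sigma_algebra boxes_setI).
  by apply: smallest_sub.
have : ae_eq mu setT (EFin \o k) (cst 0%E).
  apply: integral_ae_eq => // E _ mE; rewrite integral_cst// mul0e.
  exact: (mH E mE).2.
by apply: filterS => x /= /(_ I) [].
Qed.

(** The factor n+1 sits inside theta: exp(-1/((n+1) y)) tends to 1 for y > 0, while the value stays
    0 for y <= 0. The bumps therefore tend to the indicator of the open box, with supports in one
    fixed closed box. *)
Definition box_bump a b (n : nat) (x : plane R) : R :=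
  theta 0 (n.+1%:R * (x.1 - a.1)) * theta 0 (n.+1%:R * (b.1 - x.1)) *
  (theta 0 (n.+1%:R * (x.2 - a.2)) * theta 0 (n.+1%:R * (b.2 - x.2))).

Lemma box_bump_smooth a b n : smooth (box_bump a b n : plane R -> R^o).
Proof.
have c1 : continuous (fst : plane R -> R) by move=> x; exact: cvg_fst.
have c2 : continuous (snd : plane R -> R) by move=> x; exact: cvg_snd.
have lin (s c : R) (pr : plane R -> R) : continuous pr ->
    (forall x v (h : R), pr (h *: v + x) = h * pr v + pr x) ->
    smooth (fun x => theta 0 (s * pr x + c) : R^o).
  move=> cpr lpr k.
  apply: (@Ck_affine R R^o (plane R) k (fun x => s * pr x + c) (fun v => s * pr v)).
  - by move=> x; apply: cvgD; [apply: cvgMr; exact: cpr|exact: cvg_cst].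
  - by move=> x v h; rewrite lpr scale_reg; ring.
  - exact: theta_smooth.
move=> k.
have E (s c : R) : (s * c) = s * c by [].
have -> : box_bump a b n = (fun x =>
  theta 0 (n.+1%:R * x.1 + - (n.+1%:R * a.1)) * theta 0 (- n.+1%:R * x.1 + n.+1%:R * b.1) *
  (theta 0 (n.+1%:R * x.2 + - (n.+1%:R * a.2)) * theta 0 (- n.+1%:R * x.2 + n.+1%:R * b.2))).
  apply/funext => x; rewrite /box_bump; congr (theta _ _ * theta _ _ * (theta _ _ * theta _ _)); ring.
apply: (CkM (f := fun x : plane R => _ * _ : R^o)); apply: CkM; apply: lin => //; by move=> x v h.
Qed.

Lemma theta0_le1 (x : R) : theta 0 x <= 1.
Proof.
rewrite /theta; case: ifPn => // x0.
by rewrite expr0 mul1r expR_le1 oppr_le0 invr_ge0 ltW.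
Qed.

Lemma theta0_gt0 (x : R) : 0 < x -> 0 < theta 0 x.
Proof. by move=> x0; rewrite /theta x0 expr0 mul1r expR_gt0. Qed.

Lemma theta0_eq0 (x : R) : x <= 0 -> theta 0 x = 0.
Proof. by move=> x0; rewrite /theta ltNge x0. Qed.

Lemma box_bump_ge0 a b n x : 0 <= box_bump a b n x.
Proof. by rewrite /box_bump !mulr_ge0// theta_ge0. Qed.

Lemma box_bump_le1 a b n x : box_bump a b n x <= 1.
Proof. by rewrite /box_bump !mulr_ile1// ?mulr_ge0// ?theta_ge0// theta0_le1. Qed.

Lemma box_bump_gt0 a b n x : box a b x -> 0 < box_bump a b n x.
Proof.
move=> []; rewrite /= !in_itv/= => /andP[? ?] /andP[? ?].
by rewrite /box_bump !mulr_gt0// theta0_gt0// mulr_gt0// subr_gt0.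
Qed.

Lemma box_bump_eq0 a b n x : ~ box a b x -> box_bump a b n x = 0.
Proof.
move=> nx; have : (x.1 <= a.1) || (b.1 <= x.1) || ((x.2 <= a.2) || (b.2 <= x.2)).
  apply/negPn/negP; rewrite !negb_or -!ltNge => /andP[/andP[? ?] /andP[? ?]].
  by apply: nx; split; rewrite /= in_itv/=; apply/andP.
have t0 (y : R) : y <= 0 -> theta 0 (n.+1%:R * y) = 0.
  by move=> y0; apply: theta0_eq0; rewrite mulr_ge0_le0.
by rewrite /box_bump => /orP[/orP[]|/orP[]] h; [rewrite (t0 (x.1 - _))|rewrite (t0 (_ - x.1))|
  rewrite (t0 (x.2 - _))|rewrite (t0 (_ - x.2))]; rewrite ?subr_le0// ?(mul0r, mulr0).
Qed.

Lemma box_bump_cvg a b x : box_bump a b n x @[n --> \oo] --> ((x \in box a b)%:R : R).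
Proof.
case: (boolP (x \in box a b)) => [|/negP]; rewrite in_setE => xB; last first.
  by rewrite (_ : (fun n => _) = cst 0) ?mulr0n; [exact: cvg_cst|apply/funext => n; exact: box_bump_eq0].
have th (y : R) : 0 < y -> theta 0 (n.+1%:R * y) @[n --> \oo] --> (1 : R).
  move=> y0; rewrite (_ : (fun n => _) = (fun n : nat => expR (- (n.+1%:R^-1 * y^-1)))); last first.
    by apply/funext => n; rewrite /theta mulr_gt0// expr0 mul1r invfM.
  have h1 : (n.+1%:R^-1 : R) @[n --> \oo] --> (0 : R) by exact: (@cvg_harmonic R).
  have h2 : (n.+1%:R^-1 * y^-1 : R) @[n --> \oo] --> 0 * y^-1.
    by apply: cvgM => //; exact: cvg_cst.
  have h3 : expR (- (n.+1%:R^-1 * y^-1)) @[n --> \oo] --> expR (- (0 * y^-1)).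
    by apply: continuous_cvg; [exact: continuous_expR|exact: cvgN h2].
  by rewrite mul0r oppr0 expR0 in h3.
move: xB => []; rewrite /= !in_itv/= => /andP[? ?] /andP[? ?].
have -> : 1%:R = 1 * 1 * (1 * 1) :> R by rewrite !mulr1.
by apply: cvgM; apply: cvgM; apply: th; rewrite subr_gt0.
Qed.

Lemma box_bump_test a b n D : cbox a b `<=` D -> test_function D (box_bump a b n).
Proof.
move=> KD; split; first exact: box_bump_smooth.
exists (cbox a b); split => //; first exact: cbox_compact.
by move=> x nx; apply: box_bump_eq0 => /box_cbox.
Qed.

Lemma fundamental_lemma D (g : plane R -> R) : open D -> locally_integrable2 D g ->
  (forall psi, test_function D psi -> \int[mu]_(x in D) (g x * psi x) = 0) ->
  {ae mu, forall x, D x -> g x = 0}.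
Proof.
move=> oD [mg ig] g0.
have mD : measurable (D : set (mplane R)) by exact: open_mplane.
have iK a b : cbox a b `<=` D -> mu.-integrable (cbox a b) (EFin \o g).
  move=> KD; apply/integrableP; split; last by apply: ig => //; exact: cbox_compact.
  by apply/measurable_EFinP; apply: measurable_funS mg.
(* The bumps are admissible test functions and tend to the indicator of the box; the products are
   dominated by |g| on the closed box. *)
have Ib a b : cbox a b `<=` D -> \int[mu]_(x in box a b) g x = 0.
  move=> KD.
  have mK : measurable (cbox a b : set (mplane R)) by exact: cbox_measurable.
  have Hn n : \int[mu]_(x in cbox a b) (g x * box_bump a b n x) = 0.
    rewrite -[RHS](g0 _ (box_bump_test n KD)) [in RHS]Rintegral_mkcond [LHS]Rintegral_mkcond.
    apply: eq_Rintegral => x _; rewrite /patch; case: ifPn => xK; case: ifPn => //.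
      by rewrite notin_setE => nD; move: xK; rewrite inE => /KD.
    move=> _; rewrite box_bump_eq0 ?mulr0// => /box_cbox.
    by move: xK; rewrite notin_setE.
  have mgK : measurable_fun (cbox a b) (g : mplane R -> R) by exact: measurable_funS mg.
  have [|||||_ h] := @Rdominated_cvg _ _ _ mu (cbox a b) (fun n x => g x * box_bump a b n x)
    (fun x => g x * (x \in box a b)%:R) (fun x => `|g x|) mK.
  + move=> n; apply: measurable_funM => //.
    by apply: continuous_mplane => x; apply: (Ck_continuous (box_bump_smooth a b n 0)).
  + apply: measurable_funM => //.
    exact: (@measurable_indic _ _ R (cbox a b) (box a b) (box_measurable a b)).
  + by apply: aeW => x _; apply: cvgMr; exact: box_bump_cvg.
  + exact: (integrable_abse (iK _ _ KD)).
  + by move=> n x _; rewrite normrM ler_piMr// ger0_norm ?box_bump_ge0//; exact: box_bump_le1.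
  have e : \int[mu]_(x in box a b) g x = \int[mu]_(x in cbox a b) (g x * (x \in box a b)%:R).
    rewrite [LHS]Rintegral_mkcond [RHS]Rintegral_mkcond.
    apply: eq_Rintegral => x _; rewrite /patch; case: (boolP (x \in box a b)) => xB.
      by rewrite mulr1 ifT// inE; apply: box_cbox; rewrite inE in xB.
    by case: ifPn => // _; rewrite mulr0.
  have E0 : (fun n => \int[mu]_(x in cbox a b) (g x * box_bump a b n x)) = cst 0 by apply/funext.
  rewrite E0 in h.
  by rewrite e -(cvg_lim (@Rhausdorff R) h) lim_cst.
(* The function g cut off to this box integrates to 0 over every other box as well, since two boxes
   meet in a box. *)
have loc a b : cbox a b `<=` D -> {ae mu, forall x, box a b x -> g x = 0}.
  move=> KD; have mB := box_measurable a b.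
  have iB : mu.-integrable (box a b) (EFin \o g).
    by apply: (integrableS (cbox_measurable a b)) => //; [exact: box_cbox|exact: iK].
  have := @boxes_ae0 (g \_ (box a b)) _ _ _.
  move=> h; have : {ae mu, forall x, (g \_ (box a b)) x = 0}.
    apply: h.
    - by rewrite -restrict_EFin; apply/integrable_restrict => //; rewrite setTI.
    - by rewrite -Rintegral_mkcond; exact: Ib.
    - move=> c d; rewrite -Rintegral_mkcondl.
      by rewrite boxI; apply: Ib; exact: (subset_trans (@cboxI_sub _ _ _ _)).
  by apply: ae_imp => x; rewrite /patch => + xB; rewrite ifT ?inE.
have rb : forall q : (rat * rat) * (rat * rat), {ae mu, forall x,
    cbox (ratr q.1.1, ratr q.1.2) (ratr q.2.1, ratr q.2.2) `<=` D -> rat_box q x -> g x = 0}.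
  move=> q; have [KD|nKD] := pselect (cbox (ratr q.1.1, ratr q.1.2) (ratr q.2.1, ratr q.2.2) `<=` D).
    by have := loc _ _ KD; apply: ae_imp => x h _ qx; exact: h.
  by apply: ae_all => x KD.
(* The rational boxes are enumerated by [unpickle], so that only countably many null sets are
   united. *)
have : {ae mu, forall x, forall n : nat, forall q : (rat * rat) * (rat * rat), unpickle n = Some q ->
    cbox (ratr q.1.1, ratr q.1.2) (ratr q.2.1, ratr q.2.2) `<=` D -> rat_box q x -> g x = 0}.
  apply/ae_forall_nat => n; case: (unpickle n) => [q|]; last by apply: ae_all.
  by have := rb q; apply: ae_imp => x h _ [<-].
apply: ae_imp => x h Dx.
have /nbhs_plane[e e0 eD] : nbhs x D by exact: open_nbhs_nbhs.
have [q [qx qe]] := rat_box_nbhs x e0.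
by apply: (h (pickle q) q (pickleK q)) => // y yq; apply: eD; exact: qe.
Qed.

End fundamental_lemma.

(** * Test functions and weak gradients *)

Section test_functions.
Variable R : realType.
Local Notation mu := (mu2 R).
Implicit Types (D : set (plane R)) (psi : plane R -> R).

Lemma derivable_line (V : normedModType R) (f : V -> R^o) (x v : V) (s : R) :
  derivable f (x + s *: v) v ->
  is_derive s 1 (fun r : R => f (x + r *: v) : R^o) ('D_v f (x + s *: v)).
Proof.
move=> df.
have E : (fun h => h^-1 *: (((fun r : R => f (x + r *: v) : R^o) \o shift s) (h *: 1) -
      f (x + s *: v))) =
    (fun h : R => h^-1 *: ((f \o shift (x + s *: v)) (h *: v) - f (x + s *: v)) : R^o).
  apply/funext => h /=; congr (_ *: (f _ - _)).
  by rewrite scale_reg mulr1 scalerDl addrCA.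
apply: DeriveDef; first by rewrite /derivable E.
by rewrite /derive E.
Qed.

Lemma mean_value (V : normedModType R) (f : V -> R^o) (x v : V) (h : R) :
  0 < h -> (forall y, derivable f y v) ->
  exists2 s, 0 <= s <= h & f (x + h *: v) - f x = h * 'D_v f (x + s *: v).
Proof.
move=> h0 df.
have D (s : R) : is_derive s 1 (fun r : R => f (x + r *: v) : R^o) ('D_v f (x + s *: v)).
  by apply: derivable_line; exact: df.
have [] := @MVT R (fun r : R => f (x + r *: v)) (fun r => 'D_v f (x + r *: v)) 0 h h0.
  apply: continuous_subspaceT => s; apply: differentiable_continuous.
  by apply/derivable1_diffP; have Ds := D s.
move=> c; rewrite in_itv/= => /andP[c0 ch]; rewrite scale0r addr0 subr0 => ->.
by exists c; rewrite ?(ltW c0) ?(ltW ch)// mulrC.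
Qed.

Lemma smooth_derivable psi (v x : plane R) : smooth (psi : _ -> R^o) ->
  derivable (psi : _ -> R^o) x v.
Proof. by move=> /(_ 1%N) [_ /(_ v)[]]. Qed.

Lemma smooth_derive psi (v : plane R) : smooth (psi : _ -> R^o) ->
  smooth (fun x => 'D_v (psi : _ -> R^o) x : R^o).
Proof. by move=> sp k; have [_ /(_ v)[]] := sp k.+1. Qed.

Lemma smooth_continuous psi : smooth (psi : _ -> R^o) -> continuous (psi : _ -> R^o).
Proof. by move=> /(_ 0%N); exact: Ck_continuous. Qed.

Definition hn (n : nat) : R := n.+1%:R^-1.

Lemma hn_gt0 n : 0 < hn n. Proof. by rewrite invr_gt0. Qed.

Lemma hn_cvg : hn n @[n --> \oo] --> (0 : R).
Proof. exact: (@cvg_harmonic R). Qed.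

(** The step runs through the sequence 1/(n+1) instead of a filter at 0, so that dominated
    convergence applies. *)
Definition dq (u : plane R -> R) (e x : plane R) (n : nat) : R :=
  n.+1%:R * (u (x + hn n *: e) - u x).

Lemma dq_cvg psi (e x : plane R) : derivable (psi : _ -> R^o) x e ->
  dq psi e x n @[n --> \oo] --> 'D_e (psi : _ -> R^o) x.
Proof.
move=> dp.
have := (cvgr_dnbhsP (fun h : R => h^-1 *: ((psi \o shift x) (h *: e) - psi x)) 0 _).1 dp hn.
have h0 : forall n, hn n != 0 by move=> n; rewrite gt_eqF// hn_gt0.
move=> /(_ (conj h0 hn_cvg)); apply: cvg_trans; apply: near_eq_cvg; apply: nearW => n.
by rewrite /dq /hn invrK /= [_ + x]addrC.
Qed.

Definition grad psi (x : plane R) : plane R :=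
  ('D_(1, 0) (psi : _ -> R^o) x, 'D_(0, 1) (psi : _ -> R^o) x).

(** [smooth] speaks of each direction separately; linearity in the direction has to be drawn from
    the continuity of the directional derivatives. *)
Lemma derive_grad psi (e x : plane R) : smooth (psi : _ -> R^o) ->
  'D_e (psi : _ -> R^o) x = dot (grad psi x) e.
Proof.
move=> sp.
have dp v y : derivable (psi : _ -> R^o) y v by exact: smooth_derivable.
have P1 (v1 v2 : plane R) (s : nat -> R) : (forall n, 0 <= s n <= hn n) ->
   'D_v2 (psi : _ -> R^o) (x + hn n *: v1 + s n *: v2) @[n --> \oo] --> 'D_v2 (psi : _ -> R^o) x.
  move=> sh.
  have cs : s n @[n --> \oo] --> (0 : R).
    apply: (squeeze_cvgr _ (cvg_cst 0) hn_cvg); exact: nearW.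
  have c1 : (x + hn n *: v1 + s n *: v2) @[n --> \oo] --> x + 0 *: v1 + 0 *: v2.
    apply: cvgD; last by apply: cvgZl.
    by apply: cvgD; [exact: cvg_cst|apply: cvgZl; exact: hn_cvg].
  rewrite !scale0r !addr0 in c1.
  have cD : {for x, continuous (fun y => 'D_v2 (psi : _ -> R^o) y : R^o)}.
    exact: (smooth_continuous (smooth_derive v2 sp)).
  exact: (cvg_comp _ _ c1 cD).
(* A step along [v1 + v2] is a step along v1 followed by one along v2; the mean value theorem turns
   the second into a derivative at a nearby point, which converges by [P1]. *)
have add v1 v2 : 'D_(v1 + v2) (psi : _ -> R^o) x = 'D_v1 (psi : _ -> R^o) x + 'D_v2 (psi : _ -> R^o) x.
  have H1 := dq_cvg (dp (v1 + v2) x).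
  have H2 := dq_cvg (dp v1 x).
  have /choice[s Hs] : forall n, exists s, 0 <= s <= hn n /\
      psi (x + hn n *: v1 + hn n *: v2) - psi (x + hn n *: v1) = hn n * 'D_v2 (psi : _ -> R^o) (x + hn n *: v1 + s *: v2).
    move=> n; have [s s1 s2] := mean_value (x + hn n *: v1) (hn_gt0 n) (dp v2).
    by exists s.
  have H3 := P1 v1 v2 s (fun n => (Hs n).1).
  have E : (fun n => dq psi (v1 + v2) x n) = (fun n => dq psi v1 x n +
      'D_v2 (psi : _ -> R^o) (x + hn n *: v1 + s n *: v2)).
    apply/funext => n.
    have -> : 'D_v2 (psi : _ -> R^o) (x + hn n *: v1 + s n *: v2) =
       n.+1%:R * (psi (x + hn n *: v1 + hn n *: v2) - psi (x + hn n *: v1)).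
      by rewrite (Hs n).2 /hn mulrA divff ?mul1r.
    by rewrite /dq scalerDr addrA; ring.
  apply: (cvg_unique (@Rhausdorff R) H1); rewrite E; exact: cvgD H2 H3.
(* Both sides are derivatives at 0 of [r |-> psi (x + (c * r) *: v)], one of them computed by the
   chain rule. *)
have hom (c : R) v : 'D_(c *: v) (psi : _ -> R^o) x = c * 'D_v (psi : _ -> R^o) x.
  have Dv : is_derive (c * 0 : R) (1 : R) (fun r : R => psi (x + r *: v) : R^o) ('D_v (psi : _ -> R^o) (x + (c * 0) *: v)).
    by apply: derivable_line; exact: dp.
  have Dcv : is_derive (0 : R) (1 : R) (fun r : R => psi (x + r *: (c *: v)) : R^o) ('D_(c *: v) (psi : _ -> R^o) (x + (0 : R) *: (c *: v))).
    by apply: derivable_line; exact: dp.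
  have Dc : is_derive (0 : R) (1 : R) (fun r : R => c * r : R^o) c.
    have H := @is_deriveZ _ _ _ (@id R) c 0 1 1 (is_derive_id _ _).
    by apply: (is_derive_eq H); rewrite scale_reg mulr1.
  have := is_derive1_comp Dv Dc.
  have -> : (fun r : R => psi (x + r *: v)) \o (fun r : R => c * r) = (fun r : R => psi (x + r *: (c *: v))).
    by apply/funext => r /=; rewrite scalerA [c * r]mulrC.
  move=> D2; have := @derive_val _ _ _ _ _ _ _ D2; rewrite (@derive_val _ _ _ _ _ _ _ Dcv).
  by rewrite mulr0 !scale0r !addr0 mulrC.
rewrite /dot /grad /= [e in LHS](_ : e = e.1 *: (1, 0) + e.2 *: (0, 1)).
  by rewrite add !hom mulrC [X in _ + X]mulrC.
case: e => a b; rewrite /=.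
transitivity ((a * 1 + b * 0, a * 0 + b * 1) : plane R) => //.
by rewrite !mulr1 !mulr0 addr0 add0r.
Qed.

End test_functions.
Arguments hn {R} n.

Section test_functions2.
Variable R : realType.
Local Notation mu := (mu2 R).
Implicit Types (D : set (plane R)) (psi : plane R -> R).

Lemma bounded_set_norm (V : normedModType R) (K : set V) : bounded_set K ->
  exists2 N : R, 0 < N & forall x, K x -> `|x| < N.
Proof.
move=> [M [Mr KM]]; exists (Num.max 1 (M + 2)); first by rewrite lt_max ltr01.
move=> x Kx; rewrite lt_max; apply/orP; right.
by rewrite (@le_lt_trans _ _ (M + 1))//; [apply: KM => //; lra|lra].
Qed.

Lemma compact_norm (V : normedModType R) (K : set V) : compact K ->
  exists2 N : R, 0 < N & forall x, K x -> `|x| < N.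
Proof. by move=> /compact_bounded; exact: bounded_set_norm. Qed.

Lemma continuous_bounded_on (f : plane R -> R^o) (K : set (plane R)) : continuous f ->
  compact K -> exists2 M : R, 0 < M & forall x, K x -> `|f x| <= M.
Proof.
move=> cf cK.
have cfK : compact (f @` K).
  by apply: continuous_compact => //; exact: continuous_subspaceT.
have [M M0 HM] := compact_norm cfK.
by exists M => // x Kx; apply/ltW/HM; exists x.
Qed.

Lemma test_bounded D psi : test_function D psi ->
  exists M N : R, [/\ 0 < M, 0 < N, forall x, `|psi x| <= M & forall x, psi x != 0 -> `|x| < N].
Proof.
move=> [sp [K [cK KD K0]]].
have [M M0 HM] := continuous_bounded_on (smooth_continuous sp) cK.
have [N N0 HN] := compact_norm cK.
exists M, N; split => // x.
  have [Kx|nK] := pselect (K x); first exact: HM.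
  by rewrite (K0 _ nK) normr0 ltW.
by have [Kx _|nK] := pselect (K x); [exact: HN|rewrite (K0 _ nK) eqxx].
Qed.

Lemma test_supp D psi x : test_function D psi -> ~ D x -> psi x = 0.
Proof. by move=> [sp [K [cK KD K0]]] nD; apply: K0 => /KD. Qed.

Lemma test_continuous D psi : test_function D psi -> continuous (psi : _ -> R^o).
Proof. by move=> [sp _]; exact: smooth_continuous. Qed.

Lemma test_measurable D E psi : test_function D psi ->
  measurable_fun E (psi : mplane R -> R).
Proof. by move=> /test_continuous; exact: continuous_mplane. Qed.

Lemma test_derive D psi (v : plane R) : test_function D psi ->
  test_function D (fun x => 'D_v (psi : _ -> R^o) x).
Proof.
move=> [sp [K [cK KD K0]]]; split; first exact: smooth_derive.
exists K; split => // x nK.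
have oK : open (~` K) by apply: closed_openC; apply: compact_closed => //; exact: norm_hausdorff.
have nx : \forall y \near x, 0 = psi y.
  have : nbhs x (~` K) by exact: open_nbhs_nbhs.
  by apply: filterS => y /K0.
have D0 := @near_eq_is_derive _ _ _ (fun=> 0 : R^o) (psi : _ -> R^o) x v 0 nx (is_derive_cst _ _ _).
exact: (@derive_val _ _ _ _ _ _ _ D0).
Qed.

Lemma test_sub D E psi : D `<=` E -> test_function D psi -> test_function E psi.
Proof.
by move=> DE [sp [K [cK KD K0]]]; split => //; exists K; split => // x /KD /DE.
Qed.

Lemma test_integrable D psi : test_function D psi -> mu.-integrable setT (EFin \o psi).
Proof.
move=> tp; have [M [N [M0 N0 HM HN]]] := test_bounded tp.
by apply: (bounded_support_integrable _ HM HN); exact: test_measurable tp.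
Qed.

Lemma li_test_integrable D (g : plane R -> R) psi : open D -> locally_integrable2 D g ->
  test_function D psi -> mu.-integrable D (EFin \o (fun x => g x * psi x)).
Proof.
move=> oD [mg ig] tp; have [M [N [M0 N0 HM HN]]] := test_bounded tp.
have mD : measurable (D : set (mplane R)) by exact: open_mplane.
have [sp [K [cK KD K0]]] := tp.
have mK : measurable (K : set (mplane R)).
  by apply: closed_mplane; apply: compact_closed => //; exact: norm_hausdorff.
have iK : mu.-integrable K (EFin \o g).
  apply/integrableP; split; last exact: ig.
  by apply/measurable_EFinP; apply: measurable_funS mg.
have iD : mu.-integrable D ((EFin \o g) \_ K).
  by apply/integrable_restrict => //; rewrite setIidr.
apply: (@le_integrable _ _ _ mu D mD _ (fun x => M%:E * ((EFin \o g) \_ K) x)%E).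
- by apply/measurable_EFinP; apply: measurable_funM => //; exact: test_measurable tp.
- move=> x Dx; rewrite /patch; case: ifPn => xK /=.
    by rewrite lee_fin !normrM mulrC ler_pM// (le_trans (HM x))// ler_norm.
  by rewrite K0 ?mulr0 ?mule0 ?normr0//; move: xK; rewrite notin_setE.
- exact: integrableZl.
Qed.

Lemma mean_value_le psi (v x : plane R) (h M : R) : smooth (psi : _ -> R^o) ->
  0 <= h -> (forall y, `|'D_v (psi : _ -> R^o) y| <= M) ->
  `|psi (x + h *: v) - psi x| <= h * M.
Proof.
move=> sp; rewrite le_eqVlt => /orP[/eqP <-|h0] HM.
  by rewrite scale0r addr0 subrr normr0 mul0r.
have dp y : derivable (psi : _ -> R^o) y v by exact: smooth_derivable.
have [s _ ->] := mean_value x h0 dp.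
by rewrite normrM gtr0_norm// ler_pM2l.
Qed.

Lemma mean_value_norm psi (v x : plane R) (h M : R) : smooth (psi : _ -> R^o) ->
  (forall y, `|'D_v (psi : _ -> R^o) y| <= M) ->
  `|psi (x + h *: v) - psi x| <= M * `|h|.
Proof.
move=> sp HM; have [h0|h0] := leP 0 h.
  by rewrite (ger0_norm h0) [leRHS]mulrC; exact: mean_value_le.
rewrite (ltr0_norm h0) distrC [leRHS]mulrC.
have -> : psi x = psi ((x + h *: v) + (- h) *: v) by rewrite scaleNr addrK.
by apply: mean_value_le => //; rewrite oppr_ge0 ltW.
Qed.

Lemma test_lipschitz D psi : test_function D psi ->
  exists2 L : R, 0 < L & forall x y, `|psi x - psi y| <= L * `|x - y|.
Proof.
move=> tp; have sp := tp.1.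
have [M1 [_ [M10 _ H1 _]]] := test_bounded (test_derive (1, 0) tp).
have [M2 [_ [M20 _ H2 _]]] := test_bounded (test_derive (0, 1) tp).
have step (v : plane R) M x (h : R) : (forall y, `|'D_v (psi : _ -> R^o) y| <= M) ->
    `|psi (x + h *: v) - psi x| <= M * `|h| by exact: mean_value_norm.
exists (M1 + M2); first exact: addr_gt0.
move=> x y.
have e : x = (y + (x.1 - y.1) *: (1, 0)) + (x.2 - y.2) *: (0, 1).
  case: x => x1 x2; case: y => y1 y2 /=.
  transitivity ((y1 + (x1 - y1) * 1 + (x2 - y2) * 0, y2 + (x1 - y1) * 0 + (x2 - y2) * 1) : plane R) => //.
  by congr pair; ring.
rewrite {1}e; rewrite (_ : _ - psi y = (psi (y + (x.1 - y.1) *: (1, 0) + (x.2 - y.2) *: (0, 1)) -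
  psi (y + (x.1 - y.1) *: (1, 0))) + (psi (y + (x.1 - y.1) *: (1, 0)) - psi y)); last by ring.
apply: (le_trans (ler_normD _ _)); rewrite mulrDl addrC; apply: lerD.
  apply: le_trans (step _ _ _ _ H1) _; rewrite ler_pM2l// prod_normE le_max.
  by rewrite /= lexx.
apply: le_trans (step _ _ _ _ H2) _; rewrite ler_pM2l// prod_normE le_max.
by rewrite /= lexx orbT.
Qed.

End test_functions2.

(** * Weak gradients of Lipschitz functions *)

Section lipschitz_weak_gradient.
Variable R : realType.
Local Notation mu := (mu2 R).
Implicit Types (D : set (plane R)) (psi : plane R -> R).

Definition lipschitz_plane (L : R) (v : plane R -> R) :=
  forall x y, `|v x - v y| <= L * `|x - y|.

Lemma lipschitz_plane_continuous L v : lipschitz_plane L v -> continuous (v : _ -> R^o).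
Proof.
move=> Lv x; apply/cvgrPdist_lt => e e0.
have L0 : 0 < `|L| + 1 by rewrite ltr_wpDl.
near=> y; apply: le_lt_trans (Lv x y) _.
apply: (@le_lt_trans _ _ ((`|L| + 1) * `|x - y|)).
  by rewrite ler_wpM2r// (le_trans (ler_norm L))// lerDl.
rewrite -ltr_pdivlMl//; near: y; apply: (cvgrPdist_lt _ _).1; first exact: cvg_id.
by rewrite mulr_gt0// invr_gt0.
Unshelve. all: by end_near.
Qed.

Lemma continuous_li D v : open D -> continuous (v : _ -> R^o) -> locally_integrable2 D v.
Proof.
move=> oD cv; split; first exact: continuous_mplane.
move=> K KD cK; have [M M0 HM] := continuous_bounded_on cv cK.
have [N N0 HN] := compact_norm cK.
have mK : measurable (K : set (mplane R)).
  by apply: closed_mplane; apply: compact_closed => //; exact: norm_hausdorff.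
have : mu.-integrable setT (EFin \o (v \_ K)).
  apply: (@bounded_support_integrable R _ M N).
  - by apply/(measurable_restrictT _ mK); exact: continuous_mplane.
  - move=> x; rewrite /patch; case: ifPn => [|_]; last by rewrite normr0 ltW.
    by rewrite inE => /HM.
  - move=> x; rewrite /patch; case: ifPn => [|_]; last by rewrite eqxx.
    by rewrite inE => /HN.
rewrite -restrict_EFin => iv.
have := (integrable_mkcond _ mK).2 iv.
by move=> /integrableP[].
Qed.

Lemma bounded_li D v (M : R) : open D -> measurable_fun setT (v : mplane R -> R) ->
  (forall x, `|v x| <= M) -> locally_integrable2 D v.
Proof.
move=> oD mv HM; split; first by apply: measurable_funS mv.
move=> K KD cK; have [N N0 HN] := compact_norm cK.
have mK : measurable (K : set (mplane R)).
  by apply: closed_mplane; apply: compact_closed => //; exact: norm_hausdorff.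
have : mu.-integrable setT (EFin \o (v \_ K)).
  apply: (@bounded_support_integrable R _ M N).
  - by apply/(measurable_restrictT _ mK); apply: measurable_funS mv.
  - move=> x; rewrite /patch; case: ifPn => [_|_]; first exact: HM.
    by rewrite normr0 (le_trans _ (HM 0)).
  - move=> x; rewrite /patch; case: ifPn => [|_]; last by rewrite eqxx.
    by rewrite inE => /HN.
rewrite -restrict_EFin => iv.
have := (integrable_mkcond _ mK).2 iv.
by move=> /integrableP[].
Qed.

Lemma continuous_translate (u : plane R -> R) (w : plane R) :
  continuous (u : _ -> R^o) -> continuous ((fun x : plane R => u (x + w)) : plane R -> R^o).
Proof.
move=> cu x; apply: (@continuous_comp _ _ _ (fun x : plane R => x + w) (u : _ -> R^o)).
  by apply: cvgD; [exact: cvg_id|exact: cvg_cst].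
exact: cu.
Qed.

Lemma Rintegral_supp D (f : plane R -> R) : (forall x, ~ D x -> f x = 0) ->
  \int[mu]_(x in D) f x = \int[mu]_x f x.
Proof.
move=> f0; rewrite Rintegral_mkcond; apply: eq_Rintegral => x _.
by rewrite /patch; case: ifPn => //; rewrite notin_setE => /f0.
Qed.

(** Discrete integration by parts: translating the variable by [hn n *: e] moves the quotient from
    psi to v and reverses its direction. *)
Lemma dq_integral (v psi : plane R -> R) (e : plane R) n D :
  continuous (v : _ -> R^o) -> test_function D psi ->
  \int[mu]_x (v x * dq psi e x n) = \int[mu]_x (dq v (- e) x n * psi x).
Proof.
move=> cv tp.
have tpT : test_function setT psi by exact: test_sub tp.
have liv : locally_integrable2 setT v by apply: continuous_li => //; exact: openT.
have iv : mu.-integrable setT (EFin \o (fun x => v x * psi x)).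
  by apply: li_test_integrable => //; exact: openT.
pose f (x : plane R) := v (x + - (hn n *: e)) * psi x.
have cvt := continuous_translate (w := - (hn n *: e)) cv.
have iF : mu.-integrable setT (EFin \o f).
  apply: li_test_integrable => //; first exact: openT.
  by apply: continuous_li => //; exact: openT.
have iF' := integrable_translate (hn n *: e) iF.
transitivity (n.+1%:R * (\int[mu]_x f (x + hn n *: e) - \int[mu]_x (v x * psi x))).
  rewrite -RintegralB// -RintegralZl//; last first.
    have := integrableB measurableT iF' iv.
    by [].
  by apply: eq_Rintegral => x _; rewrite /dq /f addrK; ring.
rewrite Rintegral_translate; last by have /integrableP[/measurable_EFinP] := iF.
rewrite -RintegralB// -RintegralZl//; last first.
  have := integrableB measurableT iF iv.
  by [].
by apply: eq_Rintegral => x _; rewrite /dq /f scalerN; ring.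
Qed.

(** The null sequence u is arbitrary: [hn] serves for weak gradients, while the derivative of a
    mollification is tested along every sequence. *)
Lemma dq_dominated (v psi : plane R -> R) (e : plane R) (u : nat -> R) D :
  continuous (v : _ -> R^o) -> test_function D psi ->
  (forall n, u n != 0) -> u n @[n --> \oo] --> (0 : R) ->
  \int[mu]_x (v x * ((u n)^-1 * (psi (x + u n *: e) - psi x))) @[n --> \oo] -->
    \int[mu]_x (v x * 'D_e (psi : _ -> R^o) x).
Proof.
move=> cv tp u0 cu.
have [Mp [N [Mp0 N0 HMp HN]]] := test_bounded tp.
have [Md [_ [Md0 _ HMd _]]] := test_bounded (test_derive e tp).
have mv : measurable_fun setT (v : mplane R -> R) by exact: continuous_mplane.
have [U0 U00 HU] : exists2 U0, 0 < U0 & forall n, `|u n| <= U0.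
  have [M [Mr HM]] := cvg_seq_bounded (cvgP _ cu).
  exists (Num.max 1 (M + 1)); first by rewrite lt_max ltr01.
  by move=> n; rewrite le_max; apply/orP; right; apply: HM => //; lra.
(* Beyond this radius neither x nor [x + u n *: e] meets the support of psi, so the quotient
   vanishes. *)
pose N' := N + U0 * `|e|.
pose B := box (- N', - N') (N', N').
have mB : measurable (B : set (mplane R)) by exact: box_measurable.
have Bnorm x : `|x| < N' <-> B x.
  rewrite prod_normE gt_max /B /box /= !ltr_norml !in_itv/=.
  by split => [/andP[] //|[-> ->]].
have [C C0 HC] := continuous_bounded_on cv (@cbox_compact R (- N', - N') (N', N')).
have vB x : B x -> `|v x| <= C by move=> /box_cbox; exact: HC.
have [|||||_ H] := @Rdominated_cvg _ (mplane R) R mu setT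
    (fun n x => v x * ((u n)^-1 * (psi (x + u n *: e) - psi x)))
    (fun x => v x * 'D_e (psi : _ -> R^o) x) (fun x => C * Md * \1_B x) measurableT; last exact: H.
+ move=> n; apply: measurable_funM => //; apply: measurable_funM => //.
  apply: measurable_funB; last exact: test_measurable tp.
  by apply: continuous_mplane; apply: continuous_translate; exact: test_continuous tp.
+ by apply: measurable_funM => //; exact: test_measurable (test_derive e tp).
+ apply: ae_all => x _; apply: cvgMr.
  have dp : derivable (psi : _ -> R^o) x e by exact: smooth_derivable tp.1.
  have := (cvgr_dnbhsP (fun h : R => h^-1 *: ((psi \o shift x) (h *: e) - psi x)) 0 _).1 dp u (conj u0 cu).
  apply: cvg_trans; apply: near_eq_cvg; apply: nearW => n.
  by rewrite /= [_ + x]addrC.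
+ apply: integrableRZ => //; apply: (bounded_support_integrable (M := 1) (N := N')).
  * exact: measurable_indic.
  * by move=> x; rewrite indicE; case: (x \in B); rewrite ?normr1 ?normr0.
  * move=> x; rewrite indicE; case: (boolP (x \in B)); last by rewrite eqxx.
    by rewrite inE => /Bnorm.
+ move=> n x _; have un0 : 0 < `|u n| by rewrite normr_gt0.
  have [xB|xB] := boolP (x \in B).
    rewrite indicE xB mulr1 normrM ler_pM//; first by apply: vB; rewrite inE in xB.
    rewrite normrM normfV ler_pdivrMl// mulrC; exact: (mean_value_norm _ _ tp.1 HMd).
  have xN : N' <= `|x| by rewrite leNgt; apply/negP => /Bnorm; move: xB; rewrite notin_setE.
  rewrite indicE (negbTE xB) mulr0.
  have z (y : plane R) : N <= `|y| -> psi y = 0.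
    by move=> Ny; apply/eqP/negPn/negP => /HN; rewrite ltNge Ny.
  rewrite !z ?subrr ?mulr0 ?normr0//.
    by apply: le_trans xN; rewrite lerDl mulr_ge0// ltW.
  rewrite -(lerD2r (U0 * `|e|)); apply: le_trans xN _.
  rewrite -[x in leLHS](addrK (u n *: e)); apply: le_trans (ler_normB _ _) _.
  by rewrite lerD2l normrZ ler_wpM2r.
Qed.

(** The discrete integration by parts passes to the limit: the quotients of psi converge on one
    side, those of v on the other, where the Lipschitz bound dominates them. Convergence of the
    latter is a hypothesis, which is checked directly for smooth and for piecewise affine
    functions. *)
Lemma lipschitz_weak_grad D (v : plane R -> R) (c : plane R -> plane R) (L M : R) :
  open D -> lipschitz_plane L v ->
  measurable_fun setT ((fun x => (c x).1) : mplane R -> R) ->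
  measurable_fun setT ((fun x => (c x).2) : mplane R -> R) ->
  (forall x, `|(c x).1| <= M) -> (forall x, `|(c x).2| <= M) ->
  (forall e, {ae mu, forall x, dq v e x n @[n --> \oo] --> dot (c x) e}) ->
  is_weak_grad D v c.
Proof.
move=> oD Lv mc1 mc2 bc1 bc2 vc.
have cv := lipschitz_plane_continuous Lv.
split.
- exact: continuous_li.
- exact: bounded_li bc1.
- exact: bounded_li bc2.
move=> psi tp e.
have [Mp [N [Mp0 N0 HMp HN]]] := test_bounded tp.
have [Md [_ [Md0 _ HMd _]]] := test_bounded (test_derive e tp).
rewrite Rintegral_supp; last by move=> x nD; rewrite (test_supp (test_derive e tp) nD) mulr0.
rewrite [in RHS]Rintegral_supp; last by move=> x nD; rewrite (test_supp tp nD) mulr0.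
have mv : measurable_fun setT (v : mplane R -> R) by exact: continuous_mplane.
have mt (u : plane R -> R) (w : plane R) n : continuous (u : _ -> R^o) ->
    measurable_fun setT ((fun x => dq u w x n) : mplane R -> R).
  move=> cu; apply: continuous_mplane => x; apply: cvgMr; apply: cvgB; last exact: cu.
  exact: (continuous_translate cu).
have A : \int[mu]_x (v x * dq psi e x n) @[n --> \oo] -->
    \int[mu]_x (v x * 'D_e (psi : _ -> R^o) x).
  have := dq_dominated (e := e) cv tp (fun n => lt0r_neq0 (hn_gt0 R n)) (@hn_cvg R).
  by under eq_fun do under eq_Rintegral do rewrite invrK.
have B : \int[mu]_x (dq v (- e) x n * psi x) @[n --> \oo] -->
    \int[mu]_x (dot (c x) (- e) * psi x).
  have [|||||_ H] := @Rdominated_cvg _ (mplane R) R mu setT (fun n x => dq v (- e) x n * psi x)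
    (fun x => dot (c x) (- e) * psi x) (fun x => `|L| * `|e| * `|psi x|) measurableT; last exact: H.
  + by move=> n; apply: measurable_funM; [exact: mt|exact: test_measurable tp].
  + apply: measurable_funM; last exact: test_measurable tp.
    by apply: measurable_funD; apply: measurable_funM.
  + by apply: ae_imp (vc (- e)) => x vx _; apply: cvgMl.
  + apply: integrableRZ => //; exact: (integrable_abse (test_integrable tp)).
  + move=> n x _; rewrite normrM ler_wpM2r// /dq normrM ger0_norm// -ler_pdivlMl//.
    apply: le_trans (Lv _ _) _; rewrite [x + _]addrC addrK normrZ normrN gtr0_norm ?hn_gt0//.
    rewrite mulrCA; apply: ler_wpM2l; first by rewrite ltW// hn_gt0.
    by rewrite ler_wpM2r// ler_norm.
have E : (fun n => \int[mu]_x (v x * dq psi e x n)) = (fun n => \int[mu]_x (dq v (- e) x n * psi x)).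
  by apply/funext => n; exact: (dq_integral e n cv tp).
rewrite E in A.
rewrite (cvg_unique (@Rhausdorff R) A B).
rewrite -[RHS]mulN1r -RintegralZl//.
  by apply: eq_Rintegral => x _; rewrite /dot /=; ring.
have li : locally_integrable2 D (fun x => dot (c x) e).
  apply: (@bounded_li _ _ (M * `|e.1| + M * `|e.2|)) => //.
    by apply: measurable_funD; apply: measurable_funM.
  move=> x; apply: le_trans (ler_normD _ _) _; rewrite !normrM.
  by apply: lerD; rewrite ler_wpM2r.
apply: li_test_integrable (test_sub _ tp) => //; first exact: openT.
apply: (@bounded_li _ _ (M * `|e.1| + M * `|e.2|)) => //; first exact: openT.
  by apply: measurable_funD; apply: measurable_funM.
move=> x; apply: le_trans (ler_normD _ _) _; rewrite !normrM.
by apply: lerD; rewrite ler_wpM2r.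
Qed.

End lipschitz_weak_gradient.

(** * The spaces H1 and H10 *)

Section sobolev.
Variable R : realType.
Local Notation mu := (mu2 R).
Variable D : set (plane R).
Hypothesis oD : open D.
Implicit Types (u v : plane R -> R) (F G : plane R -> plane R).

Let mD : measurable (D : set (mplane R)). Proof. exact: open_mplane. Qed.

Lemma compact_mplane (K : set (plane R)) : compact K -> measurable (K : set (mplane R)).
Proof. by move=> cK; apply: closed_mplane; apply: compact_closed => //; exact: norm_hausdorff. Qed.

Lemma li_integrable (K : set (plane R)) u : K `<=` D -> compact K -> locally_integrable2 D u ->
  mu.-integrable K (EFin \o u).
Proof.
move=> KD cK [mu ig]; apply/integrableP; split; last exact: ig.
by apply/measurable_EFinP; apply: measurable_funS mu.
Qed.

Lemma li_lin (c : R) u v : locally_integrable2 D u -> locally_integrable2 D v ->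
  locally_integrable2 D (fun x => c * u x + v x).
Proof.
move=> lu lv; split.
  by apply: measurable_funD; [apply: measurable_funM => //; exact: lu.1|exact: lv.1].
move=> K KD cK; have mK := compact_mplane cK.
have : mu.-integrable K (EFin \o (fun x => c * u x + v x)).
  by apply: integrableRD => //; [apply: integrableRZ => //|]; exact: li_integrable.
by move=> /integrableP[].
Qed.

Lemma li_dot F (e : plane R) : locally_integrable2 D (fun x => (F x).1) ->
  locally_integrable2 D (fun x => (F x).2) -> locally_integrable2 D (fun x => dot (F x) e).
Proof.
move=> l1 l2; have l0 : locally_integrable2 D (fun=> 0).
  by apply: continuous_li => // x; exact: cvg_cst.
have -> : (fun x => dot (F x) e) = (fun x => e.1 * (F x).1 + (e.2 * (F x).2 + 0)).
  by apply/funext => x; rewrite /dot; ring.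
by apply: li_lin => //; exact: li_lin.
Qed.

Lemma sqint_li u : sqint mu D u -> locally_integrable2 D u.
Proof.
move=> su; split; first exact: su.1.
move=> K KD cK; have mK := compact_mplane cK.
have : mu.-integrable K (EFin \o u).
  have [N N0 HN] := compact_norm cK.
  have s1 : sqint mu K (fun=> 1).
    apply: (@sqint_bounded _ _ _ mu _ _ 1) => //; last by move=> x _; rewrite normr1.
    apply: (@le_lt_trans _ _ (mu (box (- N, - N) (N, N)))).
      apply: le_measure; rewrite ?inE//; first exact: box_measurable.
      move=> x /HN; rewrite prod_normE gt_max => /andP[].
      by rewrite /box /= !ltr_norml !in_itv /= => /andP[-> ->] /andP[-> ->].
    by rewrite mu2_box ?ltry//=; lra.
  have := sqint_mul mK (sqintS mD mK KD su) s1.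
  by under eq_fun do rewrite mulr1.
by move=> /integrableP[].
Qed.

Lemma weak_grad_lin (c : R) u v F G : is_weak_grad D u F -> is_weak_grad D v G ->
  is_weak_grad D (fun x => c * u x + v x) (fun x => c *: F x + G x).
Proof.
move=> [lu lF1 lF2 wu] [lv lG1 lG2 wv].
split; [exact: li_lin|exact: (li_lin c lF1 lG1)|exact: (li_lin c lF2 lG2)|].
move=> psi tp e; have td := test_derive e tp.
have I1 := li_test_integrable oD lu td; have I2 := li_test_integrable oD lv td.
have lFe := li_dot e lF1 lF2; have lGe := li_dot e lG1 lG2.
have I3 := li_test_integrable oD lFe tp; have I4 := li_test_integrable oD lGe tp.
transitivity (c * \int[mu]_(x in D) (u x * 'D_e (psi : _ -> R^o) x) +
   \int[mu]_(x in D) (v x * 'D_e (psi : _ -> R^o) x)).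
  rewrite -RintegralZl// -RintegralD//; last exact: integrableRZ.
  by apply: eq_Rintegral => x _; ring.
rewrite wu// wv// mulrN -opprD; congr (- _).
rewrite -RintegralZl// -RintegralD//; last exact: integrableRZ.
by apply: eq_Rintegral => x _; rewrite /dot /= /GRing.scale/=; ring.
Qed.

(** Each coordinate of the difference is orthogonal to all test functions, so the fundamental lemma
    applies. *)
Lemma weak_grad_unique u F G : is_weak_grad D u F -> is_weak_grad D u G ->
  {ae mu, forall x, D x -> F x = G x}.
Proof.
move=> [lu lF1 lF2 wF] [_ lG1 lG2 wG].
have aux (p : plane R -> R) (e : plane R) :
    (forall F' x, dot (F' x) e = p (F' x)) ->
    locally_integrable2 D (p \o F) -> locally_integrable2 D (p \o G) ->
    {ae mu, forall x, D x -> p (F x) = p (G x)}.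
  move=> pe lF lG.
  have l0 := li_lin (-1) lF lG.
  have : {ae mu, forall x, D x -> -1 * (p \o F) x + (p \o G) x = 0}.
    apply: fundamental_lemma => // psi tp.
    have I1 := li_test_integrable oD lF tp; have I2 := li_test_integrable oD lG tp.
    transitivity (-1 * \int[mu]_(x in D) ((p \o F) x * psi x) + \int[mu]_(x in D) ((p \o G) x * psi x)).
      rewrite -RintegralZl// -RintegralD//; last exact: integrableRZ.
      by apply: eq_Rintegral => x _; ring.
    have e1 : \int[mu]_(x in D) ((p \o F) x * psi x) = \int[mu]_(x in D) (dot (F x) e * psi x).
      by apply: eq_Rintegral => x _; rewrite pe.
    have e2 : \int[mu]_(x in D) ((p \o G) x * psi x) = \int[mu]_(x in D) (dot (G x) e * psi x).
      by apply: eq_Rintegral => x _; rewrite pe.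
    rewrite e1 e2; have := wF psi tp e; rewrite (wG psi tp e) => /oppr_inj ->; ring.
  by apply: ae_imp => x h Dx; have := h Dx; rewrite /=; lra.
have h1 := aux (fun y => y.1) (1, 0) _ lF1 lG1.
have h2 := aux (fun y => y.2) (0, 1) _ lF2 lG2.
have /ae_and : {ae mu, forall x, D x -> (F x).1 = (G x).1}.
  by apply: h1 => F' x; rewrite /dot /= mulr1 mulr0 addr0.
move=> /(_ (fun x => D x -> (F x).2 = (G x).2)) H.
have : {ae mu, forall x, (D x -> (F x).1 = (G x).1) /\ (D x -> (F x).2 = (G x).2)}.
  by apply: H; apply: h2 => F' x; rewrite /dot /= mulr1 mulr0 add0r.
apply: ae_imp => x [e1 e2] Dx.
by rewrite [LHS]surjective_pairing [RHS]surjective_pairing e1// e2.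
Qed.

Definition sqint2 F := sqint mu D (fun x => (F x).1) /\ sqint mu D (fun x => (F x).2).

(** [wgrad] is a chosen weak gradient, a priori different from the square-integrable witness
    contained in [H1]; almost-everywhere uniqueness transfers integrability to it. *)
Lemma H1P u : H1 D u -> [/\ sqint mu D u, is_weak_grad D u (wgrad D u) & sqint2 (wgrad D u)].
Proof.
move=> [/(LpE _ mD) su [G [wG /(LpE _ mD) G1 /(LpE _ mD) G2]]].
have wg : is_weak_grad D u (wgrad D u).
  by rewrite /wgrad; apply: (xgetPex _ (P := [set G | is_weak_grad D u G])); exists G.
have := weak_grad_unique wG wg; move=> ae; split => //.
have aux (p : plane R -> R) : sqint mu D (p \o G) -> locally_integrable2 D (p \o wgrad D u) ->
    sqint mu D (p \o wgrad D u).
  move=> sG [mw _]; split => //.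
  have <- : (\int[mu]_(x in D) (p (G x) ^+ 2)%:E = \int[mu]_(x in D) ((p \o wgrad D u) x ^+ 2)%:E)%E.
    apply: ae_eq_integral => //.
    - by apply/measurable_EFinP; apply: measurable_funX; exact: sG.1.
    - by apply/measurable_EFinP; apply: measurable_funX.
    - by apply: ae_imp ae => x h Dx /=; rewrite h.
  exact: sG.2.
case: wg => _ l1 l2 _.
by split; [exact: (aux fst G1 l1)|exact: (aux snd G2 l2)].
Qed.

Lemma H1_intro u G : sqint mu D u -> is_weak_grad D u G -> sqint2 G ->
  H1 D u /\ {ae mu, forall x, D x -> wgrad D u x = G x}.
Proof.
move=> su wG [G1 G2].
have Hu : H1 D u.
  split; first exact/LpE.
  by exists G; split => //; exact/LpE.
split => //; have [_ wu _] := H1P Hu; exact: weak_grad_unique wu wG.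
Qed.

Lemma sqint_lin (c : R) u v : sqint mu D u -> sqint mu D v ->
  sqint mu D (fun x => c * u x + v x).
Proof. by move=> su sv; apply: sqintD => //; exact: sqintZ. Qed.

Lemma H1_lin (c : R) u v : H1 D u -> H1 D v ->
  H1 D (fun x => c * u x + v x) /\
  {ae mu, forall x, D x -> wgrad D (fun x => c * u x + v x) x = c *: wgrad D u x + wgrad D v x}.
Proof.
move=> /H1P[su wu [u1 u2]] /H1P[sv wv [v1 v2]].
apply: (@H1_intro _ (fun x => c *: wgrad D u x + wgrad D v x)).
- exact: sqint_lin.
- exact: weak_grad_lin.
- by split; [exact: (sqint_lin c u1 v1)|exact: (sqint_lin c u2 v2)].
Qed.

Lemma H1B u v : H1 D u -> H1 D v ->
  H1 D (fun x => u x - v x) /\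
  {ae mu, forall x, D x -> wgrad D (fun x => u x - v x) x = wgrad D u x - wgrad D v x}.
Proof.
move=> Hu Hv; have [] := H1_lin (-1) Hv Hu.
have -> : (fun x => -1 * v x + u x) = (fun x => u x - v x) by apply/funext => x; ring.
move=> h1 h2; split => //; apply: ae_imp h2 => x h Dx.
by rewrite h// scaleN1r addrC.
Qed.

Lemma vnorm_sqr (w : plane R) : vnorm w ^+ 2 = w.1 ^+ 2 + w.2 ^+ 2.
Proof. by rewrite sqr_sqrtr ?addr_ge0// -?expr2 ?sqr_ge0. Qed.

Lemma sqint_vnorm F : sqint2 F -> sqint mu D (fun x => vnorm (F x)) /\
  nsq mu D (fun x => vnorm (F x)) = nsq mu D (fun x => (F x).1) + nsq mu D (fun x => (F x).2).
Proof.
move=> [F1 F2].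
have E : (fun x => vnorm (F x) ^+ 2) = (fun x => (F x).1 ^+ 2 + (F x).2 ^+ 2).
  by apply/funext => x; exact: vnorm_sqr.
split; last first.
  rewrite /nsq -RintegralD//; [|exact: sqint_sqr..].
  by apply: eq_Rintegral => x _; exact: vnorm_sqr.
apply: sqintP => //.
  apply: (@measurableT_comp _ _ _ _ _ _ (@Num.sqrt R)).
    by apply: continuous_measurable_fun => x; exact: sqrt_continuous.
  by apply: measurable_funD; apply: measurable_funM; [exact: F1.1|exact: F1.1|exact: F2.1|exact: F2.1].
by rewrite E; apply: integrableRD => //; exact: sqint_sqr.
Qed.

Definition gnrm F : R := nrm mu D (fun x => vnorm (F x)).

Lemma L2vnormE F : sqint2 F -> L2vnorm D F = (gnrm F)%:E.
Proof. by move=> /sqint_vnorm[sF _]; exact: L2normE. Qed.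

Lemma gnrm_sqr F : sqint2 F -> gnrm F ^+ 2 = nsq mu D (fun x => (F x).1) + nsq mu D (fun x => (F x).2).
Proof. by move=> /sqint_vnorm[sF <-]; rewrite sqr_sqrtr// nsq_ge0. Qed.

Lemma H1normE u : H1 D u -> H1norm D u = Num.sqrt (nrm mu D u ^+ 2 + gnrm (wgrad D u) ^+ 2).
Proof.
move=> /H1P[su _ sw]; rewrite /H1norm L2normE// L2vnormE//.
Qed.

Lemma nrm_le_H1norm u : H1 D u -> nrm mu D u <= H1norm D u.
Proof.
move=> Hu; rewrite H1normE// -[leLHS]ger0_norm ?nrm_ge0// -sqrtr_sqr.
by rewrite ler_wsqrtr// lerDl sqr_ge0.
Qed.

Lemma gnrm_le_H1norm u : H1 D u -> gnrm (wgrad D u) <= H1norm D u.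
Proof.
move=> Hu; rewrite H1normE// -[leLHS]ger0_norm ?nrm_ge0// -sqrtr_sqr.
by rewrite ler_wsqrtr// lerDr sqr_ge0.
Qed.

Lemma nrm1_le_gnrm F : sqint2 F -> nrm mu D (fun x => (F x).1) <= gnrm F.
Proof.
move=> sF; rewrite -(@ler_pXn2r _ 2)// ?nnegrE ?nrm_ge0// gnrm_sqr//.
by rewrite sqr_sqrtr ?nsq_ge0// lerDl nsq_ge0.
Qed.

Lemma nrm2_le_gnrm F : sqint2 F -> nrm mu D (fun x => (F x).2) <= gnrm F.
Proof.
move=> sF; rewrite -(@ler_pXn2r _ 2)// ?nnegrE ?nrm_ge0// gnrm_sqr//.
by rewrite sqr_sqrtr ?nsq_ge0// lerDr nsq_ge0.
Qed.

Lemma H1norm_ge0 u : 0 <= H1norm D u. Proof. exact: sqrtr_ge0. Qed.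

Lemma H1norm_le_sum u : H1 D u -> H1norm D u <= nrm mu D u +
  (nrm mu D (fun x => (wgrad D u x).1) + nrm mu D (fun x => (wgrad D u x).2)).
Proof.
move=> Hu; have [_ _ sw] := H1P Hu; rewrite H1normE// gnrm_sqr//.
set a := nrm _ _ _; have a0 : 0 <= a by exact: nrm_ge0.
rewrite -(sqr_sqrtr (nsq_ge0 mu D (fun x => (wgrad D u x).1))).
rewrite -(sqr_sqrtr (nsq_ge0 mu D (fun x => (wgrad D u x).2))).
rewrite -/(nrm mu D (fun x => (wgrad D u x).1)) -/(nrm mu D (fun x => (wgrad D u x).2)).
set b := nrm _ _ _; set c := nrm _ _ _.
have b0 : 0 <= b by exact: nrm_ge0. have c0 : 0 <= c by exact: nrm_ge0.
rewrite -[leRHS]ger0_norm ?addr_ge0// -sqrtr_sqr ler_wsqrtr//.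
have := mulr_ge0 a0 b0; have := mulr_ge0 b0 c0; have := mulr_ge0 a0 c0; nra.
Qed.

Lemma ae_eq_nrm u v : sqint mu D u -> sqint mu D v -> {ae mu, forall x, D x -> u x = v x} ->
  nrm mu D u = nrm mu D v.
Proof. by move=> su sv uv; congr Num.sqrt; exact: ae_eq_nsq. Qed.

(** The crude constant 3 suffices for density arguments: the norm is at most a sum of three L2
    norms, each subadditive and bounded by the H1 norm. *)
Lemma H1norm_triangle u v : H1 D u -> H1 D v ->
  H1norm D (fun x => u x - v x) <= 3 * H1norm D u + 3 * H1norm D v.
Proof.
move=> Hu Hv; have [Huv ae] := H1B Hu Hv.
have [su _ [u1 u2]] := H1P Hu; have [sv _ [v1 v2]] := H1P Hv.
have [suv _ [w1 w2]] := H1P Huv.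
apply: le_trans (H1norm_le_sum Huv) _.
have e0 : nrm mu D (fun x => u x - v x) <= nrm mu D u + nrm mu D v by exact: nrmB.
have e1 : nrm mu D (fun x => (wgrad D (fun x => u x - v x) x).1) <=
   nrm mu D (fun x => (wgrad D u x).1) + nrm mu D (fun x => (wgrad D v x).1).
  apply: le_trans (nrmB mD u1 v1); rewrite le_eqVlt; apply/orP; left; apply/eqP.
  apply: ae_eq_nrm => //; first exact: (sqintB mD u1 v1).
  by apply: ae_imp ae => x h Dx; rewrite h.
have e2 : nrm mu D (fun x => (wgrad D (fun x => u x - v x) x).2) <=
   nrm mu D (fun x => (wgrad D u x).2) + nrm mu D (fun x => (wgrad D v x).2).
  apply: le_trans (nrmB mD u2 v2); rewrite le_eqVlt; apply/orP; left; apply/eqP.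
  apply: ae_eq_nrm => //; first exact: (sqintB mD u2 v2).
  by apply: ae_imp ae => x h Dx; rewrite h.
have L (n0 n1 n2 a0 a1 a2 b0 b1 b2 U V : R) : n0 <= a0 + b0 -> n1 <= a1 + b1 ->
    n2 <= a2 + b2 -> a0 <= U -> b0 <= V -> a1 <= U -> b1 <= V -> a2 <= U -> b2 <= V ->
    n0 + (n1 + n2) <= 3 * U + 3 * V by clear; lra.
apply: (L _ _ _ _ _ _ _ _ _ _ _ e0 e1 e2).
- exact: nrm_le_H1norm.
- exact: nrm_le_H1norm.
- exact: le_trans (nrm1_le_gnrm (conj u1 u2)) (gnrm_le_H1norm Hu).
- exact: le_trans (nrm1_le_gnrm (conj v1 v2)) (gnrm_le_H1norm Hv).
- exact: le_trans (nrm2_le_gnrm (conj u1 u2)) (gnrm_le_H1norm Hu).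
- exact: le_trans (nrm2_le_gnrm (conj v1 v2)) (gnrm_le_H1norm Hv).
Qed.

End sobolev.

(** * Test functions in H1, and integration by parts against H10 *)

Section sobolev_test.
Variable R : realType.
Local Notation mu := (mu2 R).
Variable D : set (plane R).
Hypothesis oD : open D.
Implicit Types (u v psi : plane R -> R).

Let mD : measurable (D : set (mplane R)). Proof. exact: open_mplane. Qed.

Lemma bounded_support_sqint (f : plane R -> R) (M N : R) :
  measurable_fun setT (f : mplane R -> R) ->
  (forall x, `|f x| <= M) -> (forall x, f x != 0 -> `|x| < N) -> sqint mu D f.
Proof.
move=> mf fM fN; apply: (sqintS measurableT) => //; apply: sqintP => //.
apply: (bounded_support_integrable (M := M ^+ 2) (N := N)).
- exact: measurable_funX.
- by move=> x; rewrite normrX lerXn2r// ?nnegrE// (le_trans _ (fM x)).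
- by move=> x; rewrite sqrf_eq0; exact: fN.
Qed.

Lemma test_sqint E psi : test_function E psi -> sqint mu D psi.
Proof.
move=> tp; have [M [N [_ _ HM HN]]] := test_bounded tp.
by apply: bounded_support_sqint HM HN; exact: test_measurable tp.
Qed.

Lemma test_weak_grad E psi : test_function E psi -> is_weak_grad D psi (grad psi).
Proof.
move=> tp; have [L L0 HL] := test_lipschitz tp.
have t1 := test_derive (1, 0) tp; have t2 := test_derive (0, 1) tp.
have [M1 [_ [M10 _ H1 _]]] := test_bounded t1.
have [M2 [_ [M20 _ H2 _]]] := test_bounded t2.
apply: (@lipschitz_weak_grad _ _ _ _ L (M1 + M2)) => //.
- exact: test_measurable t1.
- exact: test_measurable t2.
- by move=> x; rewrite (le_trans (H1 x))// lerDl ltW.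
- by move=> x; rewrite (le_trans (H2 x))// lerDr ltW.
move=> e; apply: ae_all => x; rewrite -derive_grad; last exact: tp.1.
exact/dq_cvg/smooth_derivable/tp.1.
Qed.

Lemma test_H1 E psi : test_function E psi ->
  H1 D psi /\ {ae mu, forall x, D x -> wgrad D psi x = grad psi x}.
Proof.
move=> tp; apply: (H1_intro oD (test_sqint tp) (test_weak_grad tp)).
by split; [exact: test_sqint (test_derive (1, 0) tp)|exact: test_sqint (test_derive (0, 1) tp)].
Qed.

(** The gradient chosen for the zero function vanishes only almost everywhere, so uniqueness has to
    be invoked. *)
Lemma H1norm_ae0 u : H1 D u -> (forall x, u x = 0) -> H1norm D u = 0.
Proof.
move=> Hu u0; apply/eqP; rewrite eq_le H1norm_ge0 andbT.
apply: le_trans (H1norm_le_sum oD Hu) _.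
have [su wu [w1 w2]] := H1P oD Hu.
have s0 : sqint mu D (fun=> 0) by exact: sqint0.
have n0 : nrm mu D (fun=> 0) = 0.
  rewrite /nrm /nsq; under eq_Rintegral do rewrite expr0n/=.
  by rewrite /Rintegral integral0 sqrtr0.
have wg0 : is_weak_grad D u (fun=> 0).
  have l0 : locally_integrable2 D (fun=> 0 : R).
    by apply: continuous_li => // x; exact: cvg_cst.
  split => //; first exact: (sqint_li oD).
  move=> psi tp e; have -> : u = (fun=> 0) by apply/funext.
  rewrite /dot; under eq_Rintegral do rewrite mul0r.
  under [in RHS]eq_Rintegral do rewrite !mul0r addr0 mul0r.
  by rewrite /Rintegral integral0 oppr0.
have ae := weak_grad_unique oD wu wg0.
rewrite (ae_eq_nrm oD su s0); last by apply: ae_all => x _; exact: u0.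
rewrite (ae_eq_nrm oD w1 s0); last by apply: ae_imp ae => x h Dx; rewrite h.
rewrite (ae_eq_nrm oD w2 s0); last by apply: ae_imp ae => x h Dx; rewrite h.
by rewrite n0 !addr0.
Qed.

Lemma test_H10 psi : test_function D psi -> H10 D psi.
Proof.
move=> tp; have [Hp _] := test_H1 tp; split => // e e0; exists psi => //.
have [Hb _] := H1B oD Hp Hp; rewrite H1norm_ae0// => x; exact: subrr.
Qed.

Lemma test_lin (c : R) psi chi : test_function D psi -> test_function D chi ->
  test_function D (fun x => c * psi x + chi x).
Proof.
move=> [sp [K [cK KD K0]]] [sc [K' [cK' KD' K0']]]; split.
  by move=> k; apply: CkD => //; exact: CkZ.
exists (K `|` K'); split; first exact: compactU.
  by move=> x [/KD|/KD'].
by move=> x nK; rewrite K0 ?K0' ?mulr0 ?addr0// => h; apply: nK; [right|left].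
Qed.

Lemma testB psi chi : test_function D psi -> test_function D chi ->
  test_function D (fun x => psi x - chi x).
Proof.
move=> tp tc; have := test_lin (-1) tc tp.
by under eq_fun do rewrite mulN1r addrC.
Qed.

Lemma H10B u v : H10 D u -> H10 D v -> H10 D (fun x => u x - v x).
Proof.
(* [H1norm_triangle] multiplies both errors by 3, hence a seventh of e for each. *)
have L (a b e : R) : a < e / 7 -> b < e / 7 -> 0 < e -> 3 * a + 3 * b < e by lra.
move=> [Hu au] [Hv av]; have [Huv _] := H1B oD Hu Hv; split; [exact: Huv|move=> e e0].
have e6 : 0 < e / 7 by rewrite divr_gt0.
have [psi tp Hp] := au _ e6; have [chi tc Hc] := av _ e6.
exists (fun x => psi x - chi x); first exact: testB.
have [H1p _] := test_H1 tp; have [H1c _] := test_H1 tc.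
have [Hup _] := H1B oD Hu H1p; have [Hvc _] := H1B oD Hv H1c.
have -> : (fun x => u x - v x - (psi x - chi x)) = (fun x => (u x - psi x) - (v x - chi x)).
  by apply/funext => x; ring.
apply: le_lt_trans (H1norm_triangle oD Hup Hvc) _.
by apply: L Hp Hc e0.
Qed.

(** For a test function v this is the definition of the weak gradient; both sides are continuous in
    v for the H1 norm by Cauchy-Schwarz, and test functions are dense in H10. The pair [p], [e]
    stands for a coordinate and its unit vector. *)
Lemma ibp1 (p : plane R -> R) (e : plane R) u v :
  (forall w, dot w e = p w) ->
  (forall F, sqint2 D F -> sqint mu D (p \o F)) ->
  (forall F, sqint2 D F -> nrm mu D (p \o F) <= gnrm D F) ->
  H1 D u -> H10 D v ->
  \int[mu]_(x in D) (u x * p (wgrad D v x)) = - \int[mu]_(x in D) (p (wgrad D u x) * v x).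
Proof.
move=> pe ps pn Hu [Hv av]; apply/eqP; rewrite -addr_eq0; apply/eqP.
have [su wu sgu] := H1P oD Hu; have [sv wv sgv] := H1P oD Hv.
apply/eqP; rewrite -normr_le0; apply/ler_addgt0Pr => eps eps0; rewrite add0r.
pose K := nrm mu D u + gnrm D (wgrad D u) + 1.
have K0 : 0 < K by rewrite ltr_pwDr// addr_ge0// nrm_ge0.
have [psi tp Hp] := av _ (divr_gt0 eps0 K0).
have [H1p aep] := test_H1 tp; have [sp wp sgp] := H1P oD H1p.
have [Hd aed] := H1B oD Hv H1p; have [sd wd sgd] := H1P oD Hd.
have I1 := sqint_mul mD su (ps _ sgv); have I2 := sqint_mul mD (ps _ sgu) sv.
have J1 := sqint_mul mD su (ps _ sgd); have J2 := sqint_mul mD (ps _ sgu) sd.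
have P1 := sqint_mul mD su (ps _ sgp); have P2 := sqint_mul mD (ps _ sgu) sp.
have e0 : \int[mu]_(x in D) (u x * p (wgrad D psi x)) + \int[mu]_(x in D) (p (wgrad D u x) * psi x) = 0.
  case: wu => _ _ _ /(_ psi tp e) h.
  have -> : \int[mu]_(x in D) (p (wgrad D u x) * psi x) = \int[mu]_(x in D) (dot (wgrad D u x) e * psi x).
    by apply: eq_Rintegral => x _; rewrite pe.
  have -> : \int[mu]_(x in D) (u x * p (wgrad D psi x)) =
      \int[mu]_(x in D) (u x * 'D_e (psi : _ -> R^o) x).
    congr fine; apply: ae_eq_integral => //.
    - by apply/measurable_EFinP; apply: measurable_funM; [exact: su.1|exact: (ps _ sgp).1].
    - apply/measurable_EFinP; apply: measurable_funM; first exact: su.1.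
      exact: test_measurable (test_derive e tp).
    - apply: ae_imp aep => x h' Dx; rewrite /= (h' Dx) (derive_grad _ _ tp.1).
      by rewrite pe.
  by rewrite h addNr.
have -> : \int[mu]_(x in D) (u x * p (wgrad D v x)) + \int[mu]_(x in D) (p (wgrad D u x) * v x) =
  \int[mu]_(x in D) (u x * p (wgrad D (fun x => v x - psi x) x)) +
  \int[mu]_(x in D) (p (wgrad D u x) * (v x - psi x)).
  rewrite -[LHS]subr0 -[X in _ - X]e0 opprD addrACA; congr (_ + _).
    rewrite -RintegralB//; congr fine; apply: ae_eq_integral => //.
    - apply/measurable_EFinP; apply: measurable_funB; apply: measurable_funM.
        exact: su.1. exact: (ps _ sgv).1. exact: su.1. exact: (ps _ sgp).1.
    - by apply/measurable_EFinP; apply: measurable_funM; [exact: su.1|exact: (ps _ sgd).1].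
    - apply: ae_imp aed => x h' Dx; rewrite /= (h' Dx) -!pe /dot /=; congr EFin; ring.
  rewrite -RintegralB//; apply: eq_Rintegral => x _; ring.
apply: le_trans (ler_normD _ _) _.
have c1 := cauchy_schwarz mD su (ps _ sgd).
have c2 := cauchy_schwarz mD (ps _ sgu) sd.
apply: le_trans (lerD c1 c2) _.
set H := H1norm D (fun x => v x - psi x) in Hp.
have H0 : 0 <= H by exact: H1norm_ge0.
have n1 : nrm mu D (p \o wgrad D (fun x => v x - psi x)) <= H.
  by apply: le_trans (pn _ sgd) _; exact: gnrm_le_H1norm.
have n2 : nrm mu D (fun x => v x - psi x) <= H by exact: nrm_le_H1norm.
have n3 := pn _ sgu.
apply: (@le_trans _ _ (nrm mu D u * H + gnrm D (wgrad D u) * H)).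
  by apply: lerD; apply: ler_pM => //; exact: nrm_ge0.
rewrite -mulrDl; apply: (@le_trans _ _ (K * H)).
  by rewrite ler_wpM2r// lerDl.
by rewrite mulrC -ler_pdivlMr// ltW.
Qed.

Lemma H1_ibp u v : H1 D u -> H10 D v ->
  (\int[mu]_(x in D) (u x * (wgrad D v x).1) = - \int[mu]_(x in D) ((wgrad D u x).1 * v x)) /\
  (\int[mu]_(x in D) (u x * (wgrad D v x).2) = - \int[mu]_(x in D) ((wgrad D u x).2 * v x)).
Proof.
move=> Hu Hv; split.
- apply: (@ibp1 (fun w => w.1) (1, 0)) => //.
  + by move=> w; rewrite /dot /= mulr1 mulr0 addr0.
  + by move=> F [].
  + by move=> F /(nrm1_le_gnrm oD).
- apply: (@ibp1 (fun w => w.2) (0, 1)) => //.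
  + by move=> w; rewrite /dot /= mulr1 mulr0 add0r.
  + by move=> F [].
  + by move=> F /(nrm2_le_gnrm oD).
Qed.

End sobolev_test.

(** * Lipschitz functions vanishing off D are in H10 *)

Section mollification.
Variable R : realType.
Local Notation mu := (mu2 R).
Implicit Types (u v w psi rho : plane R -> R).

Record mollifier (rho : plane R -> R) (eps : R) : Prop := Mollifier {
  mollifier_test : test_function setT rho;
  mollifier_ge0 : forall x, 0 <= rho x;
  mollifier_int : \int[mu]_x rho x = 1;
  mollifier_supp : forall x, rho x != 0 -> `|x| < eps }.

Lemma mollifier_exists (eps : R) : 0 < eps -> exists rho, mollifier rho eps.
Proof.
move=> e0; pose a : plane R := (- eps, - eps); pose b : plane R := (eps, eps).
have tb : test_function setT (box_bump a b 0) by exact: box_bump_test.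
have ib := test_integrable tb.
have I0 : 0 <= \int[mu]_x box_bump a b 0 x by apply: Rintegral_ge0 => x _; exact: box_bump_ge0.
(* A vanishing integral would make the bump zero almost everywhere, although it is positive on a box
   of positive measure. *)
have Ip : 0 < \int[mu]_x box_bump a b 0 x.
  rewrite lt0r I0 andbT; apply/negP => /eqP z.
  have : ae_eq mu setT (EFin \o box_bump a b 0) (cst 0%E).
    apply/ae_eq_integral_abs => //; first by apply/measurable_EFinP; exact: test_measurable tb.
    transitivity (\int[mu]_x (box_bump a b 0 x)%:E)%E.
      by apply: eq_integral => x _; rewrite /= ger0_norm// box_bump_ge0.
    rewrite -[LHS]fineK; last exact: integrable_fin_num ib.
    by congr EFin; exact: z.
  move=> [A [mA A0 hA]].
  have : (mu (box a b) <= mu A)%E.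
    apply: le_measure; rewrite ?inE//; first exact: box_measurable.
    move=> x xB; apply: hA => /= /(_ I) [] z'.
    by have := box_bump_gt0 0 xB; rewrite z' ltxx.
  rewrite A0 mu2_box/=; [|lra|lra].
  by rewrite lee_fin leNgt mulr_gt0//; lra.
exists (fun x => (\int[mu]_x box_bump a b 0 x)^-1 * box_bump a b 0 x); split.
- split; first by move=> k; apply: CkZ; exact: tb.1.
  have [_ [K [cK _ K0]]] := tb; exists K; split => // x nK.
  by rewrite K0 ?mulr0.
- by move=> x; rewrite mulr_ge0// ?invr_ge0// box_bump_ge0.
- by rewrite RintegralZl// mulVf// gt_eqF.
- move=> x; rewrite mulf_eq0 negb_or => /andP[_ bx].
  have [xB|xB] := pselect (box a b x); last by rewrite (box_bump_eq0 _ xB) eqxx in bx.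
  by move: xB => [] /=; rewrite !in_itv/= -!ltr_norml prod_normE gt_max => -> ->.
Qed.

(** The kernel is reflected with respect to the usual convolution; derivatives in x fall on rho, in
    the direction - e. *)
Definition moll rho w (x : plane R) : R := \int[mu]_y (rho (y - x) * w y).

Lemma test_translate rho (x : plane R) : test_function setT rho ->
  test_function setT (fun y => rho (y - x)).
Proof.
move=> [sp [K [cK KD K0]]]; split.
  move=> k; apply: (@Ck_affine R (plane R) (plane R) k (fun y => y - x) id).
  - by move=> y; apply: cvgB; [exact: cvg_id|exact: cvg_cst].
  - by move=> y v h; rewrite addrA.
  - exact: sp.
exists ((fun y => y + x) @` K); split => //.
  apply: continuous_compact => //; apply: continuous_subspaceT => y.
  by apply: cvgD; [exact: cvg_id|exact: cvg_cst].
by move=> y nK; apply: K0 => Ky; apply: nK; exists (y - x) => //; rewrite subrK.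
Qed.

Lemma derive_translate rho (x e y : plane R) :
  'D_e ((fun y => rho (y - x)) : _ -> R^o) y = 'D_e (rho : _ -> R^o) (y - x).
Proof.
rewrite /derive.
suff -> : (fun h : R => h^-1 *: ((((fun y => rho (y - x)) : _ -> R^o) \o shift y) (h *: e) - rho (y - x))) =
    (fun h : R => h^-1 *: (((rho : _ -> R^o) \o shift (y - x)) (h *: e) - rho (y - x))) by [].
by apply/funext => h /=; rewrite addrA.
Qed.

Lemma mul_test_integrable w rho : continuous (w : _ -> R^o) -> test_function setT rho ->
  mu.-integrable setT (EFin \o (fun y => w y * rho y)).
Proof.
move=> cw tr; apply: li_test_integrable => //; first exact: openT.
by apply: continuous_li => //; exact: openT.
Qed.

Lemma moll_translateE rho w x : continuous (w : _ -> R^o) -> test_function setT rho ->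
  moll rho w x = \int[mu]_y (w (y + x) * rho y).
Proof.
move=> cw tr; pose f y := w y * rho (y - x).
have If : mu.-integrable setT (EFin \o f).
  by apply: mul_test_integrable => //; exact: test_translate.
have -> : moll rho w x = \int[mu]_y f y by apply: eq_Rintegral => y _; rewrite /f mulrC.
rewrite -(Rintegral_translate x); last by have /integrableP[/measurable_EFinP] := If.
by apply: eq_Rintegral => y _; rewrite /f addrK.
Qed.

Lemma moll_derive rho w (x e : plane R) : continuous (w : _ -> R^o) -> test_function setT rho ->
  derivable (moll rho w : _ -> R^o) x e /\
  'D_e (moll rho w : _ -> R^o) x = moll (fun y => 'D_(- e) (rho : _ -> R^o) y) w x.
Proof.
move=> cw tr; have tx := test_translate x tr.
have C : h^-1 *: (((moll rho w : _ -> R^o) \o shift x) (h *: e) - moll rho w x) @[h --> (0 : R)^'] -->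
    moll (fun y => 'D_(- e) (rho : _ -> R^o) y) w x.
  apply/cvgr_dnbhsP => u [u0 cu].
  have H := dq_dominated (e := - e) cw tx u0 cu.
  have -> : moll (fun y => 'D_(- e) (rho : _ -> R^o) y) w x =
      \int[mu]_y (w y * 'D_(- e) ((fun y => rho (y - x)) : _ -> R^o) y).
    by apply: eq_Rintegral => y _; rewrite derive_translate mulrC.
  have -> : (fun n => (u n)^-1 *: (((moll rho w : _ -> R^o) \o shift x) (u n *: e) - moll rho w x)) =
     (fun n => \int[mu]_y (w y * ((u n)^-1 * (rho (y + u n *: (- e) - x) - rho (y - x))))).
    apply/funext => n; rewrite scale_reg /moll /=.
    have T1 := mul_test_integrable cw (test_translate (u n *: e + x) tr).
    have T2 := mul_test_integrable cw tx.
    transitivity ((u n)^-1 * (\int[mu]_y (w y * rho (y - (u n *: e + x))) - \int[mu]_y (w y * rho (y - x)))).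
      by congr (_ * (_ - _)); apply: eq_Rintegral => y _; rewrite mulrC.
    rewrite -RintegralB// -RintegralZl//; last exact: (integrableB measurableT T1 T2).
    apply: eq_Rintegral => y _; rewrite opprD addrA scalerN; ring.
  exact: H.
split; first exact: cvgP C.
by apply/cvg_lim => //; exact: norm_hausdorff.
Qed.

(** Stated for every test function rho because [moll_smooth] applies it to the successive
    derivatives of the kernel, which change sign; hence the integral of |rho| in the constant. *)
Lemma moll_lipschitz rho w L : lipschitz_plane L w -> test_function setT rho ->
  lipschitz_plane (L * \int[mu]_y `|rho y|) (moll rho w).
Proof.
move=> Lw tr x x'; have cw := lipschitz_plane_continuous Lw.
rewrite !moll_translateE//.
have T1 := mul_test_integrable (continuous_translate (w := x) cw) tr.
have T2 := mul_test_integrable (continuous_translate (w := x') cw) tr.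
rewrite -RintegralB//; apply: le_trans (le_normr_Rintegral _ _) _ => //.
  exact: (integrableB measurableT T1 T2).
rewrite mulrAC -RintegralZl//; last exact: (integrable_abse (test_integrable tr)).
apply: le_Rintegral => //.
- exact: (integrable_abse (integrableB measurableT T1 T2)).
- by apply: integrableRZ => //; exact: (integrable_abse (test_integrable tr)).
move=> y _; rewrite -mulrBl normrM ler_wpM2r//; apply: le_trans (Lw _ _) _.
by rewrite [y + x]addrC addrKA.
Qed.

Lemma moll_smooth rho w L : lipschitz_plane L w -> test_function setT rho ->
  smooth (moll rho w : _ -> R^o).
Proof.
move=> Lw tr k; have cw := lipschitz_plane_continuous Lw.
elim: k rho tr => [|k IH] rho tr.
  by split => //; exact: lipschitz_plane_continuous (moll_lipschitz Lw tr).
split; first exact: lipschitz_plane_continuous (moll_lipschitz Lw tr).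
move=> v; split; first by move=> x; exact: (moll_derive x v cw tr).1.
have -> : (fun x => 'D_v (moll rho w : _ -> R^o) x) = moll (fun y => 'D_(- v) (rho : _ -> R^o) y) w.
  by apply/funext => x; exact: (moll_derive x v cw tr).2.
by apply: IH; exact: test_derive.
Qed.

(** A weighted mean of values within a of k stays within a of k. Closeness of the mollification to
    w, bounds on its differences and its vanishing are all instances. *)
Lemma average_bound rho eps (g : plane R -> R) (k a : R) : mollifier rho eps ->
  continuous (g : _ -> R^o) -> (forall y, `|y| < eps -> `|g y - k| <= a) ->
  `|\int[mu]_y (g y * rho y) - k| <= a.
Proof.
move=> mr cg ga; have tr := mollifier_test mr.
have Ig := mul_test_integrable cg tr.
have Ir := test_integrable tr.
have -> : \int[mu]_y (g y * rho y) - k = \int[mu]_y (g y * rho y - k * rho y).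
  by rewrite RintegralB//; [rewrite RintegralZl// (mollifier_int mr) mulr1|exact: integrableRZ].
have Id : mu.-integrable setT (EFin \o (fun y => g y * rho y - k * rho y)).
  exact: (integrableB measurableT Ig (integrableRZ k measurableT Ir)).
apply: le_trans (le_normr_Rintegral _ _) _ => //.
rewrite -[leRHS]mulr1 -(mollifier_int mr) -RintegralZl//.
apply: le_Rintegral => //; first exact: (integrable_abse Id).
  exact: integrableRZ.
move=> y _; rewrite -mulrBl normrM (ger0_norm (mollifier_ge0 mr y)).
have [->|ry] := eqVneq (rho y) 0; first by rewrite !mulr0.
by rewrite ler_wpM2r ?(mollifier_ge0 mr)//; apply: ga; exact: mollifier_supp mr _ ry.
Qed.

Lemma moll_near rho eps w L x : mollifier rho eps -> lipschitz_plane L w -> 0 <= L ->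
  `|moll rho w x - w x| <= L * eps.
Proof.
move=> mr Lw L0; have cw := lipschitz_plane_continuous Lw.
rewrite moll_translateE//; last exact: mollifier_test mr.
apply: (average_bound mr); first exact: (continuous_translate cw).
move=> y ye; apply: le_trans (Lw _ _) _; rewrite addrK.
by rewrite ler_wpM2l// ltW.
Qed.

Lemma moll_diff rho eps w L x x' (k a : R) : mollifier rho eps -> lipschitz_plane L w ->
  (forall y, `|y| < eps -> `|w (y + x) - w (y + x') - k| <= a) ->
  `|moll rho w x - moll rho w x' - k| <= a.
Proof.
move=> mr Lw h; have cw := lipschitz_plane_continuous Lw.
have tr := mollifier_test mr.
have c1 := continuous_translate (w := x) cw; have c2 := continuous_translate (w := x') cw.
rewrite !moll_translateE// -RintegralB//; [|exact: mul_test_integrable..].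
under eq_Rintegral do rewrite -mulrBl.
apply: (average_bound (g := fun y => w (y + x) - w (y + x')) mr) => //.
by move=> y; apply: cvgB; [exact: c1|exact: c2].
Qed.

Lemma moll_lip rho eps w L : mollifier rho eps -> lipschitz_plane L w ->
  lipschitz_plane L (moll rho w).
Proof.
move=> mr Lw x x'; rewrite -[X in `|X|]subr0; apply: (moll_diff mr Lw) => y _.
by rewrite subr0; apply: le_trans (Lw _ _) _; rewrite [y + x]addrC addrKA.
Qed.

Lemma lip_derive_bound psi L x (e : plane R) : lipschitz_plane L psi -> smooth (psi : _ -> R^o) ->
  `|'D_e (psi : _ -> R^o) x| <= L * `|e|.
Proof.
move=> Lp sp; have dp : derivable (psi : _ -> R^o) x e by exact: smooth_derivable.
have H : `|dq psi e x n| @[n --> \oo] --> `|'D_e (psi : _ -> R^o) x|.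
  exact: (cvg_norm (dq_cvg dp)).
rewrite -(cvg_lim (@Rhausdorff R) H); apply: limr_le; first exact: cvgP H.
apply: nearW => n; rewrite /dq normrM ger0_norm// -ler_pdivlMl//.
apply: le_trans (Lp _ _) _; rewrite [x + _]addrC addrK normrZ gtr0_norm ?hn_gt0//.
by rewrite mulrCA.
Qed.

Lemma derive_affine psi x (e c : plane R) d : 0 < d -> smooth (psi : _ -> R^o) ->
  (forall h : R, 0 < h -> h < d -> psi (x + h *: e) - psi x = h * dot c e) ->
  'D_e (psi : _ -> R^o) x = dot c e.
Proof.
move=> d0 sp h; have dp : derivable (psi : _ -> R^o) x e by exact: smooth_derivable.
apply: (cvg_unique (@Rhausdorff R) (dq_cvg dp)).
apply: cvg_near_cst; near=> n.
rewrite /dq h ?hn_gt0//; first by rewrite /hn mulrA divff ?mul1r.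
near: n; have /cvgrPdist_lt/(_ d d0) := @hn_cvg R.
by apply: filterS => n; rewrite sub0r normrN gtr0_norm// hn_gt0.
Unshelve. all: by end_near.
Qed.

(** At a small scale the average only sees the ball on which w is affine, so short difference
    quotients at x, and with them the derivative, are exactly those of w. *)
Lemma moll_affine rho eps w L x (c : plane R) d : mollifier rho eps -> lipschitz_plane L w ->
  0 < d -> eps <= d / 2 ->
  (forall z z', `|z - x| < d -> `|z' - x| < d -> w z - w z' = dot c (z - z')) ->
  forall e, 'D_e (moll rho w : _ -> R^o) x = dot c e.
Proof.
move=> mr Lw d0 ed wc e.
have e1 : 0 < `|e| + 1 by rewrite ltr_wpDl.
(* Half of d is left to the mollification radius and half to the step [h *: e]; the added 1 covers e
   = 0. *)
apply: (@derive_affine _ _ _ _ (d / 2 / (`|e| + 1))).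
- by rewrite !divr_gt0.
- exact: moll_smooth Lw (mollifier_test mr).
move=> h h0 hd; apply/eqP; rewrite -subr_eq0 -normr_le0.
apply: (moll_diff mr Lw) => y ye.
have he : h * `|e| < d / 2.
  apply: le_lt_trans (_ : h * (`|e| + 1) < _); first by rewrite ler_pM2l// lerDl.
  by rewrite -ltr_pdivlMr.
rewrite wc.
- rewrite [y + (x + _)]addrC addrKA [x + _]addrC addrK /dot /= /GRing.scale/= normr_le0; apply/eqP; ring.
- rewrite addrA addrAC addrK; apply: le_lt_trans (ler_normD _ _) _.
  by rewrite normrZ gtr0_norm//; lra.
- by rewrite addrK; lra.
Qed.

End mollification.

(** * Soft thresholding and approximation by test functions *)

Section lipschitz_H10.
Variable R : realType.
Local Notation mu := (mu2 R).
Implicit Types (u v w psi rho : plane R -> R).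

(** Soft thresholding, as the part above d plus the part below -d; unlike a hard cutoff it is
    1-Lipschitz and keeps slopes wherever it is nonzero. *)
Definition soft (d y : R) : R := Num.max (y - d) 0 + Num.min (y + d) 0.

Lemma soft_cases d y : 0 <= d -> [\/ d <= y /\ soft d y = y - d,
  (- d <= y /\ y <= d) /\ soft d y = 0 | y <= - d /\ soft d y = y + d].
Proof.
move=> d0; rewrite /soft; case: (leP (y - d) 0) => h1; case: (leP (y + d) 0) => h2.
- by apply: Or33; split; lra.
- by apply: Or32; split; [split|]; lra.
- by apply: Or31; split; lra.
- by apply: Or31; split; lra.
Qed.

Lemma soft_near d y : 0 <= d -> `|soft d y - y| <= d.
Proof.
move=> d0; rewrite ler_norml.
by case: (soft_cases y d0) => [[h ->]|[[h h'] ->]|[h ->]]; apply/andP; split; lra.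
Qed.

Lemma soft_lip d y z : 0 <= d -> `|soft d y - soft d z| <= `|y - z|.
Proof.
move=> d0; wlog yz : y z / z <= y.
  move=> H; have [|/ltW] := leP z y; first exact: H.
  by rewrite distrC (distrC y z); exact: H.
rewrite (ger0_norm (_ : 0 <= y - z)) ?subr_ge0// ler_norml.
by case: (soft_cases y d0) => [[h ->]|[[h h'] ->]|[h ->]];
   case: (soft_cases z d0) => [[k ->]|[[k k'] ->]|[k ->]]; apply/andP; split; lra.
Qed.

Lemma soft_eq0 d y : 0 <= d -> soft d y != 0 -> d <= `|y|.
Proof.
move=> d0; case: (soft_cases y d0) => [[h _] _|[_ ->]|[h _] _]; last 1 first.
- by rewrite ler_normr; apply/orP; right; lra.
- by rewrite (le_trans h)// ler_norm.
- by rewrite eqxx.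
Qed.

Lemma soft_same d a b (r : R) : 0 <= d -> d < r -> (r <= a /\ r <= b) \/ (a <= - r /\ b <= - r) ->
  soft d a - soft d b = a - b.
Proof.
move=> d0 dr; case: (soft_cases a d0) => [[h ->]|[[h h'] ->]|[h ->]];
  case: (soft_cases b d0) => [[k ->]|[[k k'] ->]|[k ->]]; move=> [[? ?]|[? ?]]; lra.
Qed.

Variable D : set (plane R).
Hypothesis oD : open D.
Hypothesis bD : bounded_set D.

Let mD : measurable (D : set (mplane R)). Proof. exact: open_mplane. Qed.

Lemma bounded_finite : (mu D < +oo)%E.
Proof.
have [N N0 HN] := bounded_set_norm bD.
apply: (@le_lt_trans _ _ (mu (box (- N, - N) (N, N)))).
  apply: le_measure; rewrite ?inE//; first exact: box_measurable.
  move=> x /HN; rewrite prod_normE gt_max => /andP[].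
  by rewrite /box /= !ltr_norml !in_itv /= => /andP[-> ->] /andP[-> ->].
by rewrite mu2_box ?ltry//=; lra.
Qed.

Lemma closed_bounded_compact (K E : set (plane R)) : closed K -> K `<=` E -> bounded_set E ->
  compact K.
Proof.
move=> cK KE /bounded_set_norm[N N0 HN].
apply: (@subclosed_compact _ K (cbox (- N, - N) (N, N))) => //; first exact: cbox_compact.
move=> x /KE/HN; rewrite prod_normE gt_max => /andP[].
by rewrite /cbox /= !ltr_norml !in_itv /= => /andP[/ltW-> /ltW->] /andP[/ltW-> /ltW->].
Qed.

Lemma hn_small (c : R) : 0 < c -> \forall n \near \oo, hn n < c.
Proof.
move=> c0; have /cvgrPdist_lt/(_ _ c0) := @hn_cvg R.
by apply: filterS => n; rewrite sub0r normrN gtr0_norm// hn_gt0.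
Qed.

(** Slopes survive thresholding and mollification: near a point with [v x != 0] the threshold
    eventually only subtracts a constant, and where [G x = 0] everything is locally constant. The
    final alternative of the hypothesis thus excludes the points where v vanishes with a nonzero
    slope, which thresholding flattens at every level. *)
Lemma H10_of_lipschitz (v : plane R -> R) (G : plane R -> plane R) (L M : R) :
  0 < L -> lipschitz_plane L v -> (forall x, ~ D x -> v x = 0) ->
  measurable_fun setT ((fun x => (G x).1) : mplane R -> R) ->
  measurable_fun setT ((fun x => (G x).2) : mplane R -> R) ->
  (forall x, `|(G x).1| <= M) -> (forall x, `|(G x).2| <= M) ->
  {ae mu, forall x, exists2 d : R, 0 < d &
     (forall z z', `|z - x| < d -> `|z' - x| < d -> v z - v z' = dot (G x) (z - z')) /\
     (v x != 0 \/ G x = 0)} ->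
  H10 D v /\ {ae mu, forall x, D x -> wgrad D v x = G x}.
Proof.
have Hp (a b : R) : - (a / 2) < b - a -> a / 2 <= b by lra.
have Hn (a b : R) : b - a < (- a) / 2 -> b <= - ((- a) / 2) by lra.
have SL (e a b c : R) : a < e / 3 -> b < e / 3 -> c < e / 3 -> a + (b + c) < e by lra.
move=> L0 Lv v0 mG1 mG2 bG1 bG2 aff.
have cv := lipschitz_plane_continuous Lv.
have [N N0 HN] := bounded_set_norm bD.
have mv : measurable_fun setT (v : mplane R -> R) by exact: continuous_mplane.
have M0 : 0 <= M by exact: le_trans (bG1 0).
have fD := bounded_finite.
have bv x : D x -> `|v x| <= `|v 0| + L * N.
  move=> /HN xN; rewrite -[v x](subrK (v 0)) addrC.
  apply: le_trans (ler_normD _ _) _; rewrite lerD2l.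
  by apply: le_trans (Lv _ _) _; rewrite subr0 ler_pM2l// ltW.
have sv : sqint mu D v.
  by apply: (sqint_bounded mD fD _ bv); apply: measurable_funS mv.
have wG : is_weak_grad D v G.
  apply: (@lipschitz_weak_grad _ _ _ _ L M) => // e.
  apply: ae_imp aff => x [d d0 [ax _]].
  have e1 : 0 < `|e| + 1 by rewrite ltr_wpDl.
  apply: cvg_near_cst; near=> n.
  rewrite /dq ax ?subrr ?normr0//.
    by rewrite [x + _]addrC addrK /dot /= /GRing.scale/= /hn; field.
  rewrite [x + _]addrC addrK normrZ gtr0_norm ?hn_gt0//.
  apply: (@le_lt_trans _ _ (hn n * (`|e| + 1))); first by rewrite ler_pM2l ?hn_gt0// lerDl.
  by rewrite -ltr_pdivlMr//; near: n; apply: hn_small; exact: divr_gt0.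
have sG : sqint2 D G.
  split.
    by apply: (sqint_bounded mD fD _ (fun x _ => bG1 x)); exact: measurable_funS mG1.
  by apply: (sqint_bounded mD fD _ (fun x _ => bG2 x)); exact: measurable_funS mG2.
have [H1v aev] := H1_intro oD sv wG sG.
split => //; split => // e e0.
(* psi n is a mollification, at scale hn n / (2 L), of v soft-thresholded at hn n *)
have eps0 n : 0 < hn n / (2 * L) :> R by rewrite divr_gt0 ?hn_gt0// mulr_gt0.
have /choice[rho Hrho] := fun n => mollifier_exists (eps0 n).
pose w n x := soft (hn n) (v x).
have Lw n : lipschitz_plane L (w n).
  by move=> x y; apply: le_trans (Lv x y); apply: soft_lip; exact/ltW/hn_gt0.
pose psi n := moll (rho n) (w n).
have Lp n : lipschitz_plane L (psi n) by exact: moll_lip (Hrho n) (Lw n).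
have sp n : smooth (psi n : _ -> R^o) by exact: moll_smooth (Lw n) (mollifier_test (Hrho n)).
have dpsi n x : `|psi n x - v x| <= 2 * hn n.
  have h1 := moll_near x (Hrho n) (Lw n) (ltW L0).
  have h2 := soft_near (v x) (ltW (hn_gt0 R n)).
  have h3 : L * (hn n / (2 * L)) = hn n / 2 by field; rewrite gt_eqF.
  rewrite h3 in h1.
  rewrite -[psi n x](subrK (w n x)) -addrA; apply: le_trans (ler_normD _ _) _.
  have := hn_gt0 R n; rewrite /psi; rewrite -/(w n x) in h2; lra.
(* Where |v x| < [hn n / 2], |v| stays below [hn n] within the mollification radius, so the
   thresholded function is 0 there and so is its average. The complementary set is closed, and it
   lies in D because v vanishes off D. *)
have tp n : test_function D (psi n).
  split => //; exists [set x | hn n / 2 <= `|v x|].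
  have KD : [set x | hn n / 2 <= `|v x|] `<=` D.
    move=> x /= hx; apply: contrapT => nD; move: hx; rewrite v0// normr0 leNgt.
    by rewrite divr_gt0 ?hn_gt0.
  split => //.
    apply: (closed_bounded_compact _ KD bD).
    have -> : [set x | hn n / 2 <= `|v x|] = (fun x => `|v x|) @^-1` [set y | hn n / 2 <= y] by [].
    apply: closed_comp; last exact: closed_ge.
    by move=> x _; apply: (cvg_comp _ _ (cv x)); exact: norm_continuous.
  move=> x /= /negP; rewrite -ltNge => xK.
  have := average_bound (k := 0) (a := 0) (g := fun y => w n (y + x)) (Hrho n).
  rewrite subr0 normr_le0 => H; apply/eqP.
  rewrite /psi moll_translateE; [apply: H|exact: lipschitz_plane_continuous (Lw n)|
    exact: mollifier_test (Hrho n)].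
    exact: continuous_translate (lipschitz_plane_continuous (Lw n)).
  move=> y ye; rewrite subr0 normr_le0; apply/negPn/negP => /(soft_eq0 (ltW (hn_gt0 R n))) hy.
  have : `|v (y + x)| <= `|v x| + L * `|y|.
    rewrite -[v (y + x)](subrK (v x)) addrC.
    apply: le_trans (ler_normD _ _) _; rewrite lerD2l.
    by apply: le_trans (Lv _ _) _; rewrite addrK.
  have h3 : L * (hn n / (2 * L)) = hn n / 2 by field; rewrite gt_eqF.
  have : L * `|y| < L * (hn n / (2 * L)) by rewrite ltr_pM2l.
  rewrite h3; lra.
(* At almost every point the gradients of the approximations equal [G x] from some n on; being
   bounded by the Lipschitz constant, they then converge in L2. *)
have gr : {ae mu, forall x, \forall n \near \oo, forall e, 'D_e (psi n : _ -> R^o) x = dot (G x) e}.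
  apply: ae_imp aff => x [d d0 [ax [vx|Gx]]]; last first.
    near=> n => f; apply: (moll_affine (Hrho n) (Lw n) d0).
      rewrite ler_pdivrMr ?mulr_gt0// mulrCA; apply: ltW.
      rewrite (_ : _ * _ = d * L); last by field.
      by near: n; apply: hn_small; exact: mulr_gt0.
    move=> z z' hz hz'; have := ax z z' hz hz'; rewrite Gx /dot /= !mul0r addr0.
    by move=> /eqP; rewrite subr_eq0 /w => /eqP ->; rewrite subrr.
  (* Within [d'] of x the function keeps its sign and has modulus at least r, so a threshold below r
     acts as a constant shift. *)
  pose r := `|v x| / 2; have r0 : 0 < r by rewrite divr_gt0// normr_gt0.
  pose d' := Num.min d (r / L); have d'0 : 0 < d' by rewrite lt_min d0 divr_gt0.
  have vz z : `|z - x| < d' -> `|v z - v x| < r.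
    rewrite lt_min => /andP[_ zx]; apply: le_lt_trans (Lv _ _) _.
    by rewrite mulrC -ltr_pdivlMr.
  near=> n => f; apply: (moll_affine (Hrho n) (Lw n) d'0).
    rewrite ler_pdivrMr ?mulr_gt0//; apply: ltW.
    rewrite mulrA divfK ?pnatr_eq0//.
    by near: n; apply: hn_small; exact: mulr_gt0.
  have hr : hn n < r by near: n; exact: hn_small.
  move=> z z' hz hz'.
  have [zd z'd] : `|z - x| < d /\ `|z' - x| < d.
    by move: hz hz'; rewrite !lt_min => /andP[? _] /andP[? _].
  rewrite -(ax _ _ zd z'd); apply: (soft_same (ltW (hn_gt0 R n)) hr).
  move: (vz _ hz) (vz _ hz'); rewrite /r; have [vp|vn] := leP 0 (v x).
    by rewrite (ger0_norm vp) !ltr_norml => /andP[/Hp ? _] /andP[/Hp ? _]; left.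
  by rewrite (ltr0_norm vn) !ltr_norml => /andP[_ /Hn ?] /andP[_ /Hn ?]; right.
have bp n x (a : plane R) : `|'D_a (psi n : _ -> R^o) x| <= L * `|a|.
  exact: lip_derive_bound (Lp n) (sp n).
have cvg0 (p : plane R -> R) (a : plane R) : (forall y, dot y a = p y) ->
    sqint mu D (p \o G) -> (forall x, `|p (G x)| <= M) ->
    nrm mu D (fun x => p (G x) - 'D_a (psi n : _ -> R^o) x) @[n --> \oo] --> (0 : R).
  move=> pa spG bpG.
  have md n : measurable_fun D (fun x => p (G x) - 'D_a (psi n : _ -> R^o) x).
    by apply: measurable_funB; [exact: spG.1|exact: test_measurable (test_derive a (tp n))].
  pose C := M + L * `|a|.
  have [|||||_ H] := @Rdominated_cvg _ (mplane R) R mu D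
      (fun n x => (p (G x) - 'D_a (psi n : _ -> R^o) x) ^+ 2) (fun=> 0) (fun=> C ^+ 2) mD.
  - by move=> n; apply: measurable_funX; exact: md.
  - exact: measurable_cst.
  - apply: ae_imp gr => x gx Dx; apply: cvg_near_cst; apply: filterS gx => n gn.
    by rewrite gn pa subrr expr0n.
  - apply/integrableP; split; first by apply/measurable_EFinP; exact: measurable_cst.
    by rewrite /= integral_cst//; apply: lte_mul_pinfty.
  - have C0 : 0 <= C by rewrite addr_ge0// mulr_ge0// ltW.
    move=> n x Dx; rewrite normrX; apply: lerXn2r; rewrite ?nnegrE//.
    by apply: le_trans (ler_normB _ _) _; apply: lerD.
  rewrite Rintegral_cst// mul0r in H.
  have := cvg_comp _ _ H (@sqrt_continuous R 0).
  by rewrite sqrtr0.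
have c1 := cvg0 (fun y => y.1) (1, 0) _ sG.1 bG1.
have {}c1 : nrm mu D (fun x => (G x).1 - 'D_(1, 0) (psi n : _ -> R^o) x) @[n --> \oo] --> (0 : R).
  by apply: c1 => y; rewrite /dot /= mulr1 mulr0 addr0.
have c2 := cvg0 (fun y => y.2) (0, 1) _ sG.2 bG2.
have {}c2 : nrm mu D (fun x => (G x).2 - 'D_(0, 1) (psi n : _ -> R^o) x) @[n --> \oo] --> (0 : R).
  by apply: c2 => y; rewrite /dot /= mulr1 mulr0 add0r.
have e3 : 0 < e / 3 by rewrite divr_gt0.
pose K := nrm mu D (fun=> 1) + 1; have K0 : 0 < K by rewrite ltr_wpDl// nrm_ge0.
have s1 : sqint mu D (fun=> 1).
  by apply: (@sqint_bounded _ _ _ mu D _ 1 mD fD) => // x _; rewrite normr1.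
have near0 (a_ : nat -> R) : (forall n, 0 <= a_ n) -> a_ n @[n --> \oo] --> (0 : R) ->
    \forall n \near \oo, a_ n < e / 3.
  move=> a0 /cvgrPdist_lt/(_ _ e3); apply: filterS => n.
  by rewrite sub0r normrN ger0_norm.
have N0' := hn_small (divr_gt0 (divr_gt0 e3 K0) (ltr0n R 2)).
have N1' := near0 _ (fun n => nrm_ge0 _ _ _) c1.
have N2' := near0 _ (fun n => nrm_ge0 _ _ _) c2.
have [n [Hn0 Hn1 Hn2]] : exists n, [/\ hn n < e / 3 / K / 2,
    nrm mu D (fun x => (G x).1 - 'D_(1, 0) (psi n : _ -> R^o) x) < e / 3 &
    nrm mu D (fun x => (G x).2 - 'D_(0, 1) (psi n : _ -> R^o) x) < e / 3].
  by apply: (@filter_ex _ \oo); apply: filterS3 N0' N1' N2' => n; split.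
exists (psi n) => //.
have [H1p aep] := test_H1 oD (tp n).
have [H1d aed] := H1B oD H1v H1p.
have [sd _ [sd1 sd2]] := H1P oD H1d.
apply: le_lt_trans (H1norm_le_sum oD H1d) _.
have e0' : nrm mu D (fun x => v x - psi n x) < e / 3.
  apply: (@le_lt_trans _ _ (nrm mu D (fun=> 2 * hn n * 1))).
    apply: nrm_le => //; first exact: sd.1.
      exact: sqintZ.
    move=> x _; rewrite mulr1 distrC; apply: le_trans (dpsi n x) _.
    by rewrite ler_norm.
  rewrite nrmZ// ger0_norm; last by rewrite mulr_ge0// ltW// hn_gt0.
  apply: (@le_lt_trans _ _ (2 * hn n * K)).
    by rewrite ler_wpM2l ?mulr_ge0 ?(ltW (hn_gt0 R n))// lerDl.
  by rewrite -ltr_pdivlMr// mulrC -ltr_pdivlMr.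
have aeG : {ae mu, forall x, D x -> wgrad D (fun x => v x - psi n x) x = G x - grad (psi n) x}.
  have := ae_and aev (ae_and aep aed).
  by apply: ae_imp => x [h1 [h2 h3]] Dx; rewrite h3// h1// h2.
have e1' : nrm mu D (fun x => (wgrad D (fun x => v x - psi n x) x).1) < e / 3.
  have -> : nrm mu D (fun x => (wgrad D (fun x => v x - psi n x) x).1) =
     nrm mu D (fun x => (G x).1 - 'D_(1, 0) (psi n : _ -> R^o) x).
    apply: (ae_eq_nrm oD sd1).
      by apply: sqintB => //; [exact: sG.1|exact: test_sqint (test_derive (1, 0) (tp n))].
    by apply: ae_imp aeG => x h Dx; rewrite h.
  exact: Hn1.
have e2' : nrm mu D (fun x => (wgrad D (fun x => v x - psi n x) x).2) < e / 3.
  have -> : nrm mu D (fun x => (wgrad D (fun x => v x - psi n x) x).2) =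
     nrm mu D (fun x => (G x).2 - 'D_(0, 1) (psi n : _ -> R^o) x).
    apply: (ae_eq_nrm oD sd2).
      by apply: sqintB => //; [exact: sG.2|exact: test_sqint (test_derive (0, 1) (tp n))].
    by apply: ae_imp aeG => x h Dx; rewrite h.
  exact: Hn2.
exact: SL.
Unshelve. all: by end_near.
Qed.

End lipschitz_H10.

(** * Poincare inequality on squares *)

Section poincare.
Variable R : realType.
Local Notation mu := (mu2 R).
Local Notation leb := (@lebesgue_measure R).
Implicit Types (psi : plane R -> R).

Lemma continuous_pairl (x2 : R) : continuous (fun r : R => (r, x2) : plane R).
Proof.
move=> r; apply/cvgrPdist_lt => e e0; near=> s.
rewrite prod_normE /= subrr normr0 gt_max e0 andbT.
by near: s; apply: (cvgrPdist_lt _ _).1 => //; exact: cvg_id.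
Unshelve. all: by end_near.
Qed.

Lemma continuous_pairr (x1 : R) : continuous (fun r : R => (x1, r) : plane R).
Proof.
move=> r; apply/cvgrPdist_lt => e e0; near=> s.
rewrite prod_normE /= subrr normr0 gt_max e0 /=.
by near: s; apply: (cvgrPdist_lt _ _).1 => //; exact: cvg_id.
Unshelve. all: by end_near.
Qed.

Lemma integral_cst_itv (a l : R) (k : \bar R) : 0 < l ->
  (\int[leb]_(x in `]a, (a + l)%R[) cst k x = k * l%:E)%E.
Proof.
move=> l0; rewrite integral_cst; last exact: measurable_itv.
have H : leb `]a, (a + l)[ = l%:E.
  by rewrite lebesgue_measure_itv/= lte_fin ltrDl l0 -EFinB addrAC subrr add0r.
by congr (_ * _)%E; exact: H.
Qed.

(** The difference is the integral of dg between s and t; Cauchy-Schwarz against the constant 1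
    gives the factor t - s <= l, and the interval is then enlarged. *)
Lemma sqr_diff_le (g dg : R -> R) (a l s t : R) :
  continuous (dg : R -> R^o) ->
  (forall r : R, is_derive r (1 : R) (g : R -> R^o) (dg r)) ->
  a < s < a + l -> a < t < a + l ->
  (((g t - g s) ^+ 2)%:E <= l%:E * \int[leb]_(r in `]a, (a + l)%R[) (dg r ^+ 2)%:E)%E.
Proof.
move=> cdg dgP; wlog st : s t / s < t.
  move=> H hs ht; have [st|ts|->] := ltgtP s t; first exact: H.
    by rewrite -sqrrN opprB; exact: H.
  rewrite subrr expr0n mule_ge0//; last by apply: integral_ge0 => r _; rewrite lee_fin sqr_ge0.
  by rewrite lee_fin; case/andP: ht => ? ?; lra.
move=> /andP[as_ sl] /andP[at_ tl].
pose D := `[s, t]%classic : set (measurableTypeR R).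
have mD : measurable D by exact: measurable_itv.
have fD : (leb D < +oo)%E by rewrite lebesgue_measure_itv/= lte_fin st -EFinB ltry.
have mdg : measurable_fun setT (dg : R -> R) by exact: continuous_measurable_fun.
have cg : continuous (g : R -> R^o).
  by move=> r; apply: differentiable_continuous; apply/derivable1_diffP; have D0 := dgP r.
have sdg : sqint leb D dg.
  have cK : compact (dg @` `[s, t]).
    by apply: continuous_compact; [exact: continuous_subspaceT|exact: segment_compact].
  have [M M0 HM] := compact_norm (cK : compact ((dg : R -> R^o) @` _)).
  apply: (sqint_bounded mD fD (M := M)); first by apply: measurable_funS mdg.
  by move=> x Dx; apply/ltW/HM; exists x.
have s1 : sqint leb D (fun=> 1).
  by apply: (sqint_bounded mD fD (M := 1)) => // x _; rewrite normr1.
have ftc : (\int[leb]_(x in `[s, t]) (dg x)%:E = (g t)%:E - (g s)%:E)%E.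
  apply: (@continuous_FTC2 R dg g s t st).
  - exact: continuous_subspaceT.
  - split.
    + by move=> x _; exact: (@ex_derive _ _ _ _ _ _ _ (dgP x)).
    + by apply: cvg_at_right_filter; exact: cg.
    + by apply: cvg_at_left_filter; exact: cg.
  - by move=> x _; rewrite derive1E; exact: (@derive_val _ _ _ _ _ _ _ (dgP x)).
have cs := cauchy_schwarz_sqr mD sdg s1.
have e1 : \int[leb]_(x in D) (dg x * 1) = g t - g s.
  by under eq_Rintegral do rewrite mulr1; rewrite /Rintegral ftc.
rewrite e1 in cs.
have e2 : nsq leb D (fun=> 1) = t - s.
  rewrite /nsq Rintegral_cst// expr1n mul1r.
  have H : leb D = (t - s)%:E by rewrite lebesgue_measure_itv/= lte_fin st EFinB.
  exact: (congr1 fine H).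
rewrite e2 in cs.
have cs' : (((g t - g s) ^+ 2)%:E <= ((t - s) * nsq leb D dg)%:E)%E by rewrite lee_fin mulrC.
apply: le_trans cs' _; rewrite EFinM -nsqE//; apply: lee_pmul.
- by rewrite lee_fin subr_ge0 ltW.
- by apply: integral_ge0 => r _; rewrite lee_fin sqr_ge0.
- by rewrite lee_fin; lra.
apply: ge0_subset_integral => //.
- apply/measurable_EFinP; apply: measurable_funX; apply: measurable_funS mdg => //.
- by move=> r _; rewrite lee_fin sqr_ge0.
- move=> r; rewrite /D /= !in_itv/= => /andP[h1 h2]; apply/andP; split; lra.
Qed.

Lemma integral_box_Fubini (F : plane R -> \bar R) (a b : plane R) :
  measurable_fun setT (F : mplane R -> \bar R) -> (forall x, 0 <= F x)%E ->
  (\int[mu]_(x in box a b) F x =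
   \int[leb]_(x2 in `]a.2, b.2[) \int[leb]_(x1 in `]a.1, b.1[) F (x1, x2))%E /\
  (\int[mu]_(x in box a b) F x =
   \int[leb]_(x1 in `]a.1, b.1[) \int[leb]_(x2 in `]a.2, b.2[) F (x1, x2))%E /\
  measurable_fun setT (fun x2 : measurableTypeR R => \int[leb]_(x1 in `]a.1, b.1[) F (x1, x2))%E /\
  measurable_fun setT (fun x1 : measurableTypeR R => \int[leb]_(x2 in `]a.2, b.2[) F (x1, x2))%E.
Proof.
move=> mF F0.
have mI (r s : R) : measurable (`]r, s[%classic : set (measurableTypeR R)) by exact: measurable_itv.
have mB : measurable (box a b : set (mplane R)) by exact: box_measurable.
have mF' := (measurable_restrictT F mB).1 (measurable_funTS mF).
have F'0 x : (0 <= (F \_ (box a b)) x)%E by rewrite /patch; case: ifP => // _; exact: F0.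
pose I1 := `]a.1, b.1[%classic : set (measurableTypeR R).
pose I2 := `]a.2, b.2[%classic : set (measurableTypeR R).
have memB x1 x2 : ((x1, x2) \in box a b) = (x1 \in I1) && (x2 \in I2).
  by rewrite /box in_setX.
have m1 : measurable (I1 `*` setT : set (mplane R)) by apply: measurableX; [first [exact: mI|exact: measurableT]|first [exact: mI|exact: measurableT]].
have m2 : measurable (setT `*` I2 : set (mplane R)) by apply: measurableX; [first [exact: mI|exact: measurableT]|first [exact: mI|exact: measurableT]].
split; [|split; [|split]].
- rewrite integral_mkcond.
  etransitivity; first exact: (fubini_tonelli2 (m1 := leb) (m2 := leb) _ mF' F'0).
  rewrite [RHS]integral_mkcond; apply: eq_integral => x2 _; rewrite /fubini_G [RHS]/patch.
  case: ifPn => hx; last first.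
    apply: integral0_eq => x1 _; rewrite /patch memB; case: ifPn => // /andP[_ h].
    by rewrite h in hx.
  rewrite [RHS]integral_mkcond; apply: eq_integral => x1 _; rewrite /patch memB.
  by rewrite [x2 \in I2]hx andbT.
- rewrite integral_mkcond.
  etransitivity; first exact: (fubini_tonelli1 (m1 := leb) (m2 := leb) _ mF' F'0).
  rewrite [RHS]integral_mkcond; apply: eq_integral => x1 _; rewrite /fubini_F [RHS]/patch.
  case: ifPn => hx; last first.
    apply: integral0_eq => x2 _; rewrite /patch memB; case: ifPn => // /andP[h _].
    by rewrite h in hx.
  rewrite [RHS]integral_mkcond; apply: eq_integral => x2 _; rewrite /patch memB.
  by rewrite [x1 \in I1]hx.
- have mg := (measurable_restrictT F m1).1 (measurable_funTS mF).
  have g0 (x : plane R) : (0 <= (F \_ (I1 `*` setT)) x)%E by rewrite /patch; case: ifP => // _; exact: F0.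
  have := measurable_fun_fubini_tonelli_G (m1 := leb) _ mg g0.
  congr measurable_fun; apply/funext => x2; rewrite /fubini_G [RHS]integral_mkcond.
  by apply: eq_integral => x1 _; rewrite /patch in_setX in_setT andbT.
- have mg := (measurable_restrictT F m2).1 (measurable_funTS mF).
  have g0 (x : plane R) : (0 <= (F \_ (setT `*` I2)) x)%E by rewrite /patch; case: ifP => // _; exact: F0.
  have := measurable_fun_fubini_tonelli_F (m2 := leb) _ mg g0.
  congr measurable_fun; apply/funext => x1; rewrite /fubini_F [RHS]integral_mkcond.
  by apply: eq_integral => x2 _; rewrite /patch in_setX in_setT.
Qed.

(** The point (x1, x2) is joined to (y1, y2) by a horizontal segment and a segment of the vertical
    line through y1, and [sqr_diff_le] is applied to each. The abscissa y1 is found in a prescribed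
    strip of relative width c, while y2 stays free, so that the reference point can be placed where
    psi vanishes. *)
Lemma poincare_box psi (a : plane R) (l i c K : R) : test_function setT psi ->
  0 < l -> 0 < c -> a.1 <= i -> i + c * l <= a.1 + l ->
  let Q := box a (a.1 + l, a.2 + l) in
  nsq mu Q (fun x => (grad psi x).1) + nsq mu Q (fun x => (grad psi x).2) < K ->
  exists2 y1, i < y1 < i + c * l & forall y2, a.2 < y2 < a.2 + l ->
    nsq mu Q (fun x => psi x - psi (y1, y2)) <= 2 * l ^+ 2 * (1 + c^-1) * K.
Proof.
have sq2 (u v w : R) : (u - w) ^+ 2 <= 2 * ((u - v) ^+ 2 + (v - w) ^+ 2).
  by have := sqr_ge0 ((u - v) - (v - w)); nra.
move=> tp l0 c0 ai il Q EK.
have mQ : measurable (Q : set (mplane R)) by exact: box_measurable.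
have oQ : open Q by exact: box_open.
have t1 := test_derive (1, 0) tp; have t2 := test_derive (0, 1) tp.
pose d1 x := 'D_(1, 0) (psi : _ -> R^o) x; pose d2 x := 'D_(0, 1) (psi : _ -> R^o) x.
have s1 : sqint mu Q d1 by exact: (test_sqint oQ t1).
have s2 : sqint mu Q d2 by exact: (test_sqint oQ t2).
have m1 : measurable_fun setT ((fun x => (d1 x ^+ 2)%:E) : mplane R -> \bar R).
  by apply/measurable_EFinP; apply: measurable_funX; exact: test_measurable t1.
have m2 : measurable_fun setT ((fun x => (d2 x ^+ 2)%:E) : mplane R -> \bar R).
  by apply/measurable_EFinP; apply: measurable_funX; exact: test_measurable t2.
have [G1 [_ [mG1 _]]] := integral_box_Fubini a (a.1 + l, a.2 + l) m1 (fun x => sqr_ge0 (d1 x)).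
have [_ [F2 [_ mF2]]] := integral_box_Fubini a (a.1 + l, a.2 + l) m2 (fun x => sqr_ge0 (d2 x)).
set E1 := nsq mu Q (fun x => (grad psi x).1) in EK; set E2 := nsq mu Q (fun x => (grad psi x).2) in EK.
have E1_ge0 : 0 <= E1 by exact: nsq_ge0.
have E2_ge0 : 0 <= E2 by exact: nsq_ge0.
have K0 : 0 < K := le_lt_trans (addr_ge0 E1_ge0 E2_ge0) EK.
have E1K : E1 < K := le_lt_trans (ler_wpDr E2_ge0 (lexx _)) EK.
have E2K : E2 < K := le_lt_trans (ler_wpDl E1_ge0 (lexx _)) EK.
pose P1 (x2 : R) := (\int[leb]_(x1 in `]a.1, (a.1 + l)%R[) (d1 (x1, x2) ^+ 2)%:E)%E.
pose P2 (x1 : R) := (\int[leb]_(x2 in `]a.2, (a.2 + l)%R[) (d2 (x1, x2) ^+ 2)%:E)%E.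
have {}G1 : (E1%:E = \int[leb]_(x2 in `]a.2, (a.2 + l)%R[) P1 x2)%E := etrans (esym (nsqE mQ s1)) G1.
have {}F2 : (E2%:E = \int[leb]_(x1 in `]a.1, (a.1 + l)%R[) P2 x1)%E := etrans (esym (nsqE mQ s2)) F2.
have P1_ge0 x : (0 <= P1 x)%E by apply: integral_ge0 => y _; rewrite lee_fin sqr_ge0.
have P2_ge0 x : (0 <= P2 x)%E by apply: integral_ge0 => y _; rewrite lee_fin sqr_ge0.
have cl0 : 0 < c * l by rewrite mulr_gt0.
(* Averaging: if the vertical energy exceeded [K / (c * l)] on the whole strip of width [c * l], the
   total energy would reach K. *)
have [y1 y1i Py1] : exists2 y1, i < y1 < i + c * l & (P2 y1 <= (K / (c * l))%:E)%E.
  apply: contrapT => H.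
  have H' y1 : i < y1 < i + c * l -> ((K / (c * l))%:E <= P2 y1)%E.
    by move=> hy; rewrite leNgt; apply/negP => hP; apply: H; exists y1 => //; exact: ltW.
  have : (K%:E <= E2%:E)%E.
    rewrite F2; apply: (@le_trans _ _ (\int[leb]_(x1 in `]i, (i + c * l)%R[) P2 x1)%E).
      have -> : (K%:E = \int[leb]_(x1 in `]i, (i + c * l)%R[) (cst (K / (c * l))%R%:E) x1)%E.
        rewrite integral_cst_itv// -EFinM; congr EFin.
        by rewrite divfK// gt_eqF.
      apply: ge0_le_integral; first exact: measurable_itv.
      - by move=> x _; rewrite lee_fin divr_ge0// ltW.
      - exact: measurable_cst.
      - by apply: measurable_funS mF2.
      - by move=> x; rewrite /= in_itv/=; exact: H'.
    apply: ge0_subset_integral; [exact: measurable_itv|exact: measurable_itv| | |].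
    - by apply: measurable_funS mF2.
    - by move=> x _; exact: P2_ge0.
    - by move=> x; rewrite /= !in_itv/= => /andP[h1 h2]; apply/andP; split;
        [exact: le_lt_trans ai h1|exact: lt_le_trans h2 il].
  by rewrite lee_fin leNgt E2K.
exists y1 => // y2 y2j.
have y1j : a.1 < y1 < a.1 + l by case/andP: y1i => h1 h2; rewrite (le_lt_trans ai h1) (lt_le_trans h2 il).
pose F0 x := ((psi x - psi (y1, y2)) ^+ 2)%:E.
have mF0 : measurable_fun setT (F0 : mplane R -> \bar R).
  apply/measurable_EFinP; apply: measurable_funX; apply: measurable_funB => //.
  exact: test_measurable tp.
have s0 : sqint mu Q (fun x => psi x - psi (y1, y2)).
  apply: sqintB => //; first exact: test_sqint tp.
  apply: (@sqint_bounded _ _ _ mu Q _ `|psi (y1, y2)|) => //.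
  by rewrite mu2_box ?ltry//= lerDl ltW.
have [G0 _] := integral_box_Fubini a (a.1 + l, a.2 + l) mF0 (fun x => sqr_ge0 _).
have {}G0 : ((nsq mu Q (fun x => psi x - psi (y1, y2)))%:E = \int[leb]_(x2 in `]a.2, (a.2 + l)%R[)
    \int[leb]_(x1 in `]a.1, (a.1 + l)%R[) F0 (x1, x2))%E := etrans (esym (nsqE mQ s0)) G0.
have two0 : (0 <= 2%:E :> \bar R)%E by rewrite lee_fin.
have pt x1 x2 : a.1 < x1 < a.1 + l -> a.2 < x2 < a.2 + l ->
    (F0 (x1, x2) <= (2 * l)%:E * (P1 x2 + P2 y1))%E.
  move=> hx1 hx2.
  have D1 (r : R) : is_derive r (1 : R) ((fun s => psi (s, x2)) : R -> R^o) (d1 (r, x2)).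
    have := derivable_line (x := ((0, x2) : plane R)) (v := ((1, 0) : plane R)) (s := r)
      (smooth_derivable (v := (1, 0)) (x := (0, x2) + r *: (1, 0)) tp.1).
    have E r' : (0, x2) + r' *: (1, 0) = (r', x2) :> plane R.
      transitivity ((0 + r' * 1, x2 + r' * 0) : plane R) => //.
      by rewrite mulr1 mulr0 add0r addr0.
    by under eq_fun do rewrite E; rewrite E.
  have D2 (r : R) : is_derive r (1 : R) ((fun s => psi (y1, s)) : R -> R^o) (d2 (y1, r)).
    have := derivable_line (x := ((y1, 0) : plane R)) (v := ((0, 1) : plane R)) (s := r)
      (smooth_derivable (v := (0, 1)) (x := (y1, 0) + r *: (0, 1)) tp.1).
    have E r' : (y1, 0) + r' *: (0, 1) = (y1, r') :> plane R.
      transitivity ((y1 + r' * 0, 0 + r' * 1) : plane R) => //.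
      by rewrite mulr1 mulr0 add0r addr0.
    by under eq_fun do rewrite E; rewrite E.
  have c1 : continuous ((fun r => d1 (r, x2)) : R -> R^o).
    move=> r; apply: (@continuous_comp _ _ _ (fun r : R => (r, x2) : plane R) (d1 : _ -> R^o)).
      exact: continuous_pairl.
    exact: (test_continuous t1).
  have c2 : continuous ((fun r => d2 (y1, r)) : R -> R^o).
    move=> r; apply: (@continuous_comp _ _ _ (fun r : R => (y1, r) : plane R) (d2 : _ -> R^o)).
      exact: continuous_pairr.
    exact: (test_continuous t2).
  have b1 := sqr_diff_le c1 D1 y1j hx1.
  have b2 := sqr_diff_le c2 D2 y2j hx2.
  rewrite EFinM -muleA (ge0_muleDr _ (P1_ge0 x2) (P2_ge0 y1)).
  apply: (@le_trans _ _ (2%:E * (((psi (x1, x2) - psi (y1, x2)) ^+ 2)%R%:E + ((psi (y1, x2) - psi (y1, y2)) ^+ 2)%R%:E))%E).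
    rewrite /F0 -EFinD -EFinM lee_fin.
    set u := psi _; set v := psi _; set w := psi _.
    exact: sq2.
  exact: (lee_wpmul2l two0 (leeD b1 b2)).
have l0' : (0 <= l%:E)%E by rewrite lee_fin ltW.
rewrite -lee_fin G0.
apply: (@le_trans _ _ (\int[leb]_(x2 in `]a.2, (a.2 + l)%R[) (l%:E * ((2 * l)%:E * (P1 x2 + P2 y1))))%E).
  apply: ge0_le_integral; first exact: measurable_itv.
  - by move=> x _; apply: integral_ge0 => y _; rewrite lee_fin sqr_ge0.
  - have [_ [_ [h _]]] := integral_box_Fubini a (a.1 + l, a.2 + l) mF0 (fun x => sqr_ge0 _).
    by apply: measurable_funS h.
  - apply: measurable_funeM; apply: measurable_funeM; apply: emeasurable_funD.
      by apply: measurable_funS mG1.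
    exact: measurable_cst.
  move=> x2; rewrite /= in_itv/= => hx2.
  have -> : (l%:E * ((2 * l)%:E * (P1 x2 + P2 y1)) =
     \int[leb]_(x1 in `]a.1, (a.1 + l)%R[) (cst ((2 * l)%:E * (P1 x2 + P2 y1))) x1)%E.
    by rewrite integral_cst_itv// muleC.
  apply: ge0_le_integral; first exact: measurable_itv.
  - by move=> x1 _; rewrite lee_fin sqr_ge0.
  - apply/measurable_EFinP.
    have mx : measurable_fun setT (fun x1 : measurableTypeR R => psi (x1, x2) - psi (y1, y2)).
      apply: measurable_funB => //; apply: continuous_measurable_fun => r.
      apply: (@continuous_comp _ _ _ (fun r : R => (r, x2) : plane R) (psi : _ -> R^o)).
        exact: continuous_pairl.
      exact: (test_continuous tp).
    by apply: measurable_funX; apply: measurable_funS mx.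
  - exact: measurable_cst.
  - by move=> x1; rewrite /= in_itv/= => hx1; exact: pt.
have E0 : (\int[leb]_(x2 in `]a.2, (a.2 + l)%R[) (l%:E * ((2 * l)%:E * (P1 x2 + P2 y1))) =
   (2 * l ^+ 2)%:E * (E1%:E + l%:E * P2 y1))%E.
  under eq_integral do rewrite muleA -EFinM.
  have mP1 : measurable_fun `]a.2, (a.2 + l)%R[ (P1 : measurableTypeR R -> \bar R).
    by apply: measurable_funS mG1.
  rewrite ge0_integralZl; [|exact: measurable_itv| | |]; last 3 first.
  - by apply: emeasurable_funD; [exact: mP1|exact: measurable_cst].
  - by move=> x _; exact: adde_ge0 (P1_ge0 x) (P2_ge0 y1).
  - by rewrite lee_fin !mulr_ge0 ?ltW.
  rewrite ge0_integralD; [|exact: measurable_itv| |exact: mP1| |exact: measurable_cst]; last 2 first.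
  - by move=> x _; exact: P1_ge0.
  - by move=> x _; exact: P2_ge0.
  have l2 : l * (2 * l) = 2 * l ^+ 2 by ring.
  have eP2 := etrans (integral_cst_itv a.2 (P2 y1) l0) (muleC _ _).
  exact: (congr2 (fun (u : R) (v : \bar R) => u%:E * v)%E l2 (congr2 adde (esym G1) eP2)).
rewrite E0.
apply: (@le_trans _ _ ((2 * l ^+ 2)%:E * (K%:E + l%:E * (K / (c * l))%:E))%E).
  apply: lee_wpmul2l; first by rewrite lee_fin mulr_ge0// sqr_ge0.
  apply: leeD; last exact: (lee_wpmul2l l0' Py1).
  by rewrite lee_fin (ltW E1K).
have fin : 2 * l ^+ 2 * (K + l * (K / (c * l))) = 2 * l ^+ 2 * (1 + c^-1) * K.
  by field; rewrite !gt_eqF.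
by rewrite -fin [leRHS]EFinM EFinD EFinM.
Qed.

End poincare.

(** * Barycentric coordinates *)

Section barycentric.
Variable R : realType.
Implicit Types (t : 'I_3 -> plane R) (x y w : plane R).

Lemma sum3 (V : nmodType) (F : 'I_3 -> V) : \sum_i F i = F 0 + F 1 + F 2%:R.
Proof.
rewrite !big_ord_recl big_ord0 addr0 addrA.
by congr (F _ + F _ + F _); apply: val_inj.
Qed.

Lemma plane_eq x y : x.1 = y.1 -> x.2 = y.2 -> x = y.
Proof. by case: x y => ? ? [? ?] /= -> ->. Qed.

Lemma dot_gt0 x : x != 0 -> 0 < dot x x.
Proof.
move=> x0; rewrite /dot -!expr2 lt0r addr_ge0 ?sqr_ge0// andbT paddr_eq0 ?sqr_ge0//.
rewrite !sqrf_eq0; apply: contra x0 => /andP[/eqP h1 /eqP h2].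
by rewrite [x]surjective_pairing h1 h2.
Qed.

Lemma ord3P (P : 'I_3 -> Prop) : P 0 -> P 1 -> P 2%:R -> forall i, P i.
Proof.
move=> P0 P1 P2 [[|[|[|//]]] h].
- by rewrite (_ : Ordinal h = 0)//; apply: val_inj.
- by rewrite (_ : Ordinal h = 1)//; apply: val_inj.
- by rewrite (_ : Ordinal h = 2%:R)//; apply: val_inj.
Qed.

Definition tdet t : R :=
  (t 1 - t 0).1 * (t 2%:R - t 0).2 - (t 1 - t 0).2 * (t 2%:R - t 0).1.

(** Gradients of the barycentric coordinates, by Cramer's rule in the basis of the two edges at
    [t 0]; [tdet] is twice the signed area. *)
Definition gbary t (i : 'I_3) : plane R :=
  let u := t 1 - t 0 in let v := t 2%:R - t 0 in
  match val i with
  | 0%N => ((u.2 - v.2) / tdet t, (v.1 - u.1) / tdet t)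
  | 1%N => (v.2 / tdet t, - v.1 / tdet t)
  | _ => (- u.2 / tdet t, u.1 / tdet t)
  end.

Definition bary t (i : 'I_3) x : R := (i == 0)%:R + dot (gbary t i) (x - t 0).

Lemma dotB (a x y : plane R) : dot a (x - y) = dot a x - dot a y.
Proof. rewrite /dot /=; ring. Qed.

Lemma dotD (a x y : plane R) : dot a (x + y) = dot a x + dot a y.
Proof. rewrite /dot /=; ring. Qed.

Lemma dotZ (a x : plane R) (c : R) : dot a (c *: x) = c * dot a x.
Proof. rewrite /dot /= /GRing.scale/=; ring. Qed.

Lemma bary_diff t i x y : bary t i x - bary t i y = dot (gbary t i) (x - y).
Proof. rewrite /bary !dotB; ring. Qed.

Lemma bary_sum t x : \sum_i bary t i x = 1.
Proof. rewrite sum3 /bary /dot /gbary /=; ring. Qed.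

Lemma gbary_sum t : \sum_i gbary t i = 0.
Proof.
rewrite sum3 /gbary /=; set d := tdet t; set u := t 1 - t 0; set v := t 2%:R - t 0.
transitivity (((u.2 - v.2) / d + v.2 / d + - u.2 / d, (v.1 - u.1) / d + - v.1 / d + u.1 / d) : plane R) => //.
by congr pair; ring.
Qed.

Lemma bary_affine t i (lam : 'I_3 -> R) (p : 'I_3 -> plane R) : \sum_j lam j = 1 ->
  bary t i (\sum_j lam j *: p j) = \sum_j lam j * bary t i (p j).
Proof.
rewrite !sum3 /bary => h; rewrite !dotB !dotD !dotZ.
have -> : lam 0 = 1 - lam 1 - lam 2%:R by rewrite -h; ring.
ring.
Qed.

Variable t : 'I_3 -> plane R.
Hypothesis nt : Defs.nondegenerate t.

Let d0 : tdet t != 0. Proof. exact: nt. Qed.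

Lemma bary_vertex i j : bary t i (t j) = (i == j)%:R.
Proof.
have H : (t 1 - t 0).1 * (t 2%:R - t 0).2 - (t 1 - t 0).2 * (t 2%:R - t 0).1 != 0 by exact: d0.
move: i j; apply: ord3P; apply: ord3P; rewrite /bary /gbary /dot /= ?subrr /=;
  rewrite ?mulr0 ?addr0 ?add0r // /tdet; move: H;
  set a := (t 1 - t 0).1; set b := (t 1 - t 0).2; set c := (t 2%:R - t 0).1;
  set e := (t 2%:R - t 0).2 => H; field; exact: H.
Qed.

Lemma bary_recover x : \sum_i bary t i x *: t i = x.
Proof.
have H : (t 1 - t 0).1 * (t 2%:R - t 0).2 - (t 1 - t 0).2 * (t 2%:R - t 0).1 != 0 by exact: d0.
rewrite sum3; apply: plane_eq; rewrite /bary /gbary /dot /tdet /= /GRing.scale/=;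
  by move: H; rewrite /= => H; field.
Qed.

Lemma bary_unique (lam : 'I_3 -> R) x : \sum_j lam j = 1 -> x = \sum_j lam j *: t j ->
  forall i, bary t i x = lam i.
Proof.
move=> h -> i; rewrite bary_affine// (bigD1 i)//= bary_vertex eqxx mulr1 big1 ?addr0//.
by move=> j ji; rewrite bary_vertex eq_sym (negbTE ji) mulr0.
Qed.

Lemma faceP (I : {set 'I_3}) x :
  face t I x <-> (forall i, 0 <= bary t i x) /\ (forall i, i \notin I -> bary t i x = 0).
Proof.
split.
  move=> [lam [l0 lI l1 xl]]; have E := bary_unique l1 xl.
  by split => i; rewrite E//; exact: lI.
move=> [b0 bI]; exists (fun i => bary t i x); split => //.
  exact: bary_sum.
by rewrite bary_recover.
Qed.

Lemma triangleP x : triangle t x <-> forall i, 0 <= bary t i x.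
Proof.
rewrite /triangle faceP; split => [[]//|h]; split => // i.
by rewrite finset.in_setT.
Qed.

Lemma triangle_vertex i : triangle t (t i).
Proof. by apply/triangleP => j; rewrite bary_vertex. Qed.

Lemma bary_le1 i x : triangle t x -> bary t i x <= 1.
Proof.
move=> /triangleP b0; rewrite -(bary_sum t x) (bigD1 i)//= lerDl.
by apply: sumr_ge0.
Qed.

Lemma bary1_vertex i x : triangle t x -> bary t i x = 1 -> x = t i.
Proof.
move=> /triangleP b0 b1.
have : \sum_(j | j != i) bary t j x = 0.
  by have := bary_sum t x; rewrite (bigD1 i)//= b1; lra.
move=> /psumr_eq0P h.
rewrite -[LHS]bary_recover (bigD1 i)//= b1 scale1r big1 ?addr0// => j ji.
by rewrite h ?scale0r// => k _; exact: b0.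
Qed.

Lemma vertex_inj i j : t i = t j -> i = j.
Proof.
move=> e; apply/eqP; have := bary_vertex i j; rewrite -e bary_vertex eqxx.
by case: (i == j) => // /eqP; rewrite oner_eq0.
Qed.

Lemma triangle_convex x y (s : R) : triangle t x -> triangle t y -> 0 <= s -> s <= 1 ->
  triangle t (x + s *: (y - x)).
Proof.
move=> /triangleP hx /triangleP hy s0 s1; apply/triangleP => i.
have -> : bary t i (x + s *: (y - x)) = (1 - s) * bary t i x + s * bary t i y.
  by rewrite /bary !dotB !dotD !dotZ !dotB; ring.
by rewrite addr_ge0// mulr_ge0// subr_ge0.
Qed.

Lemma bary_continuous i : continuous (bary t i : _ -> R^o).
Proof.
move=> x; apply: cvgD; first exact: cvg_cst.
apply: (@continuous_comp _ _ _ (fun x : plane R => x - t 0) (dot (gbary t i) : _ -> R^o)).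
  by apply: cvgB; [exact: cvg_id|exact: cvg_cst].
exact: dot_continuous.
Qed.

Lemma triangle_closed : closed (triangle t).
Proof.
have -> : triangle t = (bary t 0 @^-1` [set y | 0 <= y]) `&` (bary t 1 @^-1` [set y | 0 <= y]) `&`
   (bary t 2%:R @^-1` [set y | 0 <= y]).
  apply/seteqP; split => x /=; first by move=> /triangleP h; split; [split|]; exact: h.
  by move=> [[h0 h1] h2]; apply/triangleP; exact: ord3P.
have o i : closed (bary t i @^-1` [set y | 0 <= y]).
  by apply: (@closed_comp _ _ (bary t i : _ -> R^o)); [move=> x _; exact: bary_continuous|exact: closed_ge].
by apply: closedI; [apply: closedI|].
Qed.

Definition opent : set (plane R) := [set x | forall i, 0 < bary t i x].

Lemma opent_open : open opent.
Proof.
have -> : opent = (bary t 0 @^-1` [set y | 0 < y]) `&` (bary t 1 @^-1` [set y | 0 < y]) `&`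
   (bary t 2%:R @^-1` [set y | 0 < y]).
  apply/seteqP; split => x /=; first by move=> h; split; [split|]; exact: h.
  by move=> [[h0 h1] h2]; exact: ord3P.
have o i : open (bary t i @^-1` [set y | 0 < y]).
  by apply: (@open_comp _ _ (bary t i : _ -> R^o)); [move=> x _; exact: bary_continuous|exact: open_gt].
by apply: openI; [apply: openI|].
Qed.

Lemma opent_sub : opent `<=` triangle t.
Proof. by move=> x h; apply/triangleP => i; exact/ltW/h. Qed.

Lemma gbary_neq0 i : gbary t i != 0.
Proof.
apply/eqP => g0; have [j ij] : exists j, i != j by move: i {g0}; apply: ord3P; [exists 1|exists 0|exists 0].
have := bary_diff t i (t i) (t j).
rewrite !bary_vertex eqxx (negbTE ij) g0 /dot /= !mul0r addr0 subr0 => /eqP.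
by rewrite oner_eq0.
Qed.

(** A small move from an interior point against the gradient of a coordinate strictly decreases it
    and stays in the triangle, so the coordinate was positive. *)
Lemma interior_opent : (triangle t)° = opent.
Proof.
apply/seteqP; split; last first.
  move=> x ox; apply: (@filterS _ (nbhs x) _ opent); first exact: opent_sub.
  by apply: open_nbhs_nbhs; split; [exact: opent_open|].
move=> x /nbhs_plane[e e0 eT] i.
pose g := gbary t i.
have gg : 0 < dot g g by apply: dot_gt0; exact: gbary_neq0.
pose s := e / (`|g.1| + `|g.2| + 1).
have n0 : 0 < `|g.1| + `|g.2| + 1 by rewrite ltr_wpDl// addr_ge0.
have s0 : 0 < s by rewrite divr_gt0.
have : triangle t (x - s *: g).
  apply: eT; split => /=; rewrite addrAC subrr add0r normrN normrM (gtr0_norm s0).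
    rewrite /s mulrAC ltr_pdivrMr// ltr_pM2l//; have := normr_ge0 g.2; lra.
  rewrite /s mulrAC ltr_pdivrMr// ltr_pM2l//; have := normr_ge0 g.1; lra.
move=> /triangleP/(_ i); have := bary_diff t i (x - s *: g) x.
have e' : x - s *: g - x = (- s) *: g by rewrite addrAC subrr add0r scaleNr.
rewrite e' dotZ -/g => h1 h2.
have := mulr_gt0 s0 gg; rewrite mulNr in h1; lra.
Qed.

End barycentric.

(** * Diameters, inscribed discs and slopes of barycentric coordinates *)

Section triangle_metric.
Variable R : realType.
Implicit Types (t : 'I_3 -> plane R) (x y w : plane R).

Lemma norm1_le_vnorm x : `|x.1| <= vnorm x.
Proof. by rewrite -sqrtr_sqr ler_wsqrtr// /dot -!expr2 lerDl sqr_ge0. Qed.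

Lemma norm2_le_vnorm x : `|x.2| <= vnorm x.
Proof. by rewrite -sqrtr_sqr ler_wsqrtr// /dot -!expr2 lerDr sqr_ge0. Qed.

Lemma norm_le_vnorm x : `|x| <= vnorm x.
Proof. by rewrite prod_normE ge_max norm1_le_vnorm norm2_le_vnorm. Qed.

Lemma vnorm_le_norm1 x : vnorm x <= `|x.1| + `|x.2|.
Proof.
rewrite -[leRHS]ger0_norm ?addr_ge0// -sqrtr_sqr ler_wsqrtr// /dot -!expr2.
rewrite -(real_normK (num_real x.1)) -(real_normK (num_real x.2)).
have := normr_ge0 x.1; have := normr_ge0 x.2; nra.
Qed.

Lemma vnorm_le_norm x : vnorm x <= 2 * `|x|.
Proof.
apply: le_trans (vnorm_le_norm1 x) _; rewrite prod_normE.
have h1 : `|x.1| <= Num.max `|x.1| `|x.2| by rewrite le_max lexx.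
have h2 : `|x.2| <= Num.max `|x.1| `|x.2| by rewrite le_max lexx orbT.
lra.
Qed.

Lemma vnormZ (c : R) x : vnorm (c *: x) = `|c| * vnorm x.
Proof.
rewrite /vnorm -sqrtr_sqr -sqrtrM ?sqr_ge0//; congr Num.sqrt.
rewrite /dot /= /GRing.scale/=; ring.
Qed.

Lemma vnorm_gt0 x : x != 0 -> 0 < vnorm x.
Proof. by move=> x0; rewrite sqrtr_gt0; exact: dot_gt0. Qed.

(** The diameter is a supremum, so the distances must first be bounded: a coordinate of a point is a
    convex combination of those of the vertices. *)
Lemma le_diam t x y : Defs.nondegenerate t -> triangle t x -> triangle t y ->
  vnorm (x - y) <= diam (triangle t).
Proof.
move=> nt Tx Ty.
pose M := \sum_i (`|(t i).1| + `|(t i).2|).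
have comp (p : plane R -> R) z : (forall (c : R) u v, p (c *: u + v) = c * p u + p v) ->
    triangle t z -> `|p z| <= \sum_i `|p (t i)|.
  move=> pl Tz; rewrite -[z in leLHS](bary_recover nt) sum3 -addrA !pl.
  have p0 u : p u = 1 * p u by rewrite mul1r.
  have -> : p (bary t 2%:R z *: t 2%:R) = bary t 2%:R z * p (t 2%:R).
    have := pl (bary t 2%:R z) (t 2%:R) 0; rewrite addr0 => ->.
    have := pl 1 0 0; rewrite scaler0 addr0 mul1r => h.
    by rewrite (_ : p 0 = 0) ?addr0//; lra.
  have bp i u : `|bary t i z * p u| <= `|p u|.
    have b0 := (triangleP nt _).1 Tz i.
    by rewrite normrM (ger0_norm b0) ler_piMl//; exact: bary_le1.
  rewrite sum3 -addrA; apply: le_trans (ler_normD _ _) _; apply: lerD; first exact: bp.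
  by apply: le_trans (ler_normD _ _) _; apply: lerD; exact: bp.
have b1 z : triangle t z -> `|z.1| <= \sum_i `|(t i).1|.
  by apply: (comp fst).
have b2 z : triangle t z -> `|z.2| <= \sum_i `|(t i).2|.
  by apply: (comp snd).
apply: ub_le_sup; last by exists (x, y).
exists (2 * (\sum_i `|(t i).1|) + 2 * (\sum_i `|(t i).2|)) => _ [[u v] [/= Tu Tv] <-].
apply: le_trans (vnorm_le_norm1 _) _ => /=.
have h1 := ler_normB u.1 v.1; have h2 := ler_normB u.2 v.2.
move: (b1 _ Tu) (b1 _ Tv) (b2 _ Tu) (b2 _ Tv) h1 h2.
set a := \sum_i _; set b := \sum_i _; lra.
Qed.

Lemma diam_gt0 t : Defs.nondegenerate t -> 0 < diam (triangle t).
Proof.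
move=> nt; apply: lt_le_trans (le_diam nt (triangle_vertex nt 0) (triangle_vertex nt 1)).
apply: vnorm_gt0; rewrite subr_eq0; apply/eqP => /(vertex_inj nt) /eqP.
by [].
Qed.

Lemma diam_le t (M : R) : (forall x y, triangle t x -> triangle t y -> vnorm (x - y) <= M) ->
  Defs.nondegenerate t -> diam (triangle t) <= M.
Proof.
move=> h nt; apply: ge_sup.
  by exists (vnorm (t 0 - t 0)), (t 0, t 0) => //; split; exact: triangle_vertex.
by move=> _ [[u v] [Tu Tv] <-]; exact: h.
Qed.

(** The supremum [indiam] is not assumed to be attained, so the disc kept here is within a factor 2
    of it; another factor 2 turns diameters into radii. *)
Definition fat (S : R) t := exists c r, [/\ 0 < r,
  forall x, vnorm (x - c) < r -> triangle t x & diam (triangle t) <= 4 * S * r].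

(** Since sigma is an arbitrary real, the maximum with 1 provides the bound S >= 1 of the later
    sections. *)
Lemma shape_fat (sigma : R) t : Defs.nondegenerate t ->
  diam (triangle t) <= sigma * indiam (triangle t) -> fat (Num.max sigma 1) t.
Proof.
move=> nt h; have d0 := diam_gt0 nt; set S := Num.max sigma 1.
have S0 : 0 < S by rewrite lt_max ltr01 orbT.
set A := [set r *+ 2 | r in [set r | 0 <= r /\
  exists c, forall x, vnorm (x - c) < r -> triangle t x]].
have A0 : A !=set0.
  exists 0, 0; last by rewrite mul0rn.
  by split => //; exists 0 => x; rewrite ltNge sqrtr_ge0.
(* When [has_sup] fails the supremum is 0 by convention. *)
have i0 : 0 <= sup A.
  have [hs|/sup_out ->//] := pselect (has_sup A).
  apply: ub_le_sup; first exact: hs.2.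
  exists 0; last by rewrite mul0rn.
  by split => //; exists 0 => x; rewrite ltNge sqrtr_ge0.
have h' : diam (triangle t) <= S * sup A.
  apply: le_trans h _; rewrite -/(sup A); apply: ler_wpM2r => //.
  by rewrite le_max lexx.
have sA : 0 < sup A.
  by rewrite lt0r i0 andbT; apply/eqP => e; move: h'; rewrite e mulr0 leNgt d0.
have : diam (triangle t) / (2 * S) < sup A.
  rewrite ltr_pdivrMr ?mulr_gt0//; apply: le_lt_trans h' _.
  by rewrite [ltRHS]mulrC ltr_pM2r// mulr_natl mulr2n ltrDl.
move=> /(sup_gt A0)[_ [r [r0 [c hc]] <-]] hr.
exists c, r; split => //.
  rewrite lt0r r0 andbT; apply/eqP => e; move: hr; rewrite e mul0rn ltNge => /negP; apply.
  by rewrite divr_ge0// ?mulr_ge0// ltW.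
move: hr; rewrite ltr_pdivrMr ?mulr_gt0// => /ltW /le_trans; apply.
by rewrite le_eqVlt; apply/orP; left; apply/eqP; ring.
Qed.

Section fat_triangle.
Variables (S : R) (t : 'I_3 -> plane R).
Hypotheses (S0 : 0 < S) (nt : Defs.nondegenerate t) (ft : fat S t).

Local Notation h := (diam (triangle t)).

(** A barycentric coordinate lies in [0, 1] on the inscribed disc, so it varies by at most 1 over
    half a radius, and the radius is at least h / (4 S). *)
Lemma gbary_bound i w : `|dot (gbary t i) w| <= 8 * S / h * vnorm w.
Proof.
have h0 := diam_gt0 nt; have [c [r [r0 hc hr]]] := ft.
have [->|w0] := eqVneq w 0.
  by rewrite /dot /= !mulr0 addr0 normr0 mulr_ge0 ?sqrtr_ge0// divr_ge0 ?mulr_ge0// ltW.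
have vw : 0 < vnorm w by exact: vnorm_gt0.
pose s := r / (2 * vnorm w); have s0 : 0 < s by rewrite divr_gt0// mulr_gt0.
have Tc : triangle t c by apply: hc; rewrite subrr /vnorm /dot /= !mul0r addr0 sqrtr0.
have Tw : triangle t (c + s *: w).
  apply: hc; rewrite addrAC subrr add0r vnormZ gtr0_norm//.
  have -> : s * vnorm w = r / 2 by rewrite /s; field; rewrite gt_eqF.
  lra.
have := bary_diff t i (c + s *: w) c; rewrite [c + _ - c]addrAC subrr add0r dotZ => e.
have b : `|s * dot (gbary t i) w| <= 1.
  rewrite -e ler_norml; have := bary_le1 nt i Tc; have := bary_le1 nt i Tw.
  have := (triangleP nt _).1 Tc i; have := (triangleP nt _).1 Tw i.
  by move=> ? ? ? ?; apply/andP; split; lra.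
move: b; rewrite normrM (gtr0_norm s0) mulrC -ler_pdivlMr// => b.
apply: le_trans b _; rewrite div1r /s invfM invrK mulrA.
have -> : r^-1 * 2 * vnorm w = 2 / r * vnorm w by rewrite mulrC; ring.
rewrite ler_pM2r// ler_pdivrMr// mulrAC ler_pdivlMr//.
apply: (@le_trans _ _ (2 * (4 * S * r))); first by rewrite ler_pM2l.
by rewrite le_eqVlt; apply/orP; left; apply/eqP; ring.
Qed.

Lemma vnorm_gbary i : vnorm (gbary t i) <= 8 * S / h.
Proof.
have g0 := vnorm_gt0 (gbary_neq0 nt i).
rewrite -(ler_pM2r g0); apply: le_trans (gbary_bound i (gbary t i)).
have -> : vnorm (gbary t i) * vnorm (gbary t i) = dot (gbary t i) (gbary t i).
  by rewrite -expr2 sqr_sqrtr// /dot -!expr2 addr_ge0 ?sqr_ge0.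
exact: ler_norm.
Qed.

(** The i-th coordinate falls from 1 to 0 along the edge with a bounded slope, so the edge cannot be
    short. *)
Lemma edge_bound i j : i != j -> h <= 8 * S * vnorm (t i - t j).
Proof.
move=> ij; have h0 := diam_gt0 nt; have := gbary_bound i (t i - t j).
rewrite -bary_diff !(bary_vertex nt) eqxx (negbTE ij) subr0 normr1.
by rewrite mulrAC ler_pdivlMr// mul1r.
Qed.

End fat_triangle.
End triangle_metric.

(** * Triangulations *)

Section conformity.
Variable R : realType.
Variables (D : set (plane R)) (m : nat) (t : 'I_m -> 'I_3 -> plane R).
Hypothesis tri : triangulation D t.
Implicit Types (x y z : plane R) (k l : 'I_m) (a : plane R -> R).

Local Notation T k := (triangle (t k)).
Local Notation "'h_ k" := (diam (triangle (t k))) (at level 8, k at level 2).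

Lemma tri_nondeg k : Defs.nondegenerate (t k). Proof. by case: tri. Qed.
Local Notation nd := tri_nondeg.

Lemma tri_cover x : closure D x -> exists k, T k x.
Proof. by case: tri => _ <- _ [k _ Tk]; exists k. Qed.

Lemma tri_sub k : T k `<=` closure D.
Proof. by case: tri => _ <- _ x Tx; exists k. Qed.

Definition lin k a x : R := \sum_i bary (t k) i x * a (t k i).

Lemma lin_affine k a (lam : 'I_3 -> R) (p : 'I_3 -> plane R) : \sum_j lam j = 1 ->
  lin k a (\sum_j lam j *: p j) = \sum_j lam j * lin k a (p j).
Proof.
move=> l1; rewrite /lin; under eq_bigr do rewrite bary_affine//.
under eq_bigr do rewrite mulr_suml.
rewrite exchange_big/=; apply: eq_bigr => j _; rewrite mulr_sumr.
by apply: eq_bigr => i _; rewrite mulrA.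
Qed.

Lemma lin_vertex k a i : lin k a (t k i) = a (t k i).
Proof.
rewrite /lin (bigD1 i)//= (bary_vertex (nd k)) eqxx mul1r big1 ?addr0// => j ji.
by rewrite (bary_vertex (nd k)) (negbTE ji) mul0r.
Qed.

(** Extreme point argument: [t k i] is a convex combination of the [t l j] with j in J, and at these
    the i-th coordinate of [t k] is at most 1. It is 1 at [t k i], hence also at each vertex of
    nonzero weight. *)
Lemma face_vertex k l (I J : {set 'I_3}) i : face (t k) I = face (t l) J -> i \in I ->
  exists2 j, j \in J & t l j = t k i.
Proof.
move=> E iI.
have fk : face (t k) I (t k i).
  apply/(faceP (nd k)); split => j; rewrite (bary_vertex (nd k)); first by [].
  by move=> jI; case: eqP => // e; rewrite e iI in jI.
have /(faceP (nd l))[m0 mJ] : face (t l) J (t k i) by rewrite -E.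
have fJ j : j \in J -> face (t k) I (t l j).
  move=> jJ; rewrite E; apply/(faceP (nd l)); split => i'; rewrite (bary_vertex (nd l)); first by [].
  by move=> iJ; case: eqP => // e; rewrite e jJ in iJ.
have fb j : j \in J -> bary (t k) i (t l j) <= 1.
  move=> jJ; apply: (bary_le1 (nd k)); apply/(triangleP (nd k)).
  by have /(faceP (nd k))[] := fJ j jJ.
have s1 : \sum_j bary (t l) j (t k i) * (1 - bary (t k) i (t l j)) = 0.
  have e1 := bary_vertex (nd k) i i; rewrite eqxx -{1}(bary_recover (nd l) (t k i)) in e1.
  rewrite bary_affine ?bary_sum// in e1.
  under eq_bigr do rewrite mulrBr mulr1.
  by rewrite sumrB bary_sum e1 subrr.
have nn j : 0 <= bary (t l) j (t k i) * (1 - bary (t k) i (t l j)).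
  have [jJ|jJ] := boolP (j \in J); last by rewrite mJ ?mul0r.
  by rewrite mulr_ge0// subr_ge0 fb.
have z j : bary (t l) j (t k i) * (1 - bary (t k) i (t l j)) = 0.
  by have /psumr_eq0P -> := s1.
have [j mj] : exists j, bary (t l) j (t k i) != 0.
  apply: contrapT => /forallNP h; have := bary_sum (t l) (t k i).
  rewrite big1 => [/eqP|j _]; first by rewrite eq_sym oner_eq0.
  by apply/eqP/negPn/negP; exact: h.
have jJ : j \in J by apply: contraNT mj => /mJ ->.
exists j => //; apply: (bary1_vertex (nd k)).
  by apply/(triangleP (nd k)); have /(faceP (nd k))[] := fJ j jJ.
by have /eqP := z j; rewrite mulf_eq0 (negbTE mj)/= subr_eq0 => /eqP.
Qed.

Lemma tri_meet k l : k != l -> exists I J : {set 'I_3},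
  [/\ I != [set: 'I_3]%SET, face (t k) I = face (t l) J &
   forall x, T k x -> T l x -> face (t k) I x].
Proof.
case: tri => _ _ /(_ k l) h /h [I [J [I1 J1 E1 E2]]]; exists I, J; split => //.
  by rewrite -E1.
by move=> x Tk Tl; rewrite -E1.
Qed.

(** By [face_vertex] the vertices of the common face belong to both triangles, and both affine
    functions take the values of a at them. *)
Lemma lin_conform k l a x : T k x -> T l x -> lin k a x = lin l a x.
Proof.
move=> Tk Tl; have [->//|kl] := eqVneq k l.
have [I [J [_ E h]]] := tri_meet kl.
have /(faceP (nd k))[b0 bI] := h x Tk Tl.
rewrite -[x in RHS](bary_recover (nd k)) lin_affine ?bary_sum//.
apply: eq_bigr => i _; have [iI|iI] := boolP (i \in I); last by rewrite bI// !mul0r.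
by have [j _ e] := face_vertex E iI; rewrite -e lin_vertex.
Qed.

Lemma vertex_in l j k : T k (t l j) -> exists i, t k i = t l j.
Proof.
move=> Tk; have [e|lk] := eqVneq l k; first by exists j; rewrite e.
have [I [J [_ E h]]] := tri_meet lk.
have /(faceP (nd l))[_ bI] := h _ (triangle_vertex (nd l) j) Tk.
have jI : j \in I.
  by apply/negPn/negP => /bI /eqP; rewrite (bary_vertex (nd l)) eqxx oner_eq0.
by have [i _ e] := face_vertex E jI; exists i.
Qed.

(** A proper common face omits a vertex, whose coordinate vanishes on it. *)
Lemma opent_disjoint k l x : opent (t k) x -> opent (t l) x -> k = l.
Proof.
move=> ok ol; apply/eqP/negPn/negP => kl; have [I [J [I1 E h]]] := tri_meet kl.
have /(faceP (nd k))[_ bI] := h x (opent_sub (nd k) ok) (opent_sub (nd l) ol).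
have [i iI] : exists i, i \notin I.
  apply: contrapT => /forallNP hI; move: I1 => /eqP; apply; apply/setP => i.
  by rewrite finset.in_setT; apply/negPn/negP; exact: hI.
by have := ok i; rewrite bI// ltxx.
Qed.

Variable S : R.
Hypothesis S1 : 1 <= S.
Hypothesis ft : forall k, fat S (t k).

Let S0 : 0 < S. Proof. exact: lt_le_trans S1. Qed.
Let S8 : 1 <= 8 * S.
Proof. by apply: le_trans S1 _; rewrite ler_peMl ?ler1n// ltW. Qed.

(** A second common point besides the vertex z forces a second common vertex, hence a common edge;
    its length is at least ['h_k / (8 * S)] and at most ['h_l]. *)
Lemma adjacent_diam k l i z y : t k i = z -> y != z -> T k y -> T l z -> T l y ->
  'h_k <= 8 * S * 'h_l.
Proof.
move=> e yz Tky Tlz Tly; have hk := diam_gt0 (nd k); have hl := diam_gt0 (nd l).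
have [->|kl] := eqVneq k l.
  by apply: ler_peMl; [exact: ltW|exact: S8].
have [I [J [_ E h]]] := tri_meet kl.
have Tkz : T k z by rewrite -e; exact: triangle_vertex (nd k) i.
have /(faceP (nd k))[_ bz] := h z Tkz Tlz.
have /(faceP (nd k))[_ by_] := h y Tky Tly.
have iI : i \in I.
  by apply/negPn/negP => /bz /eqP; rewrite -e (bary_vertex (nd k)) eqxx oner_eq0.
have [i' ii' i'I] : exists2 i', i' != i & i' \in I.
  apply: contrapT => H; move: yz => /eqP; apply; rewrite -e.
  apply: (bary1_vertex (nd k) Tky); rewrite -(bary_sum (t k) y) (bigD1 i)//= big1 ?addr0// => j ji.
  by apply: by_; apply/negP => jI; apply: H; exists j.
have [j _ ej] := face_vertex E iI; have [j' _ ej'] := face_vertex E i'I.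
apply: le_trans (edge_bound S0 (nd k) (ft k) (_ : i != i')) _; first by rewrite eq_sym.
rewrite ler_pM2l; last by rewrite mulr_gt0.
by rewrite -ej -ej'; exact: (le_diam (nd l) (triangle_vertex (nd l) j) (triangle_vertex (nd l) j')).
Qed.

(* The triangles at z contain disjoint squares whose side is comparable with the smallest of
   their diameters d, all within distance 2 d of z. *)
Lemma vertex_count z : #|[pred k | z \in T k]|%:R <= (16 * S) ^+ 2.
Proof.
have [k0 _|P0] := pickP [pred k | z \in T k]; last first.
  by rewrite (eq_card0 P0) mulr0n sqr_ge0.
pose d := \big[Num.min/'h_k0]_k 'h_k.
have d0 : 0 < d.
  rewrite /d; elim/big_ind: _ => [|u v u0 v0|k _]; [exact: (diam_gt0 (nd k0))| |exact: (diam_gt0 (nd k))].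
  by rewrite lt_min u0 v0.
have dk k : d <= 'h_k by exact: bigmin_le_cond.
(* When a triangle is shrunk to diameter d, its inscribed disc keeps a radius of at least d / (4 S);
   a square of half-side rho fits in, Euclidean length being at most twice the max norm. *)
pose rho := d / (8 * S).
have rho0 : 0 < rho by rewrite divr_gt0// mulr_gt0.
have rhod : rho <= d by rewrite ler_pdivrMr ?mulr_gt0//; apply: ler_peMr; [exact: ltW|exact: S8].
have /choice[p Hp] : forall k, exists p, z \in T k ->
    `|p - z| <= d /\ box (p - (rho, rho)) (p + (rho, rho)) `<=` T k.
  move=> k; have [zT|_] := boolP (z \in T k); last by exists z.
  rewrite inE in zT; have hk := diam_gt0 (nd k); have [c [r [r0 hc hr]]] := ft k.
  pose s := d / 'h_k; have s0 : 0 < s by rewrite divr_gt0.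
  have s1 : s <= 1 by rewrite ler_pdivrMr// mul1r.
  (* Image of the centre of the inscribed disc under the homothety of centre z and ratio s <= 1,
     which maps the triangle into itself by convexity. *)
  exists (z + s *: (c - z)) => _.
  have Tc : T k c by apply: hc; rewrite subrr /vnorm /dot /= !mul0r addr0 sqrtr0.
  split.
    rewrite addrAC subrr add0r normrZ gtr0_norm//.
    apply: (@le_trans _ _ (s * 'h_k)).
      by rewrite ler_pM2l//; apply: le_trans (norm_le_vnorm _) _; exact: (le_diam (nd k)).
    by rewrite /s divfK// gt_eqF.
  move=> x xB; have -> : x = z + s *: ((z + s^-1 *: (x - z)) - z).
    by rewrite addrAC subrr add0r scalerA divff ?gt_eqF// scale1r addrC subrK.
  apply: (triangle_convex (nd k)) => //; last exact: ltW.
  apply: hc; rewrite (_ : _ - c = s^-1 *: (x - (z + s *: (c - z)))); last first.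
    by apply: plane_eq; rewrite /= /GRing.scale/=; field; rewrite gt_eqF.
  rewrite vnormZ gtr0_norm ?invr_gt0// mulrC ltr_pdivrMr//.
  move: xB; set q := z + s *: (c - z); move=> [] /=; rewrite !in_itv/= => /andP[b1 b2] /andP[b3 b4].
  apply: le_lt_trans (vnorm_le_norm _) _.
  apply: (@lt_le_trans _ _ (2 * rho)).
    rewrite ltr_pM2l// prod_normE gt_max !ltr_norml /=.
    by apply/andP; split; apply/andP; split; lra.
  rewrite /rho /s mulrA ler_pdivrMr ?mulr_gt0//.
  rewrite (_ : r * (d / 'h_k) * (8 * S) = (2 * d) * ((4 * S * r) / 'h_k)); last by field; rewrite gt_eqF.
  by apply: ler_peMr; [rewrite mulr_ge0 ?ltW|rewrite ler_pdivlMr// mul1r].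
pose B k := box (p k - (rho, rho)) (p k + (rho, rho)).
pose P := [pred k | z \in T k].
have mB k : measurable (B k : set (mplane R)) by exact: box_measurable.
have muB k : mu2 R (B k) = ((2 * rho) ^+ 2)%:E.
  by rewrite mu2_box /=; [congr EFin; ring|lra|lra].
have tB : trivIset [set k | P k] B.
  have sub k : P k -> B k `<=` opent (t k).
    move=> Pk; rewrite -(interior_opent (nd k)) => x xB.
    apply: (@filterS _ (nbhs x) _ (B k)); first exact: (Hp k Pk).2.
    by apply: open_nbhs_nbhs; split => //; exact: box_open.
  by move=> k l Pk Pl [x [xk xl]]; exact: opent_disjoint (sub k Pk x xk) (sub l Pl x xl).
have sumB : (mu2 R (\big[setU/set0]_(k | P k) B k) = \sum_(k | P k) mu2 R (B k))%E.
  by apply: measure_bigsetU_ord_cond.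
have subB : \big[setU/set0]_(k | P k) B k `<=` box (z - (2 * d, 2 * d)) (z + (2 * d, 2 * d)).
  apply: (big_ind (fun X => X `<=` _)) => [//|X Y hX hY x [/hX|/hY]//|k Pk].
  move=> x [] /=; rewrite !in_itv/= => /andP[b1 b2] /andP[b3 b4].
  have := (Hp k Pk).1; rewrite prod_normE ge_max !ler_norml /= => /andP[/andP[c1 c2] /andP[c3 c4]].
  by split; rewrite /= in_itv/=; apply/andP; split; lra.
have mU : measurable (\big[setU/set0]_(k | P k) B k : set (mplane R)).
  by apply: bigsetU_measurable => k _; exact: mB.
have : (mu2 R (\big[setU/set0]_(k | P k) B k)
    <= mu2 R (box (z - (2 * d, 2 * d))%R (z + (2 * d, 2 * d))%R))%E.
  by apply: le_measure; rewrite ?inE//; exact: box_measurable.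
rewrite sumB mu2_box /=; [|lra|lra]; under eq_bigr do rewrite muB.
rewrite sumEFin lee_fin sumr_const -[leLHS]mulr_natl => H.
have {}H : #|P|%:R * (2 * rho) ^+ 2 <= (4 * d) ^+ 2.
  apply: le_trans H _; rewrite le_eqVlt; apply/orP; left; apply/eqP; ring.
rewrite -(ler_pM2r (exprn_gt0 2 (mulr_gt0 (ltr0Sn R 1) rho0))); apply: le_trans H _.
rewrite le_eqVlt; apply/orP; left; apply/eqP; rewrite /rho; field.
by rewrite gt_eqF.
Qed.

(** If both edges at the vertex were multiples of w they would be parallel, against
    nondegeneracy. *)
Lemma independent_edge k i w : exists2 j, j != i & forall c : R, t k j - t k i != c *: w.
Proof.
apply: contrapT => H.
have hc j : j != i -> exists c : R, t k j - t k i = c *: w.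
  by move=> ji; apply: contrapT => hn; apply: H; exists j => // c; apply/eqP => e; apply: hn; exists c.
have := hc (lift i 0); have := hc (lift i 1); rewrite ![_ == i]eq_sym !neq_lift.
move=> [//|c2 e2] [//|c1 e1].
have h1 : dot (gbary (t k) (lift i 0)) (t k (lift i 0) - t k i) = 1.
  by rewrite -bary_diff !(bary_vertex (nd k)) eqxx eq_sym (negbTE (neq_lift _ _)) subr0.
have h2 : dot (gbary (t k) (lift i 0)) (t k (lift i 1) - t k i) = 0.
  rewrite -bary_diff !(bary_vertex (nd k)) (inj_eq (@lift_inj _ i)).
  by rewrite [lift i 0 == i]eq_sym (negbTE (neq_lift _ _)) subr0.
rewrite e1 dotZ in h1; move: h2; rewrite e2 dotZ => /eqP; rewrite mulf_eq0 => /orP[/eqP c0|/eqP d0].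
  move: e2; rewrite c0 scale0r => /eqP; rewrite subr_eq0 => /eqP /(vertex_inj (nd k)) /eqP.
  by rewrite eq_sym (negbTE (neq_lift _ _)).
by move: h1; rewrite d0 mulr0 => /eqP; rewrite eq_sym oner_eq0.
Qed.

(** Here z is any point: a closed triangle that misses z misses a neighbourhood of it, and there are
    finitely many triangles. *)
Lemma near_vertex z : open D ->
  exists2 e, 0 < e & forall x, `|x - z| < e -> (D z -> D x) /\ forall j, T j x -> T j z.
Proof.
move=> oD.
have N1 : \forall x \near z, forall j, T j x -> T j z.
  apply: (@filter_forall _ _ (fun j x => T j x -> T j z) (nbhs z)) => j; have [Tz|nz] := pselect (T j z); first by apply: filterE.
  have : nbhs z (~` T j).
    by apply: open_nbhs_nbhs; split => //; exact: closed_openC (triangle_closed (nd j)).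
  by apply: filterS => x nx.
have N2 : nbhs z [set x | D z -> D x].
  have [Dz|nz] := pselect (D z); last by apply: filterE => x /= /nz.
  have : nbhs z D by apply: open_nbhs_nbhs.
  by apply: filterS => x Dx.
have /nbhs_plane[e e0 he] : nbhs z ([set x | D z -> D x] `&` [set x | forall j, T j x -> T j z]) by exact: filterI.
exists e => // x.
by rewrite prod_normE gt_max => /andP[h1 h2]; apply: he; split.
Qed.

(* Around z, the unions of the small and of the large triangles are closed and cover a punctured
   neighbourhood, so they meet on any segment joining them and avoiding z. *)
Lemma diam_step z k i l (tau : R) : open D -> D z -> t k i = z -> T l z ->
  'h_k <= tau -> tau < 'h_l -> exists k' l',
  [/\ T k' z, T l' z, 'h_k' <= tau, tau < 'h_l' & 'h_l' <= 8 * S * 'h_k'].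
Proof.
have Le (e a : R) : 0 < e -> 0 <= a -> e / (e + a + 1) * a < e.
  move=> e0 a0; rewrite mulrAC ltr_pdivrMr; [nra|lra].
have Ls (e a : R) : 0 < e -> 0 <= a -> e / (e + a + 1) <= 1.
  by move=> e0 a0; rewrite ler_pdivrMr; lra.
have Lp (e a : R) : 0 < e -> 0 <= a -> 0 < e / (e + a + 1).
  by move=> e0 a0; rewrite divr_gt0//; lra.
move=> oD Dz ez Tlz hk hl; have [e e0 he] := near_vertex z oD.
have [jl ejl] : exists j, t l j = z by rewrite -ez; apply: vertex_in; rewrite ez.
have [j' nj'] : exists j', j' != jl by exists (lift jl 0); rewrite eq_sym neq_lift.
pose w := t l j' - z.
have w0 : w != 0.
  rewrite subr_eq0 -ejl; apply: contra nj' => /eqP /(vertex_inj (nd l)) ->; exact: eqxx.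
have [j ji hj] := independent_edge k i w; rewrite ez in hj.
pose a := t k j - z.
have M0 : 0 <= `|a| + `|w| by rewrite addr_ge0.
(* Small enough for the segment to stay within e of z, and at most 1 so that its ends lie in T k and
   T l. *)
pose s := e / (e + (`|a| + `|w|) + 1).
have s0 : 0 < s := Lp _ _ e0 M0.
have s1 : s <= 1 := Ls _ _ e0 M0.
pose f r : plane R := (z + s *: a) + r *: (s *: (w - a)).
have fE r : f r = z + s *: ((1 - r) *: a + r *: w).
  by apply: plane_eq; rewrite /f /= /GRing.scale /=; ring.
have fe r : 0 <= r <= 1 -> `|f r - z| < e.
  move=> /andP[r0 r1]; rewrite fE addrAC subrr add0r normrZ (gtr0_norm s0).
  apply: le_lt_trans (Le _ _ e0 M0); apply: ler_wpM2l; first exact: ltW.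
  apply: le_trans (ler_normD _ _) _; rewrite !normrZ (ger0_norm r0) ger0_norm ?subr_ge0//.
  by apply: lerD; apply: (ler_piMl (normr_ge0 _)) => //; rewrite lerBlDr lerDl.
(* Neither is w zero nor a a multiple of w, so no convex combination of a and w vanishes. *)
have fz r : 0 <= r <= 1 -> f r != z.
  move=> /andP[r0 r1]; rewrite fE; apply/eqP => /eqP.
  rewrite -[X in _ == X]addr0 (inj_eq (addrI z)) scaler_eq0 (gt_eqF s0)/= => /eqP E.
  have [r1e|r1n] := eqVneq r 1.
    by move: E; rewrite r1e subrr scale0r add0r scale1r => /eqP; rewrite (negbTE w0).
  have /negP := hj (- (r / (1 - r))); apply; apply/eqP; rewrite -/a.
  have nr : 1 - r != 0 by rewrite subr_eq0 eq_sym.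
  move/eqP: E; rewrite addr_eq0 => /eqP E.
  by apply: (scalerI nr); rewrite E scalerA mulrN [(1 - r) * _]mulrC divfK// scaleNr.
have cf : continuous f.
  move=> r; apply: cvgD; first exact: cvg_cst.
  by apply: cvgZr_tmp; exact: cvg_id.
pose U := \bigcup_(j0 in [set j0 | 'h_j0 <= tau]) T j0.
pose V := \bigcup_(j0 in [set j0 | tau < 'h_j0]) T j0.
have cU : closed U by apply: closed_bigcup => [|j0 _]; [exact: finite_finset|exact: triangle_closed (nd j0)].
have cV : closed V by apply: closed_bigcup => [|j0 _]; [exact: finite_finset|exact: triangle_closed (nd j0)].
have Tkz : T k z by rewrite -ez; exact: (triangle_vertex (nd k)).
have U0 : U (f 0).
  exists k => //; rewrite /f scale0r addr0.
  apply: (triangle_convex (nd k)) => //; last exact: ltW.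
  exact: (triangle_vertex (nd k)).
have V1 : V (f 1).
  exists l => //; rewrite fE subrr scale0r add0r scale1r.
  apply: (triangle_convex (nd l)) => //; last exact: ltW.
  exact: (triangle_vertex (nd l)).
(* Otherwise the preimage of U would be nonempty, open and closed in [0, 1] without containing 1. *)
have [r [r01 Ur Vr]] : exists r, [/\ 0 <= r <= 1, U (f r) & V (f r)].
  apply: contrapT => /forallNP H.
  have B1 : `[0, 1]%classic `&` f @^-1` U = `[0, 1]%classic.
    apply: segment_connected.
    - by exists 0; split => //; rewrite /= in_itv/= lexx ler01.
    - exists (~` (f @^-1` V)); first by apply: closed_openC; apply: closed_comp => // *; exact: cf.
      apply/seteqP; split => x [xI]; rewrite /= in_itv/= in xI.
        by move=> Ux; split; [rewrite /= in_itv|move=> Vx; exact: (H x)].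
      move=> nV; split; first by rewrite /= in_itv.
      have [/(_ Dz) Dx _] := he _ (fe _ xI); have [j0 Tj0] := tri_cover (subset_closure Dx).
      have [h0|h0] := leP 'h_j0 tau; first by exists j0.
      by case: nV; exists j0.
    - by exists (f @^-1` U) => //; apply: closed_comp => // *; exact: cf.
  have : `[0, 1]%classic (1 : R) by rewrite /= in_itv/= lexx ler01.
  by rewrite -B1 => -[_ U1]; apply: (H 1); rewrite lexx ler01.
case: Ur => k' hk' Tk'; case: Vr => l' hl' Tl'; exists k', l'.
have Tk'z := (he _ (fe _ r01)).2 _ Tk'; have Tl'z := (he _ (fe _ r01)).2 _ Tl'.
split => //; have [i' ei'] : exists i', t l' i' = z by rewrite -ez; apply: vertex_in; rewrite ez.
exact: (adjacent_diam ei' (fz _ r01) Tl' Tk'z Tk').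
Qed.

(** The threshold is multiplied by 8 S repeatedly. As long as ['h_l] exceeds the next one,
    [diam_step] brings a further triangle at z below it, so more than j triangles lie below the j-th
    threshold; [vertex_count] forbids this once j reaches its bound. *)
Lemma comparable_diam z k i l : open D -> D z -> t k i = z -> T l z ->
  'h_l <= (8 * S) ^+ Num.bound ((16 * S) ^+ 2) * 'h_k.
Proof.
move=> oD Dz ez Tlz; set N := Num.bound _.
have hk0 := diam_gt0 (nd k); pose tau j := (8 * S) ^+ j * 'h_k.
have tauS j : tau j.+1 = 8 * S * tau j by rewrite /tau exprS mulrA.
have tau0 j : 0 < tau j by rewrite mulr_gt0// exprn_gt0// mulr_gt0.
have tauW j : tau j <= tau j.+1 by rewrite tauS; apply: ler_peMl; [exact: ltW|exact: S8].
have Tkz : T k z by rewrite -ez; exact: (triangle_vertex (nd k)).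
pose A j := [pred k' | (z \in T k') && ('h_k' <= tau j)].
have H j : 'h_l <= tau j \/ (j < #|A j|)%N.
  elim: j => [|j [IH|IH]].
  - right; apply/card_gt0P; exists k; rewrite inE /= mem_set//= /tau expr0 mul1r; exact: lexx.
  - by left; exact: le_trans (tauW j).
  have [hl|hl] := leP 'h_l (tau j.+1); [by left|right].
  have hkj : 'h_k <= tau j.
    by rewrite /tau; apply: ler_peMl; [exact: ltW|exact: exprn_ege1].
  have [k' [l' [Tk' Tl' h1 h2 h3]]] := diam_step oD Dz ez Tlz hkj (le_lt_trans (tauW j) hl).
  apply: leq_ltn_trans IH _; apply: proper_card; apply/properP; split.
    by apply/fintype.subsetP => x; rewrite !inE => /andP[-> h] /=; exact: le_trans (tauW j).
  exists l'; rewrite !inE (mem_set Tl')/=; last by rewrite -ltNge.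
  apply: le_trans h3 _; rewrite tauS ler_pM2l//; exact: mulr_gt0.
case: (H N) => // hN; exfalso.
have hb : (16 * S) ^+ 2 < N%:R by apply: archi_boundP; exact: sqr_ge0.
have : #|A N|%:R <= (16 * S) ^+ 2.
  apply: le_trans (vertex_count z); rewrite ler_nat; apply: subset_leq_card.
  by apply/fintype.subsetP => x /andP[h _]; exact: h.
by apply/negP; rewrite -ltNge; apply: lt_trans hb _; rewrite ltr_nat.
Qed.

End conformity.

(** * Lipschitz boundary *)

Section exterior.
Variable R : realType.
Implicit Types (x y z : plane R).

Lemma nbhs_norm_plane x (r : R) : 0 < r -> nbhs x [set y | `|y - x| < r].
Proof.
move=> r0; apply/nbhs_plane; exists r => // y [h1 h2].
by rewrite /= prod_normE gt_max; apply/andP.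
Qed.

Lemma box_norm x y (r : R) : `|x - y| < r -> box (y - (r, r)) (y + (r, r)) x.
Proof.
have H (a b : R) : `|a - b| < r -> b - r < a < b + r.
  by rewrite ltr_norml => /andP[h1 h2]; apply/andP; split; lra.
rewrite prod_normE gt_max => /andP[h1 h2].
by split; rewrite /= in_itv/=; exact: H.
Qed.

Lemma norm_box x y (r : R) : box (y - (r, r)) (y + (r, r)) x -> `|x - y| < r.
Proof.
have H (a b : R) : b - r < a < b + r -> `|a - b| < r.
  by move=> /andP[h1 h2]; rewrite ltr_norml; apply/andP; split; lra.
move=> []; rewrite /= !in_itv/= => h1 h2.
by rewrite prod_normE gt_max; apply/andP; split; exact: H.
Qed.

Lemma dot_le_norm x e : vnorm e = 1 -> `|dot x e| <= 2 * `|x|.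
Proof.
move=> e1; have a1 : `|e.1| <= 1 by rewrite -e1; exact: norm1_le_vnorm.
have a2 : `|e.2| <= 1 by rewrite -e1; exact: norm2_le_vnorm.
have x1 : `|x.1| <= `|x| by rewrite prod_normE le_max lexx.
have x2 : `|x.2| <= `|x| by rewrite prod_normE le_max lexx orbT.
apply: le_trans (ler_normD _ _) _; rewrite !normrM mulr_natl mulr2n.
by apply: lerD; rewrite -[leRHS]mulr1; apply: ler_pM.
Qed.

Variable D : set (plane R).
Hypotheses (oD : open D) (bD : bounded_set D) (lD : lipschitz_boundary D).

Lemma bdryP x : bdry D x <-> closure D x /\ ~ D x.
Proof. by rewrite /bdry (interior_id D).1. Qed.

(** Exterior cone property: going down by s along e2 from a point on or below the graph leaves free
    room proportional to s, since the graph descends by at most L times the horizontal displacement.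
    It holds for all z off D near x0, which is what a compactness argument can use. *)
Lemma ext_local x0 : bdry D x0 -> exists r : R, [/\ 0 < r, r <= 1/2 & forall z s, ~ D z -> `|z - x0| < r ->
  0 < s < r -> exists2 y, `|y - z| <= s & forall x, `|x - y| < r * s -> ~ D x].
Proof.
have arith (z2 h hx L a1 w2 r s : R) : 0 <= L -> 0 < s -> z2 <= h -> h - hx <= L * a1 ->
    a1 <= 2 * (r * s) -> w2 <= 2 * (r * s) -> 2 * (1 + L) * r <= 1 -> z2 - s + w2 <= hx.
  move=> L0 s0 h1 h2 h3 h4 h5.
  have h6 : L * a1 <= L * (2 * (r * s)) by rewrite ler_wpM2l.
  have h7 : 2 * (1 + L) * r * s <= s by apply: ler_piMl => //; exact: ltW.
  lra.
have arith2 (a b c e r s : R) : a < r * s -> b <= s -> c < r -> s < r -> 0 < s -> r <= 1/2 -> r <= e / 4 -> 0 < r ->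
    a + b + c < e.
  move=> h1 h2 h3 h4 h5 h6 h7 h8; have h9 : r * s <= s by apply: ler_piMl; lra.
  lra.
have arith3 (L : R) : 0 <= L -> (2 * (1 + L))^-1 <= 1/2.
  by move=> L0; rewrite -[1/2](_ : 2^-1 = _) ?lef_pV2 ?posrE; lra.
move=> /lD[e1 [e2 [h [L [e11 e22 e12 hL /nbhs_plane[e e0 he]]]]]].
have L0 : 0 <= L.
  by have := hL 1 0; rewrite subr0 normr1 mulr1; apply: le_trans.
have L1 : 0 < 2 * (1 + L) by rewrite mulr_gt0// ltr_pwDl.
(* A point of the ball of radius [r * s] deviates by at most [2 * (r * s)] along e1 and e2, so
   [2 * (1 + L) * r <= 1] keeps it below the graph; e / 4 keeps the whole construction in the
   chart. *)
pose r := Num.min (e / 4) (2 * (1 + L))^-1; exists r.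
have r0 : 0 < r by rewrite lt_min invr_gt0 L1 divr_gt0.
have r12 : r <= 1/2 by apply: le_trans (arith3 _ L0); rewrite ge_min lexx orbT.
split => // z s Dz zx0 /andP[s0 sr]; exists (z - s *: e2).
  rewrite addrAC subrr add0r normrN; apply: le_trans (norm_le_vnorm _) _.
  by rewrite vnormZ /vnorm e22 sqrtr1 mulr1 gtr0_norm.
move=> x xy; pose w := x - (z - s *: e2).
have xE : x = z - s *: e2 + w by rewrite /w addrC subrK.
have dE a : dot x a = dot z a - s * dot e2 a + dot w a.
  by rewrite xE /dot /= /GRing.scale /=; ring.
have near_e y : `|y - x0| < e -> D y <-> h (dot y e1) < dot y e2.
  by rewrite prod_normE gt_max => /andP[k1 k2]; apply: he.
have xe : `|x - x0| < e.
  have -> : x - x0 = w + (- (s *: e2)) + (z - x0).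
    by apply: plane_eq; rewrite xE /= /GRing.scale /=; ring.
  apply: le_lt_trans (ler_normD _ _) _.
  apply: (@le_lt_trans _ _ (`|w| + `|- (s *: e2)| + `|z - x0|)).
    by rewrite lerD2r ler_normD.
  apply: (arith2 _ _ _ _ r s) => //; last by rewrite ge_min lexx.
  rewrite normrN; apply: le_trans (norm_le_vnorm _) _.
  by rewrite vnormZ /vnorm e22 sqrtr1 mulr1 gtr0_norm.
have ze : `|z - x0| < e.
  by apply: lt_le_trans zx0 _; rewrite /r ge_min ler_pdivrMr// ler_peMr ?ler1n// ltW.
move=> /(near_e _ xe); apply/negP; rewrite -leNgt.
have hz : dot z e2 <= h (dot z e1) by rewrite leNgt; apply/negP => /(near_e _ ze).
have wrs : 2 * `|w| <= 2 * (r * s) by rewrite ler_pM2l// ltW.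
rewrite dE e22 mulr1.
apply: (arith _ (h (dot z e1)) _ L `|dot w e1| _ r s) => //.
- apply: le_trans (ler_norm _) _; apply: le_trans (hL _ _) _; rewrite dE.
  have -> : dot e2 e1 = 0 by rewrite -e12 /dot; ring.
  rewrite mulr0 subr0 opprD addrA subrr add0r normrN; exact: lexx.
- by apply: le_trans wrs; apply: dot_le_norm; rewrite /vnorm e11 sqrtr1.
- apply: le_trans wrs; apply: le_trans (ler_norm _) _.
  by apply: dot_le_norm; rewrite /vnorm e22 sqrtr1.
- rewrite -ler_pdivlMl// mulr1 /r ge_min lexx orbT; exact: isT.
Qed.

Lemma closure_norm : exists2 N : R, 0 < N & forall x, closure D x -> `|x| < N.
Proof.
have [N N0 hN] := bounded_set_norm bD; exists (N + 1); first by rewrite addr_gt0.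
move=> x /(_ _ (nbhs_norm_plane x ltr01))[w [/hN Dw wx]].
by rewrite -[x](subKr w); apply: le_lt_trans (ler_normB _ _) _; exact: ltrD.
Qed.

(** Compactness of the boundary makes the exterior squares uniform at small scales; all scales up to
    Hm are reached by shrinking H with a fixed factor. *)
Lemma ext_box (Hm : R) : 0 < Hm -> exists kap : R, [/\ 0 < kap, kap <= 1/2 &
  forall z H, bdry D z -> 0 < H <= Hm -> exists2 y, `|y - z| <= H / 2 &
  forall x, `|x - y| < kap * H -> ~ D x].
Proof.
have arith (H d : R) : 0 < H -> H <= Hm -> 0 < d -> H * (d / (2 * Hm)) < d.
  move=> h0 h1 d0; rewrite mulrCA -[ltRHS]mulr1 ltr_pM2l// ltr_pdivrMr; lra.
move=> Hm0; have cK : compact (bdry D).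
  have [N N0 hN] := closure_norm.
  have cb : closed (bdry D).
    rewrite /bdry setDE; apply: closedI; first exact: closed_closure.
    by apply: open_closedC; exact: open_interior.
  pose B := [set x : plane R | `|x| < N]; apply: (closed_bounded_compact cb (E := B)).
    by move=> x [/hN].
  by exists N; split; [exact: num_real|move=> M NM x xB; exact: ltW (lt_trans xB NM)].
(* The unknown radius of [ext_local] is replaced by [hn n], so that the near-covering form of
   compactness applies with the filter at infinity. *)
pose P n z := bdry D z -> forall s, 0 < s < hn n -> exists2 y, `|y - z| <= s &
  forall x, `|x - y| < hn n * s -> ~ D x.
have : \forall n \near \oo, bdry D `<=` P n.
  move/compact_near_coveringP: cK; apply => x0 /ext_local[r [r0 _ hr]].
  exists ([set z | `|z - x0| < r], [set n | hn n < r]).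
    by split; [exact: nbhs_norm_plane|exact: hn_small].
  move=> [z n] [/= zr nr] /bdryP[_ nz] s /andP[s0 sn].
  have [|y yz hy] := hr z s nz zr; first by rewrite s0 (lt_trans sn).
  exists y => // x xy; apply: hy; apply: lt_trans xy _.
  by rewrite ltr_pM2r.
move=> [n _ /(_ n (leqnn n)) hn_]; have n0 := hn_gt0 R n.
(* With this factor [H * s] is at most [H / 2] and below the range [hn n], for every H <= Hm. *)
pose s := Num.min (1/2) (hn n / (2 * Hm)); have s0 : 0 < s by rewrite lt_min !divr_gt0// mulr_gt0.
exists (hn n * s); split; first exact: mulr_gt0.
  apply: (@le_trans _ _ s); last by rewrite /s ge_min lexx.
  apply: ler_piMl; first exact: ltW.
  by rewrite /hn invf_le1// ?ler1n.
move=> z H bz /andP[H0 Hle].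
have [|y yz hy] := hn_ z bz bz (H * s).
  rewrite mulr_gt0//=; apply: le_lt_trans (arith H _ H0 Hle n0).
  by rewrite ler_pM2l// /s ge_min lexx orbT.
exists y; last by move=> x xy; apply: hy; rewrite mulrCA mulrC.
by apply: le_trans yz _; rewrite ler_pM2l// /s ge_min [1/2]mul1r lexx.
Qed.

(** Arbitrarily close to a boundary point there are balls outside D, so such a point is not interior
    to the closure; a slit would violate this. *)
Lemma interior_closure_sub : (closure D)° `<=` D.
Proof.
move=> x xi; apply: contrapT => nx.
have bx : bdry D x by apply/bdryP; split => //; exact: interior_subset xi.
have [r [r0 _ hr]] := ext_local bx.
have /nbhs_plane[e e0 he] : nbhs x (closure D) by [].
pose s := Num.min r e / 2; have m0 : 0 < Num.min r e by rewrite lt_min r0 e0.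
have s0 : 0 < s by rewrite divr_gt0.
have sm : s < Num.min r e by rewrite /s ltr_pdivrMr// ltr_pMr// ltr1n.
have [||y yx hy] := hr x s nx.
- by rewrite subrr normr0.
- by rewrite s0 (lt_le_trans sm)// ge_min lexx.
have cy : closure D y.
  have : `|y - x| < e by apply: le_lt_trans yx (lt_le_trans sm _); rewrite ge_min lexx orbT.
  by rewrite prod_normE gt_max => /andP[h1 h2]; apply: he.
have [w [Dw wy]] := cy _ (nbhs_norm_plane y (mulr_gt0 r0 s0)).
exact: hy wy Dw.
Qed.

Definition energy psi : R :=
  nsq (mu2 R) D (fun x => (grad psi x).1) + nsq (mu2 R) D (fun x => (grad psi x).2).

Local Notation Q z H := (box (z - (2 * H, 2 * H)) (z + (2 * H, 2 * H))).

Lemma nsq_test_le psi (B : set (plane R)) : open B -> test_function D psi ->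
  nsq (mu2 R) B psi <= nsq (mu2 R) D psi.
Proof.
move=> oB tp; have -> : nsq (mu2 R) D psi = nsq (mu2 R) setT psi.
  by rewrite /nsq Rintegral_supp// => x Dx; rewrite (test_supp tp Dx) expr0n.
by apply: nsqS; [exact: measurableT|exact: open_mplane| |exact: (test_sqint openT tp)].
Qed.

Lemma energy_box psi (B : set (plane R)) : open B -> test_function D psi ->
  nsq (mu2 R) B (fun x => (grad psi x).1) + nsq (mu2 R) B (fun x => (grad psi x).2)
  <= energy psi.
Proof.
move=> oB tp.
by apply: lerD; apply: nsq_test_le => //; exact: test_derive.
Qed.

Lemma energy_ge0 psi : 0 <= energy psi.
Proof. by apply: addr_ge0; exact: nsq_ge0. Qed.

(** This is [poincare_box] on the square of side 4 H centred at z, which may leave D: the energy on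
    it is still at most that on D because psi vanishes outside. *)
Let poincare_Q psi z (H i c K : R) : test_function D psi -> 0 < H -> 0 < c -> energy psi < K ->
  z.1 - 2 * H <= i -> i + c * (4 * H) <= z.1 + 2 * H -> exists2 y1, i < y1 < i + c * (4 * H) &
  forall y2 : R, z.2 - 2 * H < y2 < z.2 + 2 * H ->
  nsq (mu2 R) (Q z H) (fun x => psi x - psi (y1, y2)) <= 32 * H ^+ 2 * (1 + c^-1) * K.
Proof.
move=> tp H0 c0 EK h1 h2.
pose a := z - (2 * H, 2 * H).
have e1 : z + (2 * H, 2 * H) = (a.1 + 4 * H, a.2 + 4 * H).
  by apply: plane_eq; rewrite /a /=; ring.
have e2 : z.2 + 2 * H = a.2 + 4 * H by rewrite /a /=; ring.
have e3 : 32 * H ^+ 2 = 2 * (4 * H) ^+ 2 by ring.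
have H4 : 0 < 4 * H by rewrite mulr_gt0.
have tT : test_function setT psi by exact: test_sub tp.
have h2' : i + c * (4 * H) <= a.1 + 4 * H.
  by apply: le_trans h2 _; rewrite le_eqVlt; apply/orP; left; apply/eqP; rewrite /a /=; ring.
have EK' := le_lt_trans (energy_box (@box_open R a (a.1 + 4 * H, a.2 + 4 * H)) tp) EK.
have [y1 hy1 hn_] := @poincare_box R psi a (4 * H) i c K tT H4 c0 h1 h2' EK'.
exists y1 => // y2 hy2; rewrite e1 e3 -/a; apply: hn_.
by rewrite -e2.
Qed.

Lemma poincare_local psi z (H K : R) : test_function D psi -> 0 < H -> energy psi < K ->
  exists a, nsq (mu2 R) (Q z H) (fun x => psi x - a) <= 64 * H ^+ 2 * K.
Proof.
have a1 (u : R) : u - 2 * H + 1 * (4 * H) <= u + 2 * H by lra.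
have a2 (u : R) : 0 < H -> u - 2 * H < u < u + 2 * H by move=> h; apply/andP; split; lra.
have a3 : 64 * H ^+ 2 * K = 32 * H ^+ 2 * (1 + 1^-1) * K by rewrite invr1; ring.
move=> tp H0 EK; have [y1 _ hy] := poincare_Q tp H0 ltr01 EK (lexx _) (a1 z.1).
by exists (psi (y1, z.2)); rewrite a3; apply: hy; exact: a2.
Qed.

(** The abscissa is sought in the strip of width 2 rho around that of y, a fraction rho / (2 H) of
    the side 4 H; at the height of y the reference point then falls in the ball outside D, where psi
    is 0. *)
Lemma friedrichs_local psi z y (H rho K : R) : test_function D psi -> 0 < H -> energy psi < K ->
  0 < rho -> `|y - z| + rho <= 2 * H -> (forall x, `|x - y| < rho -> ~ D x) ->
  nsq (mu2 R) (Q z H) psi <= 32 * H ^+ 2 * (1 + (rho / (2 * H))^-1) * K.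
Proof.
have a1 (u v : R) : `|v - u| + rho <= 2 * H -> u - 2 * H <= v - rho.
  by rewrite -lerBrDr ler_norml => /andP[h1 h2]; lra.
have a2 (u v : R) : `|v - u| + rho <= 2 * H -> v - rho + 2 * rho <= u + 2 * H.
  by rewrite -lerBrDr ler_norml => /andP[h1 h2]; lra.
have a3 (u v : R) : 0 < rho -> `|v - u| + rho <= 2 * H -> u - 2 * H < v < u + 2 * H.
  by move=> r0; rewrite -lerBrDr ler_norml => /andP[h1 h2]; apply/andP; split; lra.
have a4 (u v : R) : v - rho < u < v - rho + 2 * rho -> `|u - v| < rho.
  by move=> /andP[h1 h2]; rewrite ltr_norml; apply/andP; split; lra.
have cE : 0 < H -> rho / (2 * H) * (4 * H) = 2 * rho.
  by move=> H0; field; rewrite gt_eqF.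
move=> tp H0 EK r0 yz hy.
have c0 : 0 < rho / (2 * H) by rewrite divr_gt0// mulr_gt0.
have y1z : `|y.1 - z.1| + rho <= 2 * H.
  by apply: le_trans yz; rewrite lerD2r prod_normE le_max lexx.
have y2z : `|y.2 - z.2| + rho <= 2 * H.
  by apply: le_trans yz; rewrite lerD2r prod_normE le_max lexx orbT.
have h1 := a1 _ _ y1z; have h2 := a2 _ _ y1z; rewrite -(cE H0) in h2.
have [y1 hy1 hn_] := poincare_Q tp H0 c0 EK h1 h2.
have := hn_ y.2 (a3 _ _ r0 y2z).
rewrite (test_supp tp (x := (y1, y.2))); last first.
  apply: hy; rewrite prod_normE gt_max /= subrr normr0 r0 andbT.
  by rewrite cE// in hy1; exact: a4.
by under [X in X <= _]eq_Rintegral do rewrite subr0.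
Qed.

(** The exterior square given by [ext_box] at x0 still fits in the square around z, as H + H/2 + kap
    H <= 2 H. The lower bound 64 lets the constant also dominate the one of [poincare_local]. *)
Lemma friedrichs_bdry (Hm : R) : 0 < Hm -> exists2 C : R, 64 <= C & forall psi z x0 (H K : R),
  test_function D psi -> energy psi < K -> 0 < H <= Hm -> bdry D x0 -> `|x0 - z| <= H ->
  nsq (mu2 R) (Q z H) psi <= C * H ^+ 2 * K.
Proof.
have a1 (kap H a b : R) : kap <= 1/2 -> 0 < H -> a <= H / 2 -> b <= H -> a + b + kap * H <= 2 * H.
  move=> h1 h2 h3 h4; have : kap * H <= 1/2 * H by rewrite ler_pM2r.
  lra.
have a2 (kap H K : R) : 0 < kap -> 0 < H -> 32 * H ^+ 2 * (1 + (kap * H / (2 * H))^-1) * K =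
    32 * (1 + 2 / kap) * H ^+ 2 * K.
  by move=> k0 H0; field; rewrite !gt_eqF.
have a3 (kap : R) : 0 < kap -> kap <= 1/2 -> 64 <= 32 * (1 + 2 / kap).
  by move=> h1 h2; have : 1 <= 2 / kap by [rewrite ler_pdivlMr//; lra]; lra.
move=> Hm0; have [kap [k0 k1 hk]] := ext_box Hm0.
exists (32 * (1 + 2 / kap)); first exact: a3.
move=> psi z x0 H K tp EK /andP[H0 HH] bx x0z.
have [|y yx hy] := hk x0 H bx; first by rewrite H0.
rewrite -a2//; apply: friedrichs_local hy => //; first exact: mulr_gt0.
apply: le_trans (a1 kap H _ _ k1 H0 yx x0z); rewrite lerD2r.
by rewrite -[y - z](subrKA x0); exact: ler_normD.
Qed.

Lemma friedrichs : exists2 C : R, 0 < C & forall psi (K : R), test_function D psi ->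
  energy psi < K -> nsq (mu2 R) D psi <= C * K.
Proof.
have a1 (N : R) : 0 < N -> 3 * N + N <= 2 * (2 * N) by move=> ?; lra.
have a0 (N : R) : 0 < N -> N <= 2 * (2 * N) by move=> ?; lra.
have a2 (N u : R) : u + 3 * N < N -> u < N -> - N < u -> 0 < N -> False by move=> *; lra.
have [N N0 hN] := bounded_set_norm bD.
have N2 : 0 < 2 * N by rewrite mulr_gt0.
(* The max-norm ball of radius N around y misses D, which lies within N of the origin, and both lie
   in the square of half-side 4 N. *)
pose y : plane R := (- (3 * N), 0).
have yN : `|y - 0| = 3 * N.
  rewrite subr0 prod_normE /= normr0 normrN gtr0_norm ?mulr_gt0//.
  by apply/max_idPl; rewrite mulr_ge0// ltW.
exists (32 * (2 * N) ^+ 2 * (1 + (N / (2 * (2 * N)))^-1)).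
  by rewrite mulr_gt0// ?mulr_gt0 ?exprn_gt0// addr_gt0// invr_gt0 divr_gt0// mulr_gt0.
move=> psi K tp EK; apply: le_trans (friedrichs_local (z := 0) (y := y) tp N2 EK N0 _ _); last 2 first.
- by rewrite yN; exact: a1.
- move=> x xy Dx; have xN := hN _ Dx; move: xy xN; rewrite !prod_normE !gt_max /= opprK.
  move=> /andP[]; rewrite ltr_norml => /andP[_ h1] _ /andP[]; rewrite ltr_norml => /andP[h2 h3] _.
  exact: (a2 N x.1).
apply: nsqS; [exact: open_mplane (@box_open R _ _)|exact: open_mplane| |exact: (test_sqint (@box_open R _ _) tp)].
move=> x /hN xN; apply: box_norm; rewrite subr0; apply: lt_le_trans xN _.
exact: a0.
Qed.

End exterior.

(** * Interpolation *)

Section interpolant.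
Variable R : realType.
Implicit Types (x y z : plane R).

Lemma dot_le1 s x : `|dot s x| <= (`|s.1| + `|s.2|) * `|x|.
Proof.
apply: le_trans (ler_normD _ _) _; rewrite !normrM mulrDl.
by apply: lerD; apply: ler_wpM2l => //; rewrite prod_normE le_max lexx ?orbT.
Qed.

(* Along the segment from x to y, the set of r at which the bound holds up to x + r (y - x) is
   closed and open to the right. *)
Lemma local_lipschitz L (v : plane R -> R) : 0 <= L ->
  (forall x, exists2 e, 0 < e & forall y, `|y - x| < e -> `|v y - v x| <= L * `|y - x|) ->
  lipschitz_plane L v.
Proof.
have Ls (e a : R) : 0 < e -> 0 <= a -> e / (e + a + 1) * a < e.
  move=> e0 a0; rewrite mulrAC ltr_pdivrMr; [nra|lra].
have Lp (e a : R) : 0 < e -> 0 <= a -> 0 < e / (e + a + 1).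
  by move=> e0 a0; rewrite divr_gt0//; lra.
have h1 (c r d : R) : c - d < r -> r <= c -> 0 <= c - r <= d.
  by move=> ? ?; apply/andP; split; lra.
have h2 (p q L0 r c w : R) : p <= L0 * ((c - r) * w) -> q <= L0 * (r * w) -> p + q <= L0 * (c * w).
  by move=> ? ?; lra.
have h3 (c d : R) : 0 < d -> c < 1 -> 0 <= Num.min 1 (c + d) - c <= d /\ c < Num.min 1 (c + d).
  by move=> ? ?; rewrite /Num.min; case: ifPn => [|/negP]; lra.
move=> L0 hloc y x; pose w := y - x.
pose A := [set r : R | 0 <= r <= 1 /\ `|v (x + r *: w) - v x| <= L * (r * `|w|)].
have A0 : A 0 by split; rewrite ?lexx ?ler01// scale0r addr0 subrr normr0 mul0r mulr0.
have hA : has_sup A by split; [exists 0|exists 1 => r [/andP[]]].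
pose c := sup A; have c01 : 0 <= c <= 1.
  apply/andP; split; first exact: ub_le_sup hA.2 _ A0.
  by apply: ge_sup; [exists 0|move=> r [/andP[]]].
have [e e0 he] := hloc (x + c *: w); pose d := e / (e + `|w| + 1).
have d0 : 0 < d := Lp _ _ e0 (normr_ge0 w).
have close r r' : 0 <= r - r' <= d -> `|x + r *: w - (x + r' *: w)| = (r - r') * `|w| /\ (r - r') * `|w| < e.
  move=> /andP[k1 k2]; split.
    rewrite (_ : _ - _ = (r - r') *: w) ?normrZ ?ger0_norm//.
    by apply: plane_eq; rewrite /= /GRing.scale /=; ring.
  by apply: le_lt_trans (Ls _ _ e0 (normr_ge0 w)); exact: ler_wpM2r.
have Ac : A c.
  have [r Ar cr] := sup_adherent d0 hA; have rc : r <= c by exact: ub_le_sup hA.2 _ Ar.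
  split => //; have [k1 k2] := close c r (h1 _ _ _ cr rc); have [_ vr] := Ar.
  rewrite -[v _ - v x](subrKA (v (x + r *: w))); apply: le_trans (ler_normD _ _) _.
  apply: h2 vr; rewrite -k1 distrC [X in _ <= _ * X]distrC; apply: he.
  by rewrite distrC k1.
have c1 : c = 1.
  apply/eqP; rewrite eq_le (andP c01).2 /= leNgt; apply/negP => c1.
  have [k0 ck] := h3 c d d0 c1; set r := Num.min 1 (c + d) in k0 ck.
  suff Ar : A r by have := ub_le_sup hA.2 Ar; rewrite leNgt ck.
  split; first by rewrite (le_trans (andP c01).1 (ltW ck)) /r ge_min lexx.
  have [k1 k2] := close r c k0.
  rewrite -[v _ - v x](subrKA (v (x + c *: w))); apply: le_trans (ler_normD _ _) _.
  by apply: h2 Ac.2; rewrite -k1; apply: he; rewrite k1.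
have [_] := Ac; rewrite c1 scale1r mul1r /w [x + _]addrC subrK; exact.
Qed.

Lemma ae_forall_ord m (P : 'I_m -> plane R -> Prop) :
  (forall k, {ae mu2 R, forall x, P k x}) -> {ae mu2 R, forall x, forall k, P k x}.
Proof.
move=> aP; apply: (ae_imp (P := fun x => forall n k, val k = n -> P k x)).
  by move=> x h k; exact: (h _ k erefl).
apply: ae_forall_nat => n; have [nm|mn] := ltnP n m.
  apply: ae_imp (aP (Ordinal nm)) => x h k kn; suff -> : k = Ordinal nm by [].
  exact: val_inj.
by apply: ae_all => x k kn; move: mn; rewrite -kn leqNgt ltn_ord.
Qed.

Variables (D : set (plane R)) (m : nat) (t : 'I_m -> 'I_3 -> plane R).
Hypotheses (oD : open D) (bD : bounded_set D) (lD : lipschitz_boundary D).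
Hypothesis tri : triangulation D t.
Implicit Types (k l : 'I_m) (i : 'I_3).

Local Notation T k := (triangle (t k)).
Local Notation nd := (tri_nondeg tri).

Lemma opent_D k : opent (t k) `<=` D.
Proof.
rewrite -(interior_opent (nd k)) => x xk; apply: (interior_closure_sub oD lD).
by apply: filterS xk; exact: tri_sub tri k.
Qed.

Lemma ae_bary_neq0 : {ae mu2 R, forall x, forall k i, bary (t k) i x != 0}.
Proof.
have L (p q r : R) : p + (q - r) = 0 -> q = r - p by lra.
apply: ae_forall_ord => k; apply: ae_forall_ord => i.
apply: ae_imp (ae_notin_line (dot (gbary (t k) i) (t k 0) - (i == 0)%:R) (gbary_neq0 (nd k) i)).
by move=> x; apply: contra => /eqP h; apply/eqP; apply: L; rewrite -dotB.
Qed.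

Lemma ae_opent : {ae mu2 R, forall x, D x -> exists k, opent (t k) x}.
Proof.
apply: ae_imp ae_bary_neq0 => x h Dx.
have [k Tk] := tri_cover tri (subset_closure Dx); exists k => i.
by rewrite lt_neqAle eq_sym h; exact: (triangleP (nd k) x).1.
Qed.

Variable a : plane R -> R.
(** Homogeneous boundary condition, term by term: a nodal value is 0 as soon as its barycentric
    coordinate is nonzero at a point of the triangle off D. *)
Hypothesis a0 : forall k i x, T k x -> ~ D x -> bary (t k) i x * a (t k i) = 0.

Definition slope k : plane R := \sum_i a (t k i) *: gbary (t k) i.

(** All triangles containing x give the same value, by conformity. The extension by 0 makes it a
    function on the plane, as [H10_of_lipschitz] requires. *)
Definition interp x : R := if [pick k | `[< T k x >]] is Some k then lin t k a x else 0.

Lemma lin_diff k x y : lin t k a x - lin t k a y = dot (slope k) (x - y).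
Proof.
rewrite /lin /slope -sumrB sum3 [in RHS]sum3.
rewrite -!mulrBl !bary_diff /dot /= /GRing.scale /=; ring.
Qed.

Lemma interpE k x : T k x -> interp x = lin t k a x.
Proof.
rewrite /interp => Tk; case: pickP => [l /asboolP Tl|/(_ k)/asboolP//].
exact: (lin_conform tri _ Tl Tk).
Qed.

Lemma interp_out x : (forall k, ~ T k x) -> interp x = 0.
Proof. by rewrite /interp; case: pickP => // k /asboolP Tk /(_ k). Qed.

Lemma interp0 x : ~ D x -> interp x = 0.
Proof.
move=> nx; have [[k Tk]|/forallNP h] := pselect (exists k, T k x); last exact: interp_out.
by rewrite (interpE Tk) /lin big1// => i _; exact: a0.
Qed.

Lemma interp_linear k : linear_on (T k) interp.
Proof. by exists (slope k) => x y Tx Ty; rewrite (interpE Tx) (interpE Ty) lin_diff. Qed.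

Definition slope_bound : R := 1 + \sum_k (`|(slope k).1| + `|(slope k).2|).

Lemma slope_le k : `|(slope k).1| + `|(slope k).2| <= slope_bound.
Proof.
rewrite /slope_bound (bigD1 k)//= addrCA lerDl addr_ge0// sumr_ge0//.
Qed.

Lemma slope_bound_gt0 : 0 < slope_bound.
Proof. by rewrite ltr_pwDl// sumr_ge0// => l _; exact: addr_ge0. Qed.

(** A point y near x lies only in triangles that contain x, so both values come from one affine
    function. If y lies in no triangle, then x is off D and both values are 0. The local bound is
    made global by [local_lipschitz]. *)
Lemma interp_lipschitz : lipschitz_plane slope_bound interp.
Proof.
apply: local_lipschitz => [|x]; first exact: ltW slope_bound_gt0.
have [e e0 he] := near_vertex tri x oD; exists e => // y /he[hD hT].
have [[k Tk]|/forallNP h] := pselect (exists k, T k y).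
  rewrite (interpE Tk) (interpE (hT _ Tk)) lin_diff; apply: le_trans (dot_le1 _ _) _.
  by apply: ler_wpM2r => //; exact: slope_le.
rewrite (interp_out h); have [Dx|nx] := pselect (D x).
  by have [k /h] := tri_cover tri (subset_closure (hD Dx)).
by rewrite (interp0 nx) subrr normr0 mulr_ge0// ltW// slope_bound_gt0.
Qed.

Definition grad_interp x : plane R :=
  (\sum_k \1_(opent (t k)) x * (slope k).1, \sum_k \1_(opent (t k)) x * (slope k).2).

Lemma grad_interpE k x : opent (t k) x -> grad_interp x = slope k.
Proof.
move=> ok; have H l : l != k -> \1_(opent (t l)) x = 0 :> R.
  move=> lk; rewrite indicE memNset// => ol; move/eqP: lk; apply.
  exact: (opent_disjoint tri ol ok).
by apply: plane_eq; rewrite /= (bigD1 k)//= indicE mem_set// mul1r big1 ?addr0// => l /H ->; rewrite mul0r.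
Qed.

Lemma interp_H10 : H10 D interp /\
  {ae mu2 R, forall x, forall k, opent (t k) x -> wgrad D interp x = slope k}.
Proof.
have mG (c : 'I_m -> R) : measurable_fun setT
    ((fun x => \sum_k \1_(opent (t k)) x * c k) : mplane R -> R).
  apply: measurable_sum => k; apply: measurable_funM => //.
  by apply: measurable_indic; apply: open_mplane; exact: opent_open.
have bG (c : 'I_m -> R) x : (forall k, `|c k| <= `|(slope k).1| + `|(slope k).2|) ->
    `|\sum_k \1_(opent (t k)) x * c k| <= slope_bound.
  move=> hc; apply: le_trans (ler_norm_sum _ _ _) _; apply: ler_wpDl => //.
  apply: ler_sum => k _; rewrite normrM; apply: le_trans (hc k).
  by apply: ler_piMl => //; rewrite indicE; case: (_ \in _); rewrite ?normr1 ?normr0.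
have [] := @H10_of_lipschitz R D oD bD interp grad_interp slope_bound slope_bound
  slope_bound_gt0 interp_lipschitz interp0 (mG _) (mG _).
- by move=> x; apply: bG => k; rewrite lerDl.
- by move=> x; apply: bG => k; rewrite lerDr.
(* The zero lines of the nonconstant affine pieces are discarded, which leaves the alternative
   demanded by [H10_of_lipschitz]. *)
- have aeN : {ae mu2 R, forall x, forall k, slope k != 0 -> lin t k a x != 0}.
    apply: ae_forall_ord => k; have [e|nk] := eqVneq (slope k) 0; first by apply: ae_all.
    apply: ae_imp (ae_notin_line (- lin t k a 0) nk) => x h _; apply: contra h => /eqP e.
    by rewrite -[x]subr0 -lin_diff e sub0r.
  apply: ae_imp (ae_and ae_bary_neq0 aeN) => x [hb hl].
  have [e e0 he] := near_vertex tri x oD.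
  have [[k Tk]|/forallNP h] := pselect (exists k, T k x).
    have ok : opent (t k) x.
      by move=> i; rewrite lt_neqAle eq_sym hb; exact: (triangleP (nd k) x).1.
    have /nbhs_plane[d d0 hd] : nbhs x (opent (t k)).
      by apply: open_nbhs_nbhs; split => //; exact: opent_open.
    have {}hd z : `|z - x| < d -> opent (t k) z.
      by rewrite prod_normE gt_max => /andP[? ?]; apply: hd.
    exists d => //; split => [z z' /hd/opent_sub oz /hd/opent_sub oz'|].
      by rewrite (interpE (oz (nd k))) (interpE (oz' (nd k))) (grad_interpE ok) lin_diff.
    rewrite (grad_interpE ok) (interpE Tk); have [->|/hl] := eqVneq (slope k) 0; [by right|by left].
  exists e => //; split => [z z' /he[_ hz] /he[_ hz']|].
    rewrite !interp_out => [|k /hz'/h//|k /hz/h//]; rewrite subrr.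
    rewrite /grad_interp /dot /= !big1 ?mul0r ?addr0// => k _;
      by rewrite indicE memNset ?mul0r// => /(opent_sub (nd k))/h.
  right; apply: plane_eq; rewrite /= big1// => k _;
    by rewrite indicE memNset ?mul0r// => /(opent_sub (nd k))/h.
move=> hH hG; split => //; apply: ae_imp hG => x hx k ok.
by rewrite hx ?(grad_interpE ok)//; exact: opent_D ok.
Qed.

Lemma interp_Sh0 : Sh0 D t interp.
Proof.
by have [h _] := interp_H10; split; [split; [exact: h.1|exact: interp_linear]|exact: h].
Qed.

End interpolant.

(** * Error of the interpolant on each triangle *)

Section interpolation.
Variable R : realType.
Implicit Types (x y z : plane R).
Local Notation mu := (mu2 R).
Local Notation Q z H := (box (z - (2 * H, 2 * H)) (z + (2 * H, 2 * H))).

Lemma sqint_shift (B E : set (plane R)) psi (c : R) : open B -> bounded_set B -> test_function E psi ->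
  sqint mu B (fun x => psi x - c).
Proof.
move=> oB bB tp; have mB := open_mplane oB.
apply: (sqintB mB (test_sqint oB tp)); apply: (@sqint_bounded _ _ _ _ _ _ `|c| mB).
- exact: bounded_finite.
- exact: measurable_cst.
- by move=> x _; exact: lexx.
Qed.

Lemma bounded_subset (A B : set (plane R)) : A `<=` B -> bounded_set B -> bounded_set A.
Proof.
move=> AB /bounded_set_norm[N N0 hN]; exists N; split; first exact: num_real.
by move=> M NM x /AB/hN xN; exact: ltW (lt_trans xN NM).
Qed.

Lemma bounded_Q z (H : R) : bounded_set (Q z H).
Proof.
exists (2 * H + `|z|); split; first exact: num_real.
move=> M HM x /norm_box xz; apply: ltW; apply: lt_trans HM.
by rewrite -[x](subrK z); apply: le_lt_trans (ler_normD _ _) _; rewrite ltrD2r.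
Qed.

Variable D : set (plane R).
Hypotheses (oD : open D) (bD : bounded_set D) (lD : lipschitz_boundary D).
Variable S : R.
Hypothesis S1 : 1 <= S.

Lemma nrm_le_sqrt (B : set (plane R)) (f : plane R -> R) (C h K : R) : 0 <= h -> 0 <= C ->
  nsq mu B f <= C * h ^+ 2 * K -> nrm mu B f <= Num.sqrt C * h * Num.sqrt K.
Proof.
move=> h0 C0 H; rewrite /nrm; apply: le_trans (ler_wsqrtr H) _.
by rewrite sqrtrM ?mulr_ge0// ?sqr_ge0// sqrtrM// sqrtr_sqr ger0_norm.
Qed.

(** A nodal value is compared with psi on a square containing the triangle, by Poincare's
    inequality, or by Friedrichs' when the value is 0. The constant combines the larger of the two
    constants with the ratio c between the side of the square and the diameter of the triangle. *)
Lemma nodal_estimate : exists2 C : R, 0 < C & forall m (t : 'I_m -> 'I_3 -> plane R),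
  triangulation D t -> (forall k, fat S (t k)) ->
  forall psi (K : R), test_function D psi -> energy D psi < K ->
  exists a : plane R -> R,
    (forall k i x, triangle (t k) x -> ~ D x -> bary (t k) i x * a (t k i) = 0) /\
    (forall k i, nrm mu (opent (t k)) (fun x => psi x - a (t k i))
       <= C * diam (triangle (t k)) * Num.sqrt K).
Proof.
have a1 (h H c C K : R) : 0 < h -> 0 <= H -> 0 <= K -> 0 <= C -> H <= c * h -> C * H ^+ 2 * K <= C * c ^+ 2 * h ^+ 2 * K.
  move=> h0 H0 K0 C0 Hc; apply: ler_wpM2r => //; rewrite -mulrA; apply: ler_wpM2l => //.
  by rewrite -exprMn; apply: lerXn2r; rewrite ?nnegrE//; exact: le_trans Hc.
have [N N0 hN] := closure_norm bD.
have Hm0 : 0 < 4 * N by rewrite mulr_gt0.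
have [CF CF64 hF] := friedrichs_bdry oD bD lD Hm0.
have CFp : 0 < CF by apply: lt_le_trans CF64.
have CF0 : 0 <= CF := ltW CFp.
set c := (8 * S) ^+ Num.bound ((16 * S) ^+ 2).
have c1 : 1 <= c.
  by apply: exprn_ege1; apply: le_trans S1 _; apply: ler_peMl; rewrite ?ler1n// (le_trans ler01).
pose C := CF * c ^+ 2.
have C0 : 0 < C by rewrite mulr_gt0// exprn_gt0// (lt_le_trans ltr01).
exists (Num.sqrt C); first by rewrite sqrtr_gt0.
move=> m t tri ft psi K tp EK; have nd := tri_nondeg tri.
have K0 : 0 <= K by apply: le_trans (ltW EK); exact: energy_ge0.
have hk0 k : 0 < diam (triangle (t k)) := diam_gt0 (nd k).
have hkm k : diam (triangle (t k)) <= 4 * N.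
  have L (p q r : R) : p <= q + r -> q < N -> r < N -> 2 * p <= 4 * N by lra.
  apply: (diam_le _ (nd k)) => x y Tx Ty; apply: le_trans (vnorm_le_norm _) _.
  by apply: L (ler_normB _ _) (hN _ _) (hN _ _); exact: (tri_sub tri (k := k)).
(* One scale per vertex, so that all triangles around z share a square and thus one nodal value. *)
pose Hz z := \big[Num.max/0]_(k | `[< triangle (t k) z >]) diam (triangle (t k)).
have Hz_ge z k : triangle (t k) z -> diam (triangle (t k)) <= Hz z.
  by move=> Tz; apply: le_bigmax_cond; exact/asboolP.
have Hz_m z : Hz z <= 4 * N by apply: bigmax_le => [|k _]; [exact: ltW|exact: hkm].
have Hz_c z k i : D z -> t k i = z -> Hz z <= c * diam (triangle (t k)).
  move=> Dz e; apply: bigmax_le => [|l /asboolP Tl].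
    by rewrite mulr_ge0// ltW// (lt_le_trans ltr01).
  exact: (comparable_diam tri S1 ft oD Dz e Tl).
(* A vertex is good when its hat function vanishes off D; a vertex off D is bad, its hat function
   being 1 there. *)
pose good z := forall k i x, t k i = z -> triangle (t k) x -> ~ D x -> bary (t k) i x = 0.
have /choice[a ha] : forall z, exists a, (good z -> 0 < Hz z ->
    nsq mu (Q z (Hz z)) (fun x => psi x - a) <= 64 * Hz z ^+ 2 * K) /\ (~ good z -> a = 0).
  move=> z; have [g|ng] := pselect (good z); last by exists 0.
  have [H0|H0] := ltP 0 (Hz z); last first.
    by exists 0; split => // _ H1; move: H0; rewrite leNgt H1.
  by have [b hb] := poincare_local z tp H0 EK; exists b.
exists a; split => [k i x Tx nx|k i].
  have [g|ng] := pselect (good (t k i)); first by rewrite (g k i x)// mul0r.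
  by rewrite (ha _).2// mulr0.
set z := t k i; have Tkz : triangle (t k) z by exact: (triangle_vertex (nd k) i).
have sub (H : R) : diam (triangle (t k)) <= H -> opent (t k) `<=` Q z H.
  move=> hH x /opent_sub -/(_ (nd k)) Tx; apply: box_norm.
  apply: le_lt_trans (norm_le_vnorm _) _; apply: le_lt_trans (le_diam (nd k) Tx Tkz) _.
  apply: (le_lt_trans hH); rewrite ltr_pMl ?ltr1n//; exact: (lt_le_trans (hk0 k) hH).
have mono (H b : R) : diam (triangle (t k)) <= H ->
    nsq mu (opent (t k)) (fun x => psi x - b) <= nsq mu (Q z H) (fun x => psi x - b).
  move=> hH; apply: nsqS; [exact: (open_mplane (@box_open R _ _))| | exact: sub |].
    by apply: open_mplane; exact: opent_open.
  by apply: sqint_shift tp; [exact: box_open|exact: bounded_Q].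
have fin (H b : R) : diam (triangle (t k)) <= H -> H <= c * diam (triangle (t k)) ->
    nsq mu (Q z H) (fun x => psi x - b) <= CF * H ^+ 2 * K ->
    nrm mu (opent (t k)) (fun x => psi x - b) <= Num.sqrt C * diam (triangle (t k)) * Num.sqrt K.
  move=> h1 h2 h3; apply: nrm_le_sqrt; [exact: ltW|exact: ltW|].
  apply: le_trans (mono H b h1) _; apply: le_trans h3 _.
  by apply: a1 => //; exact: le_trans (ltW (hk0 k)) h1.
have sub0 (H : R) : nsq mu (Q z H) (fun x => psi x - 0) = nsq mu (Q z H) psi.
  by apply: eq_Rintegral => x _; rewrite subr0.
have [Dz|nz] := pselect (D z).
  have Hz0 : 0 < Hz z := lt_le_trans (hk0 k) (Hz_ge _ _ Tkz).
  apply: (fin (Hz z)); [exact: Hz_ge|exact: (Hz_c _ _ _ Dz erefl)|].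
  have [g|ng] := pselect (good z).
    apply: le_trans ((ha z).1 g Hz0) _; apply: ler_wpM2r => //; apply: ler_wpM2r => //.
    exact: sqr_ge0.
  rewrite ((ha z).2 ng) sub0.
  (* A bad vertex in D has a boundary point x0 in one of its triangles, hence within [Hz z], and
     Friedrichs' inequality applies. *)
  have [k' [i' [x0 [e Tx0 nx0]]]] : exists k' i' x0, [/\ t k' i' = z, triangle (t k') x0 & ~ D x0].
    apply: contrapT => h; apply: ng => k' i' x0 e Tx0 nx0; exfalso; apply: h.
    by exists k', i', x0.
  apply: (hF _ _ x0) => //; first by rewrite Hz0 Hz_m.
    by apply/(bdryP oD); split => //; exact: (tri_sub tri Tx0).
  have Tz' : triangle (t k') z by rewrite -e; exact: (triangle_vertex (nd k') i').
  apply: le_trans (norm_le_vnorm _) _; apply: le_trans (le_diam (nd k') Tx0 Tz') _.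
  exact: Hz_ge.
have ng : ~ good z.
  move=> /(_ k i z erefl Tkz nz) /eqP; by rewrite (bary_vertex (nd k)) eqxx oner_eq0.
apply: (fin (diam (triangle (t k)))) => //.
  by apply: ler_peMl => //; exact: ltW.
rewrite ((ha z).2 ng) sub0; apply: (hF _ _ z) => //; first by rewrite hk0 hkm.
  by apply/(bdryP oD); split => //; exact: (tri_sub tri Tkz).
by rewrite subrr normr0 ltW.
Qed.

(** As the barycentric coordinates sum to 1, psi - v is the sum of the bary_i (psi - a_i), with
    factors in [0, 1]. As their gradients sum to 0, the slope of v is minus the sum of the gbary_i
    (psi - a_i); the factor 8 S / h on gbary_i cancels the h of the nodal estimate. *)
Lemma interpolation : exists2 C : R, 0 < C & forall m (t : 'I_m -> 'I_3 -> plane R),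
  triangulation D t -> (forall k, fat S (t k)) ->
  forall psi (K : R), test_function D psi -> energy D psi < K ->
  exists (v : plane R -> R) (s : 'I_m -> plane R),
  [/\ Sh0 D t v, {ae mu, forall x, forall k, opent (t k) x -> wgrad D v x = s k} &
   forall k,
   [/\ nrm mu (opent (t k)) (fun x => psi x - v x) <= C * diam (triangle (t k)) * Num.sqrt K,
     nrm mu (opent (t k)) (fun x => (grad psi x).1 - (s k).1) <= C * Num.sqrt K &
     nrm mu (opent (t k)) (fun x => (grad psi x).2 - (s k).2) <= C * Num.sqrt K]].
Proof.
have [C C0 hC] := nodal_estimate.
have S0 : 0 < S by exact: lt_le_trans S1.
pose C' := 3 * C + (1 + 3 * (8 * S * C)).
have SC0 : 0 < 8 * S * C by rewrite !mulr_gt0.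
have C'0 : 0 < C' by rewrite addr_gt0 ?mulr_gt0// addr_gt0// mulr_gt0.
have CC' : 3 * C <= C' by rewrite lerDl addr_ge0// ltW// mulr_gt0.
have SC' : 1 + 3 * (8 * S * C) <= C' by rewrite lerDr ltW// mulr_gt0.
exists C' => // m t tri ft psi K tp EK; have nd := tri_nondeg tri.
have [a [a0 ha]] := hC m t tri ft psi K tp EK.
have [hH hG] := interp_H10 oD bD lD tri a0.
exists (interp t a), (slope t a); split; [exact: (interp_Sh0 oD bD lD tri a0)|exact: hG|move=> k].
have oT : open (opent (t k)) by exact: opent_open.
have mT := open_mplane oT.
have TD := opent_D oD lD tri (k := k).
have bT := bounded_subset TD bD.
have sA (b : R) : sqint mu (opent (t k)) (fun x => psi x - b) by exact: sqint_shift tp.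
have h0 := diam_gt0 (nd k).
have hsum : \sum_i nrm mu (opent (t k)) (fun x => psi x - a (t k i))
    <= 3 * (C * diam (triangle (t k)) * Num.sqrt K).
  rewrite sum3 (_ : 3 * _ = C * diam (triangle (t k)) * Num.sqrt K + C * diam (triangle (t k)) * Num.sqrt K
    + C * diam (triangle (t k)) * Num.sqrt K); last by ring.
  by apply: lerD; [apply: lerD|]; exact: ha.
have K0 : 0 <= Num.sqrt K := sqrtr_ge0 K.
have comp (dg : plane R -> R) (gb : 'I_3 -> R) : sqint mu (opent (t k)) dg ->
    nrm mu (opent (t k)) dg <= Num.sqrt K -> \sum_i gb i = 0 ->
    (forall i, `|gb i| <= 8 * S / diam (triangle (t k))) ->
    nrm mu (opent (t k)) (fun x => dg x - \sum_i a (t k i) * gb i) <= C' * Num.sqrt K.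
  move=> sdg ndg g0 gle.
  have -> : nrm mu (opent (t k)) (fun x => dg x - \sum_i a (t k i) * gb i) =
      nrm mu (opent (t k)) (fun x => dg x + \sum_i gb i * (psi x - a (t k i))).
    congr nrm; apply/funext => x; congr (_ + _).
    under [RHS]eq_bigr do rewrite mulrBr.
    rewrite sumrB -mulr_suml g0 mul0r sub0r; congr (- _).
    by apply: eq_bigr => i _; rewrite mulrC.
  have sS : forall i, sqint mu (opent (t k)) (fun x => gb i * (psi x - a (t k i))).
    by move=> i; exact: sqintZ.
  apply: le_trans (nrmD mT sdg (sqint_sum _ mT sS)) _.
  apply: le_trans (ler_wpM2r K0 SC'); rewrite mulrDl mul1r; apply: lerD => //.
  apply: le_trans (nrm_sum _ mT sS) _.
  apply: (@le_trans _ _ (\sum_i 8 * S / diam (triangle (t k)) * nrm mu (opent (t k)) (fun x => psi x - a (t k i)))).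
    by apply: ler_sum => i _; rewrite nrmZ//; apply: ler_wpM2r (gle i); exact: nrm_ge0.
  rewrite -mulr_sumr; apply: le_trans (ler_wpM2l _ hsum) _.
    by rewrite divr_ge0// ?ltW// mulr_gt0.
  by rewrite le_eqVlt; apply/orP; left; apply/eqP; field; rewrite gt_eqF.
have nE (f : plane R -> R) : nsq mu (opent (t k)) f <= nsq mu D f -> nsq mu D f <= energy D psi ->
    nrm mu (opent (t k)) f <= Num.sqrt K.
  by move=> h1 h2; apply: ler_wsqrtr; exact: le_trans h1 (le_trans h2 (ltW EK)).
have gv i : vnorm (gbary (t k) i) <= 8 * S / diam (triangle (t k)).
  exact: (vnorm_gbary S0 (nd k) (ft k) i).
split.
- apply: le_trans (_ : _ <= 3 * (C * diam (triangle (t k)) * Num.sqrt K)) _; last first.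
    by rewrite mulrA [3 * _]mulrA; apply: ler_wpM2r => //; apply: ler_wpM2r => //; exact: ltW.
  apply: le_trans hsum.
  have sS : forall i, sqint mu (opent (t k)) (fun x => `|psi x - a (t k i)|).
    by move=> i; exact: sqint_abs.
  have -> : \sum_i nrm mu (opent (t k)) (fun x => psi x - a (t k i)) =
      \sum_i nrm mu (opent (t k)) (fun x => `|psi x - a (t k i)|).
    apply: eq_bigr => i _; congr Num.sqrt; apply: eq_Rintegral => x _.
    by rewrite real_normK// num_real.
  apply: le_trans (nrm_sum _ mT sS); apply: nrm_le => //; last 2 first.
  + exact: sqint_sum.
  + move=> x ox; have Tx := opent_sub (nd k) ox.
    rewrite (interpE tri _ Tx) /lin.
    have -> : psi x - \sum_i bary (t k) i x * a (t k i) = \sum_i bary (t k) i x * (psi x - a (t k i)).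
      under [RHS]eq_bigr do rewrite mulrBr.
      by rewrite sumrB -mulr_suml bary_sum mul1r.
    rewrite [leRHS]ger0_norm ?sumr_ge0//; apply: le_trans (ler_norm_sum _ _ _) _.
    apply: ler_sum => i _; rewrite normrM; apply: ler_piMl => //.
    by rewrite ger0_norm; [exact: bary_le1|exact: ltW (ox i)].
  apply: measurable_funB.
    exact: (test_sqint oT tp).1.
  apply: continuous_mplane.
  exact: lipschitz_plane_continuous (interp_lipschitz oD tri a0).
- rewrite (_ : (slope t a k).1 = \sum_i a (t k i) * (gbary (t k) i).1); last by rewrite /slope !sum3.
  apply: comp.
  + exact: (test_sqint oT (test_derive (1, 0) tp)).
  + apply: nE; last by rewrite lerDl nsq_ge0.
    exact: (nsq_test_le oT (test_derive (1, 0) tp)).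
  + by have /(congr1 fst) := gbary_sum (t k); rewrite !sum3.
  + by move=> i; apply: le_trans (gv i); exact: norm1_le_vnorm.
- rewrite (_ : (slope t a k).2 = \sum_i a (t k i) * (gbary (t k) i).2); last by rewrite /slope !sum3.
  apply: comp.
  + exact: (test_sqint oT (test_derive (0, 1) tp)).
  + apply: nE; last by rewrite lerDr nsq_ge0.
    exact: (nsq_test_le oT (test_derive (0, 1) tp)).
  + by have /(congr1 snd) := gbary_sum (t k); rewrite !sum3.
  + by move=> i; apply: le_trans (gv i); exact: norm2_le_vnorm.
Qed.

End interpolation.

(** * Residual estimate *)

Section residual.
Variable R : realType.
Local Notation mu := (mu2 R).
Implicit Types (f g h u v : plane R -> R).

Section inner_product.
Variable D : set (plane R).
Hypothesis oD : open D.
Let mD : measurable (D : set (mplane R)). Proof. exact: open_mplane. Qed.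

Lemma ipC f g : ip D f g = ip D g f.
Proof. by apply: eq_Rintegral => x _; rewrite mulrC. Qed.

Lemma ipDr f g h : sqint mu D f -> sqint mu D g -> sqint mu D h ->
  ip D f (fun x => g x + h x) = ip D f g + ip D f h.
Proof.
move=> sf sg sh; rewrite /ip -(RintegralD mD (sqint_mul mD sf sg) (sqint_mul mD sf sh)).
by apply: eq_Rintegral => x _; rewrite mulrDr.
Qed.

Lemma ipNr f g : sqint mu D f -> sqint mu D g -> ip D f (fun x => - g x) = - ip D f g.
Proof.
move=> sf sg; rewrite /ip -mulN1r -(RintegralZl _ mD (sqint_mul mD sf sg)).
by apply: eq_Rintegral => x _; rewrite mulN1r mulrN.
Qed.

Lemma ipBr f g h : sqint mu D f -> sqint mu D g -> sqint mu D h ->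
  ip D f (fun x => g x - h x) = ip D f g - ip D f h.
Proof.
by move=> sf sg sh; rewrite (ipDr sf sg (sqintN mD sh)) (ipNr sf sh).
Qed.

Lemma ipDl f g h : sqint mu D f -> sqint mu D g -> sqint mu D h ->
  ip D (fun x => g x + h x) f = ip D g f + ip D h f.
Proof. by move=> sf sg sh; rewrite ipC (ipDr sf sg sh) ipC [X in _ + X]ipC. Qed.

Lemma ipBl f g h : sqint mu D f -> sqint mu D g -> sqint mu D h ->
  ip D (fun x => g x - h x) f = ip D g f - ip D h f.
Proof. by move=> sf sg sh; rewrite ipC (ipBr sf sg sh) ipC [X in _ - X]ipC. Qed.

Lemma ip_ae f g h : sqint mu D f -> sqint mu D g -> sqint mu D h ->
  {ae mu, forall x, D x -> g x = h x} -> ip D f g = ip D f h.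
Proof.
move=> sf sg sh gh; rewrite /ip /Rintegral; congr fine; apply: ae_eq_integral => //.
- by apply/measurable_EFinP; apply: measurable_funM; [exact: sf.1|exact: sg.1].
- by apply/measurable_EFinP; apply: measurable_funM; [exact: sf.1|exact: sh.1].
- by apply: ae_imp gh => x e Dx; rewrite e.
Qed.

Lemma ip_le f g : sqint mu D f -> sqint mu D g -> ip D f g <= nrm mu D f * nrm mu D g.
Proof. by move=> sf sg; apply: le_trans (ler_norm _) (cauchy_schwarz mD sf sg). Qed.

Lemma ipvE (F G : plane R -> plane R) : sqint2 D F -> sqint2 D G ->
  ipv D F G = ip D (fun x => (F x).1) (fun x => (G x).1) + ip D (fun x => (F x).2) (fun x => (G x).2).
Proof.
move=> [F1 F2] [G1 G2].
by rewrite /ip -(RintegralD mD (sqint_mul mD F1 G1) (sqint_mul mD F2 G2)).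
Qed.

(** Up to a null set D is the disjoint union of the cells, so the integral of |f g| splits and
    Cauchy-Schwarz is used on each cell. *)
Lemma ip_cells m (tau : 'I_m -> set (plane R)) f g : (forall k, open (tau k)) ->
  (forall k, tau k `<=` D) -> (forall k l x, tau k x -> tau l x -> k = l) ->
  {ae mu, forall x, D x -> exists k, tau k x} -> sqint mu D f -> sqint mu D g ->
  ip D f g <= \sum_k nrm mu (tau k) f * nrm mu (tau k) g.
Proof.
move=> ot tD dt aeD sf sg; have mt k := open_mplane (ot k).
pose h x := `|f x * g x|.
have ih : mu.-integrable D (EFin \o h) by exact: integrable_norm (sqint_mul mD sf sg).
pose U := \big[setU/set0]_(k <- index_enum 'I_m) tau k.
have UE x : U x <-> exists k, tau k x.
  rewrite /U -bigcup_seq; split => [[k _ ?]|[k ?]]; first by exists k.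
  by exists k => //=; rewrite mem_index_enum.
have mU : measurable (U : set (mplane R)) by apply: bigsetU_measurable => k _; exact: mt.
have mN : measurable (D `\` U : set (mplane R)) by exact: measurableD.
have N0 : mu (D `\` U) = 0%E.
  apply: measure_negligible => //; apply: negligibleS aeD => x [Dx nU] /= H.
  by apply: nU; apply/UE; exact: H.
have mh : measurable_fun D (EFin \o h : mplane R -> \bar R) by case/integrableP: ih.
have UD : U `<=` D by move=> x /UE[k]; exact: tD.
have E : (\int[mu]_(x in D) (h x)%:E = \sum_k \int[mu]_(x in tau k) (h x)%:E)%E.
  rewrite (ge0_negligible_integral mN mD mh _ N0); last by move=> x _; rewrite lee_fin normr_ge0.
  rewrite setDD setIidr//; apply: ge0_integral_bigsetU => //.
  - exact: index_enum_uniq.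
  - by move=> k l _ _ [x [xk xl]]; exact: dt xk xl.
  - exact: (measurable_funS mD UD mh).
  - by move=> x _; rewrite lee_fin normr_ge0.
apply: (le_trans (ler_norm _)).
apply: (le_trans (le_normr_Rintegral mD (sqint_mul mD sf sg))).
have F k : (\int[mu]_(x in tau k) (h x)%:E)%E = (\int[mu]_(x in tau k) h x)%:E.
  rewrite /Rintegral fineK//; apply: integrable_fin_num; first exact: mt.
  exact: (integrableS mD (mt k) (tD k) ih).
rewrite /Rintegral [X in fine X]E (eq_bigr _ (fun k _ => F k)) sumEFin [fine _]/=.
apply: ler_sum => k _.
have sfk := sqintS mD (mt k) (tD k) sf; have sgk := sqintS mD (mt k) (tD k) sg.
have abs u : sqint mu (tau k) u -> nrm mu (tau k) (fun x => `|u x|) = nrm mu (tau k) u.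
  by move=> su; congr Num.sqrt; apply: eq_Rintegral => x _; rewrite real_normK// num_real.
rewrite -(abs f)// -(abs g)//.
apply: le_trans (le_trans (ler_norm _) (cauchy_schwarz (mt k) (sqint_abs (mt k) sfk) (sqint_abs (mt k) sgk))).
rewrite le_eqVlt; apply/orP; left; apply/eqP.
by apply: eq_Rintegral => x _; rewrite -normrM.
Qed.

End inner_product.

(** * Coercivity with the coefficient eps *)

Section absorption.
Variables (D : set (plane R)) (eps : plane R -> R) (eps0 eps1 : R).
Hypotheses (oD : open D) (meps : measurable_fun D (eps : mplane R -> R)).
Hypotheses (e0 : 0 < eps0) (heps : forall x, D x -> eps0 <= eps x <= eps1).
Let mD : measurable (D : set (mplane R)). Proof. exact: open_mplane. Qed.

Let eps_le x : D x -> `|eps x| <= `|eps1|.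
Proof.
move=> /heps/andP[h1 h2]; have h : 0 <= eps x by exact: le_trans (ltW e0) h1.
by rewrite !ger0_norm//; exact: le_trans h2.
Qed.

Lemma sqint_eps g : sqint mu D g -> sqint mu D (fun x => eps x * g x).
Proof.
move=> sg; apply: (sqint_le mD _ (sqintZ eps1 mD sg)).
  by apply: measurable_funM => //; exact: sg.1.
by move=> x Dx; rewrite !normrM ler_wpM2r// eps_le.
Qed.

Lemma nrm_eps g : sqint mu D g -> nrm mu D (fun x => eps x * g x) <= `|eps1| * nrm mu D g.
Proof.
move=> sg; rewrite -nrmZ//; apply: nrm_le => //; first exact: (sqint_eps sg).1.
  exact: sqintZ.
by move=> x Dx; rewrite !normrM ler_wpM2r// eps_le.
Qed.

Lemma ip_eps_ge g : sqint mu D g -> eps0 * nsq mu D g <= ip D (fun x => eps x * g x) g.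
Proof.
move=> sg; rewrite /nsq -(RintegralZl _ mD (sqint_sqr mD sg)); apply: le_Rintegral => //.
- exact: integrableRZ (sqint_sqr mD sg).
- exact: sqint_mul mD (sqint_eps sg) sg.
- move=> x Dx; rewrite -mulrA -expr2; apply: ler_wpM2r; first exact: sqr_ge0.
  by have /andP[] := heps Dx.
Qed.

(* Testing with psi close to u in H1 gives eps0 |grad u|^2 <= M |grad u| in the limit. *)
Lemma absorb u (M : R) : H10 D u -> 0 <= M ->
  (forall psi (K : R), test_function D psi -> energy D psi < K ->
    ip D (fun x => eps x * (wgrad D u x).1) (fun x => (grad psi x).1) +
    ip D (fun x => eps x * (wgrad D u x).2) (fun x => (grad psi x).2) <= M * Num.sqrt K) ->
  eps0 * gnrm D (wgrad D u) <= M.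
Proof.
have L1 (a x y d p q : R) : 0 <= a -> 0 <= x -> 0 <= y -> x <= a -> y <= a -> 0 < d -> a ^+ 2 = x ^+ 2 + y ^+ 2 -> 0 <= p -> 0 <= q ->
    p <= x + d -> q <= y + d -> p ^+ 2 + q ^+ 2 < (a + 3 * d) ^+ 2.
  move=> a0 x0 y0 xa ya d0 E p0 q0 px qy.
  have h1 : p ^+ 2 <= (x + d) ^+ 2 by apply: lerXn2r; rewrite ?nnegrE// ltW// ltr_wpDl.
  have h2 : q ^+ 2 <= (y + d) ^+ 2 by apply: lerXn2r; rewrite ?nnegrE// ltW// ltr_wpDl.
  have h3 : x * d <= a * d by apply: ler_wpM2r => //; exact: ltW.
  have h4 : y * d <= a * d by apply: ler_wpM2r => //; exact: ltW.
  have h5 : 0 < d ^+ 2 by rewrite exprn_gt0.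
  have h6 : 0 <= a * d by rewrite mulr_ge0// ltW.
  have : (a + 3 * d) ^+ 2 = x ^+ 2 + y ^+ 2 + 6 * (a * d) + 9 * d ^+ 2 by rewrite -E; ring.
  move: h1 h2; rewrite !sqrrD => h1 h2 ->; lra.
have L2 (a x y n1 n2 i1 i2 j1 j2 b1 b2 MM : R) : n1 <= i1 + j1 -> n2 <= i2 + j2 -> i1 + i2 <= MM ->
    j1 <= b1 -> j2 <= b2 -> n1 + n2 <= MM + (b1 + b2) by lra.
have L3 (A B C : R) : 0 <= C -> (forall d, 0 < d -> A <= B + d * C) -> A <= B.
  move=> C0 h; apply/ler_addgt0Pr => d d0.
  have C1 : 0 < C + 1 by rewrite ltr_wpDl.
  apply: le_trans (h (d / (C + 1)) (divr_gt0 d0 C1)) _; rewrite lerD2l -mulrA.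
  by apply: ler_piMr; [exact: ltW|rewrite mulrC ler_pdivrMr// mul1r lerDl].
move=> [Hu au] M0 hM; have [su _ sw] := H1P oD Hu; have [s1 s2] := sw.
set g := wgrad D u in sw s1 s2 hM *; set a := gnrm D g.
have a0 : 0 <= a by exact: nrm_ge0.
set x := nrm mu D (fun z => (g z).1); set y := nrm mu D (fun z => (g z).2).
have x0 : 0 <= x by exact: nrm_ge0.
have y0 : 0 <= y by exact: nrm_ge0.
have xa : x <= a by exact: (nrm1_le_gnrm oD sw).
have ya : y <= a by exact: (nrm2_le_gnrm oD sw).
have nn f : nrm mu D f ^+ 2 = nsq mu D f by rewrite sqr_sqrtr// nsq_ge0.
have aE : a ^+ 2 = x ^+ 2 + y ^+ 2 by rewrite /a (gnrm_sqr oD sw) -!nn.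
have fin : eps0 * a ^+ 2 <= M * a.
  (* The error is d times this constant: 3 M comes from the square root of K = (a + 3 d)^2, and each
     component of g - grad psi adds [|eps1| * a]. *)
  apply: (L3 _ _ (3 * M + 2 * (`|eps1| * a))).
    by rewrite addr_ge0// mulr_ge0// mulr_ge0.
  move=> d d0; have [psi tp hpsi] := au d d0.
  have [Hp aep] := test_H1 oD tp; have [Hd aed] := H1B oD Hu Hp.
  have [_ _ [sd1 sd2]] := H1P oD Hd.
  have t1 := test_sqint oD (test_derive (1, 0) tp); have t2 := test_sqint oD (test_derive (0, 1) tp).
  have aew : {ae mu, forall z, D z -> wgrad D (fun z => u z - psi z) z = g z - grad psi z}.
    by apply: ae_imp (ae_and aep aed) => z [h1 h2] Dz; rewrite h2// h1.
  have sb1 : sqint mu D (fun z => (g z).1 - (grad psi z).1) := sqintB mD s1 t1.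
  have sb2 : sqint mu D (fun z => (g z).2 - (grad psi z).2) := sqintB mD s2 t2.
  have gd : gnrm D (wgrad D (fun z => u z - psi z)) <= d.
    by apply: ltW; apply: le_lt_trans hpsi; exact: (gnrm_le_H1norm oD Hd).
  have d1 : nrm mu D (fun z => (g z).1 - (grad psi z).1) <= d.
    rewrite (ae_eq_nrm oD sb1 sd1); last by apply: ae_imp aew => z h Dz; exact: (esym (congr1 fst (h Dz))).
    exact: (le_trans (nrm1_le_gnrm oD (conj sd1 sd2)) gd).
  have d2 : nrm mu D (fun z => (g z).2 - (grad psi z).2) <= d.
    rewrite (ae_eq_nrm oD sb2 sd2); last by apply: ae_imp aew => z h Dz; exact: (esym (congr1 snd (h Dz))).
    exact: (le_trans (nrm2_le_gnrm oD (conj sd1 sd2)) gd).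
  have p1 : nrm mu D (fun z => (grad psi z).1) <= x + d.
    have -> : (fun z => (grad psi z).1) = (fun z => (g z).1 - ((g z).1 - (grad psi z).1)).
      by apply/funext => z; rewrite subKr.
    exact: (le_trans (nrmB mD s1 sb1) (lerD (lexx x) d1)).
  have p2 : nrm mu D (fun z => (grad psi z).2) <= y + d.
    have -> : (fun z => (grad psi z).2) = (fun z => (g z).2 - ((g z).2 - (grad psi z).2)).
      by apply/funext => z; rewrite subKr.
    exact: (le_trans (nrmB mD s2 sb2) (lerD (lexx y) d2)).
  (* Each component of grad psi has norm at most d more than that of g; 3 d leaves room for a strict
     inequality. *)
  have EK : energy D psi < (a + 3 * d) ^+ 2.
    rewrite /energy -!nn; apply: (L1 a x y d) => //; exact: nrm_ge0.
  have := hM psi _ tp EK; rewrite sqrtr_sqr ger0_norm; last by rewrite addr_ge0// mulr_ge0// ltW.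
  move=> hI; have se1 := sqint_eps s1; have se2 := sqint_eps s2.
  have k1 : eps0 * nsq mu D (fun z => (g z).1) <=
      ip D (fun z => eps z * (g z).1) (fun z => (grad psi z).1) +
      ip D (fun z => eps z * (g z).1) (fun z => (g z).1 - (grad psi z).1).
    by apply: le_trans (ip_eps_ge s1) _; rewrite (ipBr oD se1 s1 t1) addrC subrK.
  have k2 : eps0 * nsq mu D (fun z => (g z).2) <=
      ip D (fun z => eps z * (g z).2) (fun z => (grad psi z).2) +
      ip D (fun z => eps z * (g z).2) (fun z => (g z).2 - (grad psi z).2).
    by apply: le_trans (ip_eps_ge s2) _; rewrite (ipBr oD se2 s2 t2) addrC subrK.
  have bnd (f h : plane R -> R) (n : R) : sqint mu D f -> sqint mu D h -> nrm mu D f <= n -> n <= a -> nrm mu D h <= d ->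
      ip D (fun z => eps z * f z) h <= `|eps1| * a * d.
    move=> sf sh fn na hd; apply: le_trans (ip_le oD (sqint_eps sf) sh) _.
    apply: ler_pM => //; try exact: nrm_ge0.
    by apply: le_trans (nrm_eps sf) _; apply: ler_wpM2l => //; exact: le_trans na.
  rewrite aE !nn mulrDr.
  apply: le_trans (L2 0 0 0 _ _ _ _ _ _ _ _ _ k1 k2 hI (bnd _ _ x s1 sb1 (lexx _) xa d1) (bnd _ _ y s2 sb2 (lexx _) ya d2)) _.
  by rewrite le_eqVlt; apply/orP; left; apply/eqP; ring.
have [->|an] := eqVneq a 0; first by rewrite mulr0.
by move: fin; rewrite expr2 mulrA ler_pM2r// lt_neqAle eq_sym an.
Qed.

End absorption.

(** * The residual functional on test functions *)

Section residual_estimate.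
Variable D : set (plane R).
Hypotheses (oD : open D) (bD : bounded_set D) (lD : lipschitz_boundary D).
Variable S : R.
Hypothesis S1 : 1 <= S.
Let mD : measurable (D : set (mplane R)). Proof. exact: open_mplane. Qed.

(** Orthogonality replaces psi by psi - v. Cell by cell, r then meets the L2 error, which carries
    the diameter, while d1 and d2 meet the gradient errors; the bounds on the errors do not depend
    on the cell otherwise, so they factor out of the sum. *)
Lemma residual_estimate : exists2 C : R, 0 < C & forall m (t : 'I_m -> 'I_3 -> plane R),
  triangulation D t -> (forall k, fat S (t k)) -> forall r d1 d2 : plane R -> R,
  sqint mu D r -> sqint mu D d1 -> sqint mu D d2 ->
  (forall v, Sh0 D t v ->
    ip D r v + ip D d1 (fun x => (wgrad D v x).1) + ip D d2 (fun x => (wgrad D v x).2) = 0) ->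
  forall psi (K : R), test_function D psi -> energy D psi < K ->
  ip D r psi + ip D d1 (fun x => (grad psi x).1) + ip D d2 (fun x => (grad psi x).2) <=
  C * (\sum_k (diam (triangle (t k)) * nrm mu (opent (t k)) r + nrm mu (opent (t k)) d1
               + nrm mu (opent (t k)) d2)) * Num.sqrt K.
Proof.
have L (a b c a' b' c' : R) : a' + b' + c' = 0 -> a + b + c = (a - a') + (b - b') + (c - c') by lra.
have [C C0 hC] := interpolation oD bD lD S1; exists C => // m t tri ft r d1 d2 sr s1 s2 orth psi K tp EK.
have [v [s [Sv aes hk]]] := hC m t tri ft psi K tp EK.
have nd := tri_nondeg tri; have [sv _ [w1 w2]] := H1P oD Sv.2.1.
have sp := test_sqint oD tp.
have t1 : sqint mu D (fun x => (grad psi x).1) := test_sqint oD (test_derive (1, 0) tp).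
have t2 : sqint mu D (fun x => (grad psi x).2) := test_sqint oD (test_derive (0, 1) tp).
have -> : ip D r psi + ip D d1 (fun x => (grad psi x).1) + ip D d2 (fun x => (grad psi x).2) =
    ip D r (fun x => psi x - v x) + ip D d1 (fun x => (grad psi x).1 - (wgrad D v x).1) +
    ip D d2 (fun x => (grad psi x).2 - (wgrad D v x).2).
  rewrite (ipBr oD sr sp sv) (ipBr oD s1 t1 w1) (ipBr oD s2 t2 w2).
  exact: (L _ _ _ _ _ _ (orth v Sv)).
have ot k : open (opent (t k)) by exact: opent_open.
have cells f g := @ip_cells D oD m (fun k => opent (t k)) f g ot (opent_D oD lD tri)
  (opent_disjoint tri) (ae_opent tri).
have step f g (c : 'I_m -> R) : sqint mu D f -> sqint mu D g ->
    (forall k, nrm mu (opent (t k)) g <= C * c k * Num.sqrt K) ->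
    ip D f g <= C * (\sum_k c k * nrm mu (opent (t k)) f) * Num.sqrt K.
  move=> sf sg hg; apply: le_trans (cells f g sf sg) _.
  rewrite mulr_sumr mulr_suml; apply: ler_sum => k _.
  apply: le_trans (ler_wpM2l (nrm_ge0 _ _ _) (hg k)) _.
  by rewrite le_eqVlt; apply/orP; left; apply/eqP; ring.
have restr k g : sqint mu D g -> sqint mu (opent (t k)) g.
  by apply: sqintS => //; [exact: open_mplane|exact: (opent_D oD lD tri)].
have -> : C * (\sum_k (diam (triangle (t k)) * nrm mu (opent (t k)) r + nrm mu (opent (t k)) d1
      + nrm mu (opent (t k)) d2)) * Num.sqrt K =
    C * (\sum_k diam (triangle (t k)) * nrm mu (opent (t k)) r) * Num.sqrt K +
    C * (\sum_k 1 * nrm mu (opent (t k)) d1) * Num.sqrt K +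
    C * (\sum_k 1 * nrm mu (opent (t k)) d2) * Num.sqrt K.
  have one (c : 'I_m -> R) : \sum_k 1 * c k = \sum_k c k by apply: eq_bigr => k _; rewrite mul1r.
  by rewrite !big_split /= !one !mulrDr !mulrDl.
apply: lerD; [apply: lerD|]; apply: step.
- exact: sr.
- exact: (sqintB mD sp sv).
- by move=> k; have [] := hk k.
- exact: s1.
- exact: (sqintB mD t1 w1).
- move=> k; rewrite mulr1; have [_ h _] := hk k; apply: le_trans h.
  have sk : sqint mu (opent (t k)) (fun x => (grad psi x).1 - (wgrad D v x).1) := restr k _ (sqintB mD t1 w1).
  rewrite le_eqVlt; apply/orP; left; apply/eqP; apply: (ae_eq_nrm (ot k) sk); first exact: (sqint_shift _ (ot k) (bounded_subset (opent_D oD lD tri (k := k)) bD) (test_derive (1, 0) tp)).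
  by apply: ae_imp aes => x h' ok; exact: (congr1 (fun w => (grad psi x).1 - w.1) (h' k ok)).
- exact: s2.
- exact: (sqintB mD t2 w2).
- move=> k; rewrite mulr1; have [_ _ h] := hk k; apply: le_trans h.
  have sk : sqint mu (opent (t k)) (fun x => (grad psi x).2 - (wgrad D v x).2) := restr k _ (sqintB mD t2 w2).
  rewrite le_eqVlt; apply/orP; left; apply/eqP; apply: (ae_eq_nrm (ot k) sk); first exact: (sqint_shift _ (ot k) (bounded_subset (opent_D oD lD tri (k := k)) bD) (test_derive (0, 1) tp)).
  by apply: ae_imp aes => x h' ok; exact: (congr1 (fun w => (grad psi x).2 - w.2) (h' k ok)).
Qed.

End residual_estimate.
End residual.

(** * The recovered flux and integration by parts *)

Section averaging.
Variable R : realType.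
Local Notation mu := (mu2 R).
Variable D : set (plane R).
Hypothesis oD : open D.
Let mD : measurable (D : set (mplane R)). Proof. exact: open_mplane. Qed.

Lemma smooth_on_measurable (f : plane R -> R) : smooth_on (closure D) (f : _ -> R^o) ->
  measurable_fun D (f : mplane R -> R).
Proof.
move=> [F [/(_ 0%N)[cF _] fF]]; apply: (eq_measurable_fun (F : mplane R -> R)).
  by move=> x; rewrite inE => Dx; rewrite fF//; exact: subset_closure.
exact: continuous_mplane.
Qed.

Lemma H1_0 : H1 D (fun=> 0).
Proof.
have t0 : test_function D (fun=> 0).
  by split; [move=> k; exact: Ck_cst|exists set0; split => //; exact: compact0].
by have [] := test_H1 oD t0.
Qed.

Lemma H1_sum (I : Type) (s : seq I) (w : I -> plane R -> R) (c : I -> R) :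
  (forall z, H1 D (w z)) -> H1 D (fun x => \sum_(z <- s) w z x * c z).
Proof.
move=> hw; elim: s => [|z s IH]; first by under eq_fun do rewrite big_nil; exact: H1_0.
under eq_fun do rewrite big_cons mulrC.
by have [] := H1_lin oD (c z) (hw z) IH.
Qed.

(** [nodal] is a choice with default 0, and the zero function is in H1 as well. *)
Lemma H1_nodal m (t : 'I_m -> 'I_3 -> plane R) z : H1 D (nodal D t z).
Proof.
rewrite /nodal; case: xgetP => [v _ [[Hv _] _]//|_]; exact: H1_0.
Qed.

Lemma H1_Gh m (t : 'I_m -> 'I_3 -> plane R) wt (eps v : plane R -> R) :
  H1 D (fun x => (Gh D t wt eps v x).1) /\ H1 D (fun x => (Gh D t wt eps v x).2).
Proof.
pose c z : plane R := \sum_(k < m | z \in triangle (t k)) (wt z k * eps z) *: grad_on (triangle (t k)) v.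
split.
- have -> : (fun x => (Gh D t wt eps v x).1) = (fun x => \sum_(z <- vertices t) nodal D t z x * (c z).1).
    by apply/funext => x; rewrite /Gh (big_morph fst (fun _ _ => erefl) erefl).
  by apply: H1_sum => z; exact: H1_nodal.
- have -> : (fun x => (Gh D t wt eps v x).2) = (fun x => \sum_(z <- vertices t) nodal D t z x * (c z).2).
    by apply/funext => x; rewrite /Gh (big_morph snd (fun _ _ => erefl) erefl).
  by apply: H1_sum => z; exact: H1_nodal.
Qed.

Lemma ip_sum_le n (q : 'I_n -> R) (u : 'I_n -> plane R -> R) (v : plane R -> R) :
  (forall i, sqint mu D (u i)) -> sqint mu D v ->
  ip D (fun x => \sum_i q i * u i x) v <= (\sum_i `|q i|) * (\sum_i nrm mu D (u i)) * nrm mu D v.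
Proof.
move=> su sv; have sZ i : sqint mu D (fun x => q i * u i x) by exact: sqintZ.
apply: le_trans (ip_le oD (sqint_sum _ mD sZ) sv) _; apply: ler_wpM2r; first exact: nrm_ge0.
apply: le_trans (nrm_sum _ mD sZ) _; rewrite mulr_suml; apply: ler_sum => i _.
rewrite nrmZ//; apply: ler_wpM2l => //; rewrite (bigD1 i)//= lerDl.
by apply: sumr_ge0 => j _; exact: nrm_ge0.
Qed.

Lemma ipv_test (F : plane R -> plane R) psi : sqint2 D F -> test_function D psi ->
  ipv D F (wgrad D psi) = ip D (fun x => (F x).1) (fun x => (grad psi x).1) +
    ip D (fun x => (F x).2) (fun x => (grad psi x).2).
Proof.
move=> sF tp; have [Hp aep] := test_H1 oD tp; have [_ _ [w1 w2]] := H1P oD Hp.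
have t1 : sqint mu D (fun x => (grad psi x).1) := test_sqint oD (test_derive (1, 0) tp).
have t2 : sqint mu D (fun x => (grad psi x).2) := test_sqint oD (test_derive (0, 1) tp).
rewrite (ipvE oD sF (conj w1 w2)); congr (_ + _).
- by apply: (ip_ae oD sF.1 w1 t1); apply: ae_imp aep => x h Dx; exact: (congr1 fst (h Dx)).
- by apply: (ip_ae oD sF.2 w2 t2); apply: ae_imp aep => x h Dx; exact: (congr1 snd (h Dx)).
Qed.

(** Here e1, e2 are to be the components of [eps *: wgrad phih], and G1, G2 those of the recovered
    flux, which cancels since (div G, v) = - (G, grad v) for v in H10. *)
Lemma recovered_residual (F e1 e2 G1 G2 v : plane R -> R) :
  sqint mu D F -> sqint mu D e1 -> sqint mu D e2 -> H1 D G1 -> H1 D G2 -> H10 D v ->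
  ip D (fun x => F x + ((wgrad D G1 x).1 + (wgrad D G2 x).2)) v
  + ip D (fun x => G1 x - e1 x) (fun x => (wgrad D v x).1)
  + ip D (fun x => G2 x - e2 x) (fun x => (wgrad D v x).2)
  = ip D F v - (ip D e1 (fun x => (wgrad D v x).1) + ip D e2 (fun x => (wgrad D v x).2)).
Proof.
have L (a b c p q r s : R) : p = - b -> q = - c -> a + (b + c) + (p - r) + (q - s) = a - (r + s).
  by move=> -> ->; ring.
move=> sF s1 s2 HG1 HG2 Hv.
have [sv _ [v1 v2]] := H1P oD Hv.1.
have [sG1 _ [a1 a2]] := H1P oD HG1; have [sG2 _ [b1 b2]] := H1P oD HG2.
have [i1 _] := H1_ibp oD HG1 Hv; have [_ i2] := H1_ibp oD HG2 Hv.
rewrite (ipDl oD sv sF (sqintD mD a1 b2)) (ipDl oD sv a1 b2) (ipBl oD v1 sG1 s1) (ipBl oD v2 sG2 s2).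
exact: L i1 i2.
Qed.

End averaging.

Theorem theorem1 (R : realType) (Omega : set (plane R))
    (alpha : plane R -> R -> R) (beta : plane R -> R -> plane R)
    (gamma g : plane R -> R -> R) (eps : plane R -> R) (eps0 eps1 : R)
    (n : nat) (q : 'I_n -> R) (f : plane R -> R)
    (p : 'I_n -> plane R -> R) (phi : plane R -> R) (sigma : R) :
  polygonal_lipschitz_domain Omega ->
  smooth_on (closure Omega `*` [set: R]) (fun z => alpha z.1 z.2 : R^o) ->
  smooth_on (closure Omega `*` [set: R]) (fun z => beta z.1 z.2) ->
  smooth_on (closure Omega `*` [set: R]) (fun z => gamma z.1 z.2 : R^o) ->
  smooth_on (closure Omega `*` [set: R]) (fun z => g z.1 z.2 : R^o) ->
  smooth_on (closure Omega) (eps : _ -> R^o) ->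
  0 < eps0 ->
  (forall x, closure Omega x -> eps0 <= eps x <= eps1) ->
  Lp Omega 2%:E f ->
  solution_regularity Omega alpha beta gamma g p phi ->
  weak_PNP Omega alpha beta gamma g eps q f (H10 Omega) p phi ->
  exists2 C : R, 0 < C &
    forall (m : nat) (t : 'I_m -> 'I_3 -> plane R) (wt : plane R -> 'I_m -> R)
      (ph : 'I_n -> plane R -> R) (phih : plane R -> R),
    triangulation Omega t ->
    shape_regular sigma t ->
    averaging_weights t wt ->
    weak_PNP Omega alpha beta gamma g eps q f (Sh0 Omega t) ph phih ->
    (L2vnorm Omega (wgrad Omega (fun x => (phi x - phih x)%R))
     <= C%:E * (eta_phi Omega t wt eps q f ph phih
                + \sum_(i < n) L2norm Omega (fun x => (p i x - ph i x)%R)))%E.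
Proof.
have L1 (e a c X : R) : 0 < e -> 0 <= X -> e * a <= c * X -> a <= (c + 1) / e * X.
  move=> he hX h; rewrite mulrAC ler_pdivlMr// mulrC; apply: le_trans h _.
  by rewrite mulrDl lerDl mul1r.
have L2 (i1 i2 F1 F2 I J : R) : I = F1 - (i1 + i2) -> J = F2 - (i1 + i2) -> I = (F1 - F2) + J.
  by move=> -> ->; ring.
have L4 (a b u v : R) : 0 <= a -> u <= b -> v <= b -> a + u + v <= 2 * (a + b) by lra.
have L3 (C2 Qm cf E P sK a b : R) : 0 <= C2 -> 0 <= Qm -> 0 <= cf -> 0 <= E -> 0 <= P -> 0 <= sK ->
    a <= Qm * P * (cf * sK) -> b <= C2 * (2 * E) * sK -> a + b <= (2 * C2 + Qm * cf) * (E + P) * sK.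
  move=> hC hQ hc hE hP hK ha hb.
  have -> : (2 * C2 + Qm * cf) * (E + P) * sK = C2 * (2 * E) * sK + Qm * P * (cf * sK)
      + (2 * C2 * P * sK + Qm * cf * E * sK) by ring.
  rewrite addrC; apply: ler_wpDr; last exact: lerD.
  by rewrite addr_ge0// ?mulr_ge0// mulr_ge0.
move=> [[oD _ _ bD] [_ lD]] _ _ _ _ seps e0 heps fL2 _ [Hp Hphi _ weak].
have mD : measurable (Omega : set (mplane R)) by exact: open_mplane.
have heps' x : Omega x -> eps0 <= eps x <= eps1 by move=> Dx; apply: heps; exact: subset_closure.
have meps := smooth_on_measurable seps.
have sE := sqint_eps oD meps e0 heps'.
have sf : sqint (mu2 R) Omega f by apply/(LpE _ mD).
have S1 : 1 <= Num.max sigma 1 by rewrite le_max lexx orbT.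
have [C2 C20 hC2] := residual_estimate oD bD lD S1.
have [CF CF0 hCF] := friedrichs oD bD.
set Qm := \sum_i `|q i|; have Qm0 : 0 <= Qm by apply: sumr_ge0.
(* C2 is doubled because both components of [Dh] are bounded by its full norm; [Qm * Num.sqrt CF]
   comes from the difference of the right-hand sides, with Friedrichs' inequality for psi. *)
pose c := 2 * C2 + Qm * Num.sqrt CF.
have c0 : 0 <= c by rewrite addr_ge0 ?mulr_ge0 ?sqrtr_ge0// ltW.
(* All ingredients of the constant are fixed before the mesh; the division by eps0 undoes
   coercivity. *)
exists ((c + 1) / eps0); first by rewrite divr_gt0// ltr_wpDl.
move=> m t wt ph phih tri reg _ [Hph Hphih _ weakh].
have nd := tri_nondeg tri.
have ft k : fat (Num.max sigma 1) (t k) by apply: shape_fat (nd k) (reg k).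
have [sphi _ [w1 w2]] := H1P oD Hphi.1; have [sphih _ [z1 z2]] := H1P oD Hphih.1.1.
have sp i := let: And3 h _ _ := H1P oD (Hp i).1 in h.
have sph i := let: And3 h _ _ := H1P oD (Hph i).1.1 in h.
have [HG1 HG2] := H1_Gh oD t wt eps phih.
have [sG1 _ [a1 a2]] := H1P oD HG1; have [sG2 _ [b1 b2]] := H1P oD HG2.
have sdp i : sqint (mu2 R) Omega (fun x => p i x - ph i x) := sqintB mD (sp i) (sph i).
pose F0 x := \sum_i q i * p i x + f x; pose Fh x := \sum_i q i * ph i x + f x.
have sF0 : sqint (mu2 R) Omega F0.
  by apply: (sqintD mD _ sf); apply: sqint_sum => // i; exact: (sqintZ (q i) mD (sp i)).
have sFh : sqint (mu2 R) Omega Fh.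
  by apply: (sqintD mD _ sf); apply: sqint_sum => // i; exact: (sqintZ (q i) mD (sph i)).
pose e1 x := eps x * (wgrad Omega phih x).1; pose e2 x := eps x * (wgrad Omega phih x).2.
have se1 : sqint (mu2 R) Omega e1 := sE _ z1; have se2 : sqint (mu2 R) Omega e2 := sE _ z2.
have seh : sqint2 Omega (fun x => eps x *: wgrad Omega phih x) := conj se1 se2.
have sew : sqint2 Omega (fun x => eps x *: wgrad Omega phi x) := conj (sE _ w1) (sE _ w2).
pose G1 x := (Gh Omega t wt eps phih x).1; pose G2 x := (Gh Omega t wt eps phih x).2.
have rE : R1h Omega t wt eps q f ph phih =
    (fun x => Fh x + ((wgrad Omega G1 x).1 + (wgrad Omega G2 x).2)).
  by apply/funext => x; rewrite /R1h /Fh addrAC.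
set r := R1h _ _ _ _ _ _ _ _ in rE *.
have sr : sqint (mu2 R) Omega r by rewrite rE; exact: sqintD mD sFh (sqintD mD a1 b2).
pose d1 x := G1 x - e1 x; pose d2 x := G2 x - e2 x.
have sd1 : sqint (mu2 R) Omega d1 := sqintB mD sG1 se1.
have sd2 : sqint (mu2 R) Omega d2 := sqintB mD sG2 se2.
have orth v : Sh0 Omega t v -> ip Omega r v + ip Omega d1 (fun x => (wgrad Omega v x).1)
    + ip Omega d2 (fun x => (wgrad Omega v x).2) = 0.
  move=> Sv; have [_ _ sv] := H1P oD Sv.2.1.
  have := weakh v Sv; rewrite /form_ta (ipvE oD seh sv) => h.
  rewrite rE (recovered_residual oD sFh se1 se2 HG1 HG2 Sv.2).
  by apply/eqP; rewrite subr_eq0; apply/eqP; exact: esym.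
have He : H10 Omega (fun x => phi x - phih x) := H10B oD Hphi Hphih.2.
have [_ aee] := H1B oD Hphi.1 Hphih.1.1.
have [_ _ se] := H1P oD He.1.
have oT k : open (opent (t k)) by exact: opent_open.
have sub k := opent_D oD lD tri (k := k).
have restr k u : sqint (mu2 R) Omega u -> sqint (mu2 R) (opent (t k)) u.
  exact: sqintS mD (open_mplane (oT k)) (sub k).
have sDh k : sqint2 (opent (t k)) (Dh Omega t wt eps phih) := conj (restr k _ sd1) (restr k _ sd2).
pose E := \sum_k (diam (triangle (t k)) * nrm (mu2 R) (opent (t k)) r
   + gnrm (opent (t k)) (Dh Omega t wt eps phih)).
(* The estimator is finite, so the claim becomes an inequality between real numbers. *)
have etaE : eta_phi Omega t wt eps q f ph phih = E%:E.
  rewrite /eta_phi /E -sumEFin; apply: eq_bigr => k _.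
  rewrite (interior_opent (nd k)) (L2normE (open_mplane (oT k)) (restr k _ sr)).
  by rewrite (L2vnormE (oT k) (sDh k)).
pose P := \sum_i nrm (mu2 R) Omega (fun x => p i x - ph i x).
have PE : (\sum_(i < n) L2norm Omega (fun x => (p i x - ph i x)%R) = P%:E)%E.
  by rewrite /P -sumEFin; apply: eq_bigr => i _; rewrite (L2normE mD (sdp i)).
rewrite etaE PE (L2vnormE oD se) -EFinD -EFinM lee_fin.
have E0 : 0 <= E.
  apply: sumr_ge0 => k _; apply: addr_ge0; last exact: nrm_ge0.
  by apply: mulr_ge0; [exact: ltW (diam_gt0 (nd k))|exact: nrm_ge0].
have P0 : 0 <= P by apply: sumr_ge0 => i _; exact: nrm_ge0.
apply: (L1 _ _ _ _ e0); first exact: addr_ge0.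
apply: (absorb oD meps e0 heps' He); first by apply: mulr_ge0 c0 _; exact: addr_ge0.
move=> psi K tp EK; have Hpsi := test_H10 oD tp.
have st := test_sqint oD tp.
have t1 : sqint (mu2 R) Omega (fun x => (grad psi x).1) := test_sqint oD (test_derive (1, 0) tp).
have t2 : sqint (mu2 R) Omega (fun x => (grad psi x).2) := test_sqint oD (test_derive (0, 1) tp).
have I1 : ip Omega (fun x => eps x * (wgrad Omega (fun x => phi x - phih x) x).1) (fun x => (grad psi x).1) =
    ip Omega (fun x => eps x * (wgrad Omega phi x).1) (fun x => (grad psi x).1) - ip Omega e1 (fun x => (grad psi x).1).
  rewrite -(ipBl oD t1 (sE _ w1) se1) ipC [RHS]ipC.
  apply: (ip_ae oD t1 (sE _ se.1) (sqintB mD (sE _ w1) se1)).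
  apply: ae_imp aee => x h Dx; rewrite /e1 -mulrBr.
  exact: (congr1 (fun w : plane R => eps x * w.1) (h Dx)).
have I2 : ip Omega (fun x => eps x * (wgrad Omega (fun x => phi x - phih x) x).2) (fun x => (grad psi x).2) =
    ip Omega (fun x => eps x * (wgrad Omega phi x).2) (fun x => (grad psi x).2) - ip Omega e2 (fun x => (grad psi x).2).
  rewrite -(ipBl oD t2 (sE _ w2) se2) ipC [RHS]ipC.
  apply: (ip_ae oD t2 (sE _ se.2) (sqintB mD (sE _ w2) se2)).
  apply: ae_imp aee => x h Dx; rewrite /e2 -mulrBr.
  exact: (congr1 (fun w : plane R => eps x * w.2) (h Dx)).
have W : ip Omega (fun x => eps x * (wgrad Omega phi x).1) (fun x => (grad psi x).1) +
    ip Omega (fun x => eps x * (wgrad Omega phi x).2) (fun x => (grad psi x).2) = ip Omega F0 psi.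
  by have := weak psi Hpsi; rewrite /form_ta (ipv_test oD sew tp).
have J : ip Omega r psi + ip Omega d1 (fun x => (grad psi x).1) + ip Omega d2 (fun x => (grad psi x).2) =
    ip Omega Fh psi - (ip Omega e1 (fun x => (grad psi x).1) + ip Omega e2 (fun x => (grad psi x).2)).
  have [Hp1 aep] := test_H1 oD tp; have [_ _ [p1 p2]] := H1P oD Hp1.
  have ae1 u : sqint (mu2 R) Omega u -> ip Omega u (fun x => (wgrad Omega psi x).1) = ip Omega u (fun x => (grad psi x).1).
    by move=> su; apply: (ip_ae oD su p1 t1); apply: ae_imp aep => x h Dx; exact: (congr1 fst (h Dx)).
  have ae2 u : sqint (mu2 R) Omega u -> ip Omega u (fun x => (wgrad Omega psi x).2) = ip Omega u (fun x => (grad psi x).2).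
    by move=> su; apply: (ip_ae oD su p2 t2); apply: ae_imp aep => x h Dx; exact: (congr1 snd (h Dx)).
  rewrite -(ae1 d1 sd1) -(ae2 d2 sd2) -(ae1 e1 se1) -(ae2 e2 se2) rE.
  exact: (recovered_residual oD sFh se1 se2 HG1 HG2 Hpsi).
have IE (a b u v F : R) : a + b = F -> a - u + (b - v) = F - (u + v) by move=> <-; ring.
(* The weighted product of the error gradient with grad psi splits into (F0 - Fh, psi), controlled
   by the errors on the p i, and the residual functional at psi. *)
rewrite I1 I2 (IE _ _ _ _ _ W) (L2 _ _ _ _ _ _ erefl J) -(ipBl oD st sF0 sFh).
have dF : (fun x => F0 x - Fh x) = (fun x => \sum_i q i * (p i x - ph i x)).
  apply/funext => x; rewrite /F0 /Fh opprD addrACA subrr addr0 -sumrB.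
  by apply: eq_bigr => i _; rewrite mulrBr.
have K0 : 0 <= K by apply: le_trans (ltW EK); exact: energy_ge0.
rewrite dF; apply: (L3 C2 Qm (Num.sqrt CF) E P) => //; first exact: ltW; try exact: sqrtr_ge0.
- apply: le_trans (ip_sum_le oD q sdp st) _; apply: ler_wpM2l; first exact: mulr_ge0.
  by rewrite -sqrtrM ?(ltW CF0)//; apply: ler_wsqrtr; exact: hCF.
- apply: le_trans (hC2 m t tri ft r d1 d2 sr sd1 sd2 orth psi K tp EK) _.
  apply: ler_wpM2r; first exact: sqrtr_ge0.
  apply: ler_wpM2l; first exact: ltW.
  rewrite /E mulr_sumr; apply: ler_sum => k _; apply: L4.
  + by apply: mulr_ge0; [exact: ltW (diam_gt0 (nd k))|exact: nrm_ge0].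
  + exact: (nrm1_le_gnrm (oT k) (sDh k)).
  + exact: (nrm2_le_gnrm (oT k) (sDh k)).
Qed.
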